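(* In the triangular-array exponential family setting described in the context (with $d\to\infty$ as $n\to\infty$), let $\alpha=\alpha_n\ge0$ be a sequence (possibly growing with $n$), and set $M_{d,\alpha}=(d+\alpha)\left(1+\frac{\alpha\ln(d+\alpha)}{d+\alpha}\right)$. Suppose that (i) for any fixed $c>0$, $B_{1n}(c)\sqrt{d/n}=o(1)$; (iii) $\|F^{-1}\|_{op}\,d/n=o(1)$; and that for any fixed $\bar c>0$: (ii') $\lambda_n(\bar cM_{d,\alpha}/d)\,[\bar cM_{d,\alpha}]^{1+\alpha/2}=o(1)$; (iv') the prior $\pi$ satisfies Assumption P($\bar cM_{d,\alpha}/d$) and $K_n(\bar cM_{d,\alpha}/d)\sqrt{\|F^{-1}\|_{op}[\bar cM_{d,\alpha}]^{1+\alpha}/n}=o(1)$. Then $$\int_{\mathcal U}\|u\|^\alpha\left|\pi_n^*(u)-\phi_d(u;\Delta_n,I_d)\right|du=o_p(1).$$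
   Context: All objects may depend on $n$ (triangular array); asymptotics are as $n\to\infty$. For each $n$, $\Theta\subset\mathbb R^d$ is open and convex, $d=d^{(n)}\to\infty$, and $X_1,\dots,X_n$ are i.i.d. $d$-dimensional vectors with density (with respect to a fixed dominating measure) $f(x;\theta)=h(x)\exp(\langle x,\theta\rangle-\psi(\theta))$ at the true parameter $\theta=\theta_0\in\Theta$, where $\psi$ is the (convex) normalizing function. Let $\mu=\psi'(\theta_0)$ and $F=\psi''(\theta_0)$ be the mean and the (invertible) covariance matrix of $X_i$, and $J=F^{1/2}$ the symmetric square root. $\|\cdot\|$ is the Euclidean norm, $\|\cdot\|_{op}$ the operator norm, $S^{d-1}$ the unit sphere, $B_d(\bar\theta,\varepsilon)$ the closed Euclidean ball. It is assumed that $B_d(\theta_0,\sqrt{d\|F^{-1}\|_{op}/n}\,\log n)\subset\Theta$. $\phi_d(\cdot;m,V)$ is the $d$-dimensional Gaussian density with mean $m$ and covariance $V$. Let $\mathcal U=\sqrt n J(\Theta-\theta_0)$ and $\Delta_n=\sqrt n J^{-1}\big(\frac1n\sum_{i=1}^nX_i-\mu\big)$. For a (possibly improper) prior density $\pi$ on $\Theta$, the posterior in the local parameter space is, for $u\in\mathcal U$, $$\pi_n^*(u)=\frac{\pi(\theta_0+n^{-1/2}J^{-1}u)\prod_{i=1}^nf(X_i;\theta_0+n^{-1/2}J^{-1}u)}{\int_{\mathcal U}\pi(\theta_0+n^{-1/2}J^{-1}v)\prod_{i=1}^nf(X_i;\theta_0+n^{-1/2}J^{-1}v)\,dv}.$$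 For $\theta\in\Theta$ let $V=J^{-1}(U-E_\theta[U])$ with $U\sim f(\cdot;\theta)$. For $c\ge 0$, $$B_{1n}(c)=\sup\{|E_\theta[\langle a,V\rangle^3]|:a\in S^{d-1},\ \theta\in\Theta,\ \|J(\theta-\theta_0)\|^2\le cd/n\},$$ $$B_{2n}(c)=\sup\{E_\theta[\langle a,V\rangle^4]:a\in S^{d-1},\ \theta\in\Theta,\ \|J(\theta-\theta_0)\|^2\le cd/n\},$$ $$\lambda_n(c)=\tfrac16\Big(\sqrt{\tfrac{cd}{n}}\,B_{1n}(0)+\tfrac{cd}{n}B_{2n}(c)\Big).$$ Assumption P($c_n$), for a positive sequence $c_n$: $\sup_{\theta\in\Theta}\ln[\pi(\theta)/\pi(\theta_0)]\le O(d)$, and $|\ln\pi(\theta)-\ln\pi(\theta_0)|\le K_n(c_n)\|\theta-\theta_0\|$ for every $\theta$ with $\|\theta-\theta_0\|\le\sqrt{c_n\|F^{-1}\|_{op}d/n}$, where $K_n(c_n)\sqrt{c_n\|F^{-1}\|_{op}d/n}=o(1)$. *)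

(* Defs.v *)
From HB Require Import structures.
From mathcomp Require Import all_boot all_order all_algebra.
From mathcomp Require Import all_classical all_reals all_analysis.

Set Implicit Arguments.
Unset Strict Implicit.
Unset Printing Implicit Defensive.

Import Order.TTheory GRing.Theory Num.Theory.
Import numFieldNormedType.Exports.

Local Open Scope classical_set_scope.
Local Open Scope ring_scope.

Definition measure_matrix_display : measure_display -> measure_display.
Proof. exact. Qed.

(* Matrices carry the sigma-algebra generated by their entries; on
   'cV[R]_d with R : realType this is the Borel sigma-algebra. *)
Section measurable_matrix.
Context {disp : measure_display} {T : measurableType disp}.
Variables m n : nat.

Definition mx_measurable : set (set 'M[T]_(m, n)) :=
  <<s \bigcup_(ij in [set: 'I_m * 'I_n])
      preimage_set_system setT (fun M : 'M[T]_(m, n) => M ij.1 ij.2)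
        measurable >>.

Let mx_set0 : mx_measurable set0.
Proof. exact: sigma_algebra0. Qed.

Let mx_setC A : mx_measurable A -> mx_measurable (~` A).
Proof. exact: sigma_algebraC. Qed.

Let mx_bigcup (F : (set 'M[T]_(m, n))^nat) :
  (forall i, mx_measurable (F i)) -> mx_measurable (\bigcup_i (F i)).
Proof. exact: sigma_algebra_bigcup. Qed.

HB.instance Definition _ := @isMeasurable.Build (measure_matrix_display disp)
  'M[T]_(m, n) mx_measurable mx_set0 mx_setC mx_bigcup.

Lemma measurable_mxE (i : 'I_m) (j : 'I_n) :
  measurable_fun [set: 'M[T]_(m, n)] (fun M : 'M[T]_(m, n) => M i j).
Proof.
move=> _ Y mY; apply: sub_sigma_algebra => /=.
by exists (i, j) => //; exists Y.
Qed.

Lemma measurable_fun_mxP {disp' : measure_display} {U : measurableType disp'}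
    (f : U -> 'M[T]_(m, n)) :
  (forall i j, measurable_fun [set: U] (fun u => f u i j)) ->
  measurable_fun [set: U] f.
Proof.
move=> mf; apply: (@measurability _ _ _ _ _ _
  (\bigcup_(ij in [set: 'I_m * 'I_n])
      preimage_set_system setT (fun M : 'M[T]_(m, n) => M ij.1 ij.2)
        measurable)) => //.
move=> _ [_ [[i j] _ [B mB <-]] <-].
by rewrite !setTI; have := mf i j measurableT B mB; rewrite setTI.
Qed.

End measurable_matrix.

Section lebesgue_step.
Context {R : realType} (d : nat).
Variable mu : {sigma_finite_measure set 'cV[R]_d -> \bar R}.

Definition cV_cons (p : measurableTypeR R * 'cV[R]_d) : 'cV[R]_d.+1 :=
  col_mx (p.1 : R)%:M p.2.

Definition cV_uncons (v : 'cV[R]_d.+1) : measurableTypeR R * 'cV[R]_d :=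
  (v ord0 ord0, \col_i v (lift ord0 i) ord0).

Lemma cV_cons0 p j : cV_cons p ord0 j = p.1.
Proof.
rewrite /cV_cons (_ : ord0 = lshift d (ord0 : 'I_1)); last exact/val_inj.
by rewrite (@col_mxEu R 1) (ord1 j) mxE.
Qed.

Lemma cV_consS p i j : cV_cons p (lift ord0 i) j = p.2 i j.
Proof.
rewrite /cV_cons (_ : lift _ _ = rshift 1 i); last exact/val_inj.
by rewrite (@col_mxEd R 1).
Qed.

Lemma cV_consK : cancel cV_cons cV_uncons.
Proof.
move=> p; rewrite /cV_uncons cV_cons0 [RHS]surjective_pairing; congr pair.
by apply/matrixP => i j; rewrite mxE cV_consS (ord1 j).
Qed.

Lemma measurable_cV_cons : measurable_fun setT cV_cons.
Proof.
apply: measurable_fun_mxP => i j; case: (unliftP ord0 i) => [k|] ->.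
- rewrite (_ : (fun _ => _) = (fun p : measurableTypeR R * 'cV[R]_d => p.2 k j)); last first.
    by apply/funext => p; rewrite cV_consS.
  exact: (measurableT_comp (measurable_mxE k j)).
- by rewrite (_ : (fun _ => _) = fst)//; apply/funext => p; rewrite cV_cons0.
Qed.

Lemma measurable_cV_uncons : measurable_fun [set: 'cV[R]_d.+1] cV_uncons.
Proof.
apply: measurable_fun_pair => //=; first exact: measurable_mxE.
apply: measurable_fun_mxP => i j.
rewrite (_ : (fun _ => _) = (fun v : 'cV[R]_d.+1 => v (lift ord0 i) ord0)).
  exact: measurable_mxE.
by apply/funext => v; rewrite mxE.
Qed.

Definition lebesgue_step : set 'cV[R]_d.+1 -> \bar R :=
  pushforward (lebesgue_measure \x mu)%E cV_cons.

Let lebesgue_step0 : lebesgue_step set0 = 0%E.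
Proof. by rewrite /lebesgue_step /pushforward preimage_set0 measure0. Qed.

Let lebesgue_step_ge0 A : (0 <= lebesgue_step A)%E.
Proof. by rewrite /lebesgue_step /pushforward; exact: measure_ge0. Qed.

Let lebesgue_step_sigma_additive : semi_sigma_additive lebesgue_step.
Proof.
exact: (@measure_semi_sigma_additive _ _ _
  (measure_function_pushforward__canonical__measure_function_Measure
     (lebesgue_measure \x mu)%E measurable_cV_cons)).
Qed.

HB.instance Definition _ := isMeasure.Build _ _ _ lebesgue_step
  lebesgue_step0 lebesgue_step_ge0 lebesgue_step_sigma_additive.

Let lebesgue_step_sigma_finite : sigma_finite setT lebesgue_step.
Proof.
have /sigma_finiteP[F [TF ndF Foo]] := sigma_finiteT (@lebesgue_measure R).
have /sigma_finiteP[G [TG ndG Goo]] := sigma_finiteT mu.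
exists (fun k => cV_uncons @^-1` (F k `*` G k)).
  rewrite -preimage_bigcup (_ : \bigcup_k _ = setT) ?preimage_setT//.
  apply/seteqP; split => // -[x y] _.
  have [n _ Fnx] : (\bigcup_n F n) x by rewrite -TF.
  have [k _ Gky] : (\bigcup_k G k) y by rewrite -TG.
  exists (maxn n k) => //; split => /=.
  - by move: x Fnx; exact/subsetPset/ndF/leq_maxl.
  - by move: y Gky; exact/subsetPset/ndG/leq_maxr.
move=> k; have [mF Fkoo] := Foo k; have [mG Gkoo] := Goo k; split.
  by rewrite -[X in measurable X]setTI; apply: measurable_cV_uncons => //;
    exact: measurableX.
rewrite /lebesgue_step /pushforward -comp_preimage.
rewrite (_ : _ \o _ = id); last by apply/funext => p; exact: cV_consK.
by rewrite preimage_id product_measure1E// lte_mul_pinfty// ge0_fin_numE.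
Qed.

HB.instance Definition _ := Measure_isSigmaFinite.Build _ _ _ lebesgue_step
  lebesgue_step_sigma_finite.

End lebesgue_step.

(* d-dimensional Lebesgue measure, as the d-fold product of the
   one-dimensional one. *)
Fixpoint lebesgue_cV (R : realType) (d : nat) :
    {sigma_finite_measure set 'cV[R]_d -> \bar R} :=
  match d with
  | 0 => dirac (0 : 'cV[R]_0)
  | d'.+1 => lebesgue_step (lebesgue_cV R d')
  end.

Lemma measurable_box (R : realType) (d : nat) (a b : 'cV[R]_d) :
  measurable [set v : 'cV[R]_d | forall i, v i ord0 \in `[a i ord0, b i ord0]].
Proof.
rewrite (_ : [set v | _] = \bigcap_(i in [set: 'I_d])
    ((fun v : 'cV[R]_d => v i ord0) @^-1` `[a i ord0, b i ord0])); last first.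
  by apply/seteqP; split => [v ab i _|v ab i]; [exact: ab|exact: ab].
apply: fin_bigcap_measurable => // i _.
by rewrite -[X in measurable X]setTI; exact: measurable_mxE.
Qed.

Lemma lebesgue_cV_box (R : realType) (d : nat) (a b : 'cV[R]_d) :
  (forall i, a i ord0 <= b i ord0) ->
  lebesgue_cV R d [set v | forall i, v i ord0 \in `[a i ord0, b i ord0]] =
  (\prod_i (b i ord0 - a i ord0))%:E.
Proof.
elim: d a b => [|d IH] a b ab.
  by rewrite big_ord0 /= diracE mem_set//= => -[].
rewrite big_ord_recl EFinM.
have := IH (\col_i a (lift ord0 i) ord0) (\col_i b (lift ord0 i) ord0).
under eq_bigr do rewrite !mxE.
move=> <-; last by move=> i; rewrite !mxE.
have -> : (b ord0 ord0 - a ord0 ord0)%:E =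
    lebesgue_measure `[a ord0 ord0, b ord0 ord0].
  rewrite lebesgue_measure_itv/= lte_fin; case: ltP => // ba.
  have -> : b ord0 ord0 = a ord0 ord0 by apply/le_anti; rewrite ba ab.
  by rewrite subrr.
rewrite -product_measure1E//; last exact: measurable_box.
rewrite /= /lebesgue_step /pushforward; congr product_measure1.
apply/seteqP; split => [p /= abp|p /= [ab0 abS] i].
  split; first by have := abp ord0; rewrite cV_cons0.
  by move=> i; have := abp (lift ord0 i); rewrite cV_consS !mxE.
by case: (unliftP ord0 i) => [k|] ->; rewrite ?cV_cons0// cV_consS;
  have := abS k; rewrite !mxE.
Qed.

Section euclidean.
Context {R : realType} {d : nat}.
Implicit Types (u v : 'cV[R]_d) (A : 'M[R]_d).

Definition dotv u v : R := \sum_i u i ord0 * v i ord0.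

(* The norm `|u| of the library is the sup norm. *)
Definition enorm u : R := Num.sqrt (dotv u u).

Definition opnorm A : R :=
  sup [set enorm (A *m u) | u in [set u | enorm u <= 1]].

Definition is_sqrtmx (J A : 'M[R]_d) : Prop :=
  [/\ J^T = J, forall u, 0 <= dotv u (J *m u) & J *m J = A].

Definition gradient (f : 'cV[R]_d -> R) (x : 'cV[R]_d) : 'cV[R]_d :=
  \col_i 'D_(delta_mx i ord0) f x.

Definition hessian (f : 'cV[R]_d -> R) (x : 'cV[R]_d) : 'M[R]_d :=
  \matrix_(i, j) 'D_(delta_mx i ord0) (fun y => 'D_(delta_mx j ord0) f y) x.

Definition gaussian_pdf (m : 'cV[R]_d) (V : 'M[R]_d) (u : 'cV[R]_d) : R :=
  (Num.sqrt ((2 * pi) ^+ d * \det V))^-1 *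
  expR (- (dotv (u - m) (invmx V *m (u - m)) / 2)).

End euclidean.

Definition expfam_pdf {R : realType} {d : nat} (h psi : 'cV[R]_d -> R)
    (theta x : 'cV[R]_d) : R :=
  h x * expR (dotv x theta - psi theta).

(* The exponential family for one value of n, together with the true parameter
   theta0 and the symmetric square root J of F = psi''(theta0). *)
Record expfam (R : realType) (d : nat) := ExpFam {
  Theta : set 'cV[R]_d ;
  dominating : {measure set 'cV[R]_d -> \bar R} ;
  h : 'cV[R]_d -> R ;
  psi : 'cV[R]_d -> R ;
  theta0 : 'cV[R]_d ;
  J : 'M[R]_d ;
  Theta_open : open Theta ;
  Theta_convex : convex_set (Theta : set (convex_lmodType 'cV[R]_d)) ;
  h_ge0 : forall x, 0 <= h x ;
  h_measurable : measurable_fun setT h ;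
  psi_normalizing : forall theta, Theta theta ->
    (\int[dominating]_x (expfam_pdf h psi theta x)%:E)%E = 1%E ;
  theta0_Theta : Theta theta0 ;
  hessian_unit : hessian psi theta0 \in unitmx ;
  J_sqrt : is_sqrtmx J (hessian psi theta0) }.

Section model.
Context {R : realType} {d : nat}.
Variable E : expfam R d.

Definition pdf (theta x : 'cV[R]_d) : R := expfam_pdf (h E) (psi E) theta x.

Definition mu : 'cV[R]_d := gradient (psi E) (theta0 E).

Definition F : 'M[R]_d := hessian (psi E) (theta0 E).

Definition normFV : R := opnorm (invmx F).

Definition expect (theta : 'cV[R]_d) (g : 'cV[R]_d -> R) : \bar R :=
  (\int[dominating E]_x (g x * pdf theta x)%:E)%E.

Definition mean (theta : 'cV[R]_d) : 'cV[R]_d :=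
  \col_i fine (expect theta (fun x => x i ord0)).

Definition Vproj (theta a x : 'cV[R]_d) : R :=
  dotv a (invmx (J E) *m (x - mean theta)).

Definition moment_region (n : nat) (c : R) : set 'cV[R]_d :=
  [set theta | Theta E theta /\
    enorm (J E *m (theta - theta0 E)) ^+ 2 <= c * d%:R / n%:R].

Definition B1 (n : nat) (c : R) : \bar R :=
  ereal_sup [set y | exists a theta,
    [/\ enorm a = 1, moment_region n c theta &
        y = `|expect theta (fun x => (Vproj theta a x ^+ 3)%R)|%E]].

Definition B2 (n : nat) (c : R) : \bar R :=
  ereal_sup [set y | exists a theta,
    [/\ enorm a = 1, moment_region n c theta &
        y = expect theta (fun x => Vproj theta a x ^+ 4)]].

Definition lambda (n : nat) (c : R) : \bar R :=
  ((6^-1)%:E * ((Num.sqrt (c * d%:R / n%:R))%:E * B1 n 0 +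
                (c * d%:R / n%:R)%:E * B2 n c))%E.

Definition local_space (n : nat) : set 'cV[R]_d :=
  [set Num.sqrt n%:R *: (J E *m (theta - theta0 E)) | theta in Theta E].

Definition of_local (n : nat) (u : 'cV[R]_d) : 'cV[R]_d :=
  theta0 E + (Num.sqrt n%:R)^-1 *: (invmx (J E) *m u).

Definition Delta (n : nat) (x : 'I_n -> 'cV[R]_d) : 'cV[R]_d :=
  Num.sqrt n%:R *: (invmx (J E) *m (n%:R^-1 *: (\sum_i x i) - mu)).

Definition posterior_num (prior : 'cV[R]_d -> R) (n : nat)
    (x : 'I_n -> 'cV[R]_d) (u : 'cV[R]_d) : R :=
  prior (of_local n u) * \prod_i pdf (of_local n u) (x i).

(* If the normalizing integral is infinite this is 0. *)
Definition posterior (prior : 'cV[R]_d -> R) (n : nat)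
    (x : 'I_n -> 'cV[R]_d) (u : 'cV[R]_d) : R :=
  posterior_num prior x u /
  \int[lebesgue_cV R d]_(v in local_space n) posterior_num prior x v.

End model.

Section sampling.
Context {R : realType} {disp disp' : measure_display}
  {Omega : measurableType disp} {T : measurableType disp'}.
Variable P : probability Omega R.

Definition independent_RV (n : nat) (X : 'I_n -> {RV P >-> T}) : Prop :=
  forall (I : {set 'I_n}) (A : 'I_n -> set T),
    (forall i, i \in I -> measurable (A i)) ->
    P (\bigcap_(i in [set` I]) (X i @^-1` A i)) =
    (\prod_(i in I) fine (P (X i @^-1` A i)))%:E.

End sampling.

Definition iid_from {R : realType} {disp : measure_display}
    {Omega : measurableType disp} (P : probability Omega R) (d : nat)
    (E : expfam R d) (n : nat) (X : 'I_n -> {RV P >-> 'cV[R]_d}) : Prop :=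
  independent_RV X /\
  forall i (A : set 'cV[R]_d), measurable A ->
    distribution P (X i) A =
    (\int[dominating E]_(x in A) (pdf E (theta0 E) x)%:E)%E.

(* Z n = o_p(1), each Z n living on its own probability space. *)
Definition is_op1 {R : realType} {disp : nat -> measure_display}
    {Omega : forall n, measurableType (disp n)}
    (P : forall n, probability (Omega n) R)
    (Z : forall n, Omega n -> \bar R) : Prop :=
  forall eps : R, 0 < eps ->
    P n [set w | (eps%:E <= `|Z n w|)%E] @[n --> \oo] --> 0%E.

(* The logarithms are extended-real valued (lne 0 = -oo), so that the second
   clause forces the prior to be positive near theta0. *)
Definition assumptionP {R : realType} {d : nat -> nat}
    (E : forall n, expfam R (d n)) (prior : forall n, 'cV[R]_(d n) -> R)
    (K : nat -> R -> R) (c : nat -> R) : Prop :=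
  let radius n := Num.sqrt (c n * normFV (E n) * (d n)%:R / n%:R) in
  [/\ exists C : R, \forall n \near \oo,
        (ereal_sup [set lne (prior n theta / prior n (theta0 (E n)))%:E
                   | theta in Theta (E n)] <= (C * (d n)%:R)%:E)%E,
      \forall n \near \oo, forall theta, Theta (E n) theta ->
        enorm (theta - theta0 (E n)) <= radius n ->
        (`|lne (prior n theta)%:E - lne (prior n (theta0 (E n)))%:E| <=
         (K n (c n) * enorm (theta - theta0 (E n)))%:E)%E &
      K n (c n) * radius n @[n --> \oo] --> (0 : R)].

Definition Mda {R : realType} (d : nat) (alpha : R) : R :=
  (d%:R + alpha) * (1 + alpha * ln (d%:R + alpha) / (d%:R + alpha)).

(* Main.v *)
(** Write [u] for the local parameter, [D] for the score vector and
    [q u = exp (<D, u> - |u|^2 / 2)]; up to constants the posterior density is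
    [p u = (prior u / prior 0) * exp (<D, u> - G u)], where [G] is the convex
    second-order remainder of the cumulant function.  A fourth-order Taylor
    expansion along rays, whose coefficients are the third moment at the true
    parameter and fourth cumulants nearby, gives [|G u - |u|^2 / 2| <= lambda |u|^2]
    on the ball of radius [rho = sqrt (c M)]; with the Lipschitz bound on the log
    prior this makes [p / q] uniformly close to 1 there, even after multiplication
    by [rho ^ alpha].  Outside the ball convexity of [G] gives
    [G u >= rho |u| / 4]; since [|D|^2 = O_p(d)] by a second moment computation and
    [M] dominates both [d] and [alpha ln (d + alpha)], the weighted tails of [p] and
    [q] are bounded by [exp (- d)]. *)

Require Import Defs.
From HB Require Import structures.
From mathcomp Require Import all_boot all_order all_algebra.
From mathcomp Require Import all_classical all_reals all_analysis.
From mathcomp Require Import measurable_realfun ring lra.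

Set Implicit Arguments.
Unset Strict Implicit.
Unset Printing Implicit Defensive.

Import Order.TTheory GRing.Theory Num.Theory.
Import numFieldNormedType.Exports.

Local Open Scope classical_set_scope.
Local Open Scope ring_scope.

(** * Measurability and Euclidean geometry of column vectors *)

(** The event that [|D| > rho / 8] has probability at most [64 d / rho^2 <= 64 / c], which does not
    vanish for a fixed [c]. Hence [c] is chosen after the tolerated probability, and also large
    against the constant [C] that bounds the log prior ratio by [C d]; for this fixed [c] all other
    error terms are deterministic and tend to 0.

    The growth of alpha shapes the radius. To absorb the weight [|u| ^ alpha] into the exponential
    decay, both [alpha] and [alpha ln rho] must stay below [rho^2 / 64], and [rho] itself contains
    [alpha]. The ball of radius [rho] must moreover fit into the local space, where only a ball of
    radius [sqrt d ln n] is given; the smallness of [lambda] supplies this as well.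

    The dominating measure is arbitrary, so every integral is moved to the law [nu] of one
    observation, weighted by [exp <x, theta - theta0>]. Derivatives, measurability and convexity
    along rays of [psi], and the fact that its Hessian is the covariance, are then all derived from
    the normalization of the densities. *)

Lemma measurable_dist_lt (R : realType) (a e : R) :
  measurable [set x : R | `|a - x| < e].
Proof.
rewrite (_ : [set x | _] = `]a - e, a + e[%classic)//.
by apply/seteqP; split => x /=; rewrite in_itv/= distrC ltr_norml => /andP[? ?];
  apply/andP; split; lra.
Qed.

(** The countably many boxes with rational centre and radius [1 / (k + 1)] contained in [U] cover
    it. Taking the radius below [e / 2] keeps any two points of one box within [e] of each other in
    the sup norm. *)
Lemma open_cV_measurable (R : realType) (d : nat) (U : set 'cV[R]_d) :
  open U -> measurable U.
Proof.
move=> oU.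
pose box (p : 'cV[rat]_d * nat) : set 'cV[R]_d :=
  [set v | forall i, `|ratr (p.1 i ord0) - v i ord0| < p.2.+1%:R^-1].
have mbox p : measurable (box p).
  rewrite (_ : box p = \bigcap_(i in [set: 'I_d]) ((fun v : 'cV[R]_d => v i ord0) @^-1`
     [set x | `|ratr (p.1 i ord0) - x| < p.2.+1%:R^-1])); last first.
    by apply/seteqP; split => [v ab i _|v ab i]; [exact: ab|exact: ab].
  apply: fin_bigcap_measurable => // i _.
  rewrite -[X in measurable X]setTI; apply: measurable_mxE => //.
  exact: measurable_dist_lt.
rewrite (_ : U = \bigcup_(p in [set p | box p `<=` U]) box p); last first.
  apply/seteqP; split => [v Uv|v [p /= pU]]; last exact: pU.
  have /nbhs_ballP[e /= e0 eU] : nbhs v U by exact: open_nbhs_nbhs.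
  have [k _ ke] : exists2 k : nat, True & k.+1%:R^-1 < e / 2.
    have [|k] := @ltr_add_invr R 0 (e/2); first by rewrite divr_gt0.
    by rewrite add0r => ?; exists k.
  have q_ (i : 'I_d) : {q : rat | `|ratr q - v i ord0| < k.+1%:R^-1}.
    apply/cid.
    have k0 : 0 < k.+1%:R^-1 :> R by rewrite invr_gt0 ltr0n.
    have [|q] := @rat_in_itvoo R (v i ord0 - k.+1%:R^-1) (v i ord0 + k.+1%:R^-1).
      by rewrite ltrBlDr -addrA ltrDl addr_gt0.
    rewrite in_itv/= => /andP[q1 q2]; exists q.
    by rewrite ltr_norml; apply/andP; split; [rewrite ltrBrDl|rewrite ltrBlDl].
  exists (\col_i sval (q_ i), k); last first.
    by move=> i /=; rewrite mxE; exact: svalP (q_ i).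
  move=> /= x bx; apply: eU; split => // i j; rewrite -ball_normE /ball_ /= (ord1 j).
  have := bx i; rewrite /= mxE; have := svalP (q_ i) => /= h1 h2.
  rewrite (_ : v i ord0 - x i ord0 = - (ratr (sval (q_ i)) - v i ord0) + (ratr (sval (q_ i)) - x i ord0)).
    rewrite (le_lt_trans (ler_normD _ _))// normrN [ltRHS]splitr ltrD// (lt_trans _ ke)//.
  by rewrite opprB addrC addrA subrK addrC.
rewrite bigcup_mkcond; apply: countable_bigcupT_measurable => [|p].
  exact: countableP.
by case: ifP.
Qed.

Section measurable_linear_algebra.
Context {R : realType} {disp : measure_display} {T : measurableType disp}.
Variable D : set T.

Lemma measurable_fun_mx (m n : nat) (f : T -> 'M[R]_(m, n)) :
  (forall i j, measurable_fun D (fun u => f u i j)) -> measurable_fun D f.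
Proof.
move=> mf mD; suff : measurable_fun D f by apply.
apply: (@measurability _ _ _ _ _ _
  (\bigcup_(ij in [set: 'I_m * 'I_n])
      preimage_set_system setT (fun M : 'M[R]_(m, n) => M ij.1 ij.2)
        measurable)) => //.
move=> _ [_ [[i j] _ [B mB <-]] <-].
by rewrite setTI; have := mf i j mD B mB.
Qed.

Lemma measurable_coef (m n : nat) (f : T -> 'M[R]_(m, n)) i j :
  measurable_fun D f -> measurable_fun D (fun u => f u i j).
Proof. exact: (measurableT_comp (measurable_mxE i j)). Qed.

Lemma measurable_mulmx (m n p : nat) (A : 'M[R]_(m, n)) (f : T -> 'M[R]_(n, p)) :
  measurable_fun D f -> measurable_fun D (fun u => A *m f u).
Proof.
move=> mf; apply: measurable_fun_mx => i j.
rewrite (_ : (fun _ => _) = (fun u => \sum_k A i k * f u k j)); last first.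
  by apply/funext => u; rewrite mxE.
by apply: measurable_sum => k; apply: measurable_funM => //; exact: measurable_coef.
Qed.

Lemma measurable_dotv (d : nat) (f g : T -> 'cV[R]_d) :
  measurable_fun D f -> measurable_fun D g ->
  measurable_fun D (fun u => dotv (f u) (g u)).
Proof.
move=> mf mg; apply: measurable_sum => k.
by apply: measurable_funM => //; exact: measurable_coef.
Qed.

Lemma measurable_enorm (d : nat) (f : T -> 'cV[R]_d) :
  measurable_fun D f -> measurable_fun D (fun u => enorm (f u)).
Proof.
move=> mf; rewrite (_ : (fun _ => _) = (fun u => dotv (f u) (f u) `^ 2^-1)).
  by apply: (measurableT_comp (measurable_powR _)); exact: measurable_dotv.
apply/funext => u; rewrite powR12_sqrt//.
by apply: sumr_ge0 => i _; rewrite -expr2 sqr_ge0.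
Qed.

Lemma measurable_scalemx (m n : nat) (c : T -> R) (f : T -> 'M[R]_(m, n)) :
  measurable_fun D c -> measurable_fun D f -> measurable_fun D (fun u => c u *: f u).
Proof.
move=> mc mf; apply: measurable_fun_mx => i j.
rewrite (_ : (fun _ => _) = (fun u => c u * f u i j)); last first.
  by apply/funext => u; rewrite mxE.
by apply: measurable_funM => //; exact: measurable_coef.
Qed.

Lemma measurable_addmx (m n : nat) (f g : T -> 'M[R]_(m, n)) :
  measurable_fun D f -> measurable_fun D g -> measurable_fun D (fun u => f u + g u).
Proof.
move=> mf mg; apply: measurable_fun_mx => i j.
rewrite (_ : (fun _ => _) = (fun u => f u i j + g u i j)); last first.
  by apply/funext => u; rewrite mxE.
by apply: measurable_funD => //; exact: measurable_coef.
Qed.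

Lemma measurable_summx (m n k : nat) (f : 'I_k -> T -> 'M[R]_(m, n)) :
  (forall i, measurable_fun D (f i)) -> measurable_fun D (fun u => \sum_i f i u).
Proof.
move=> mf; apply: measurable_fun_mx => i j.
rewrite (_ : (fun _ => _) = (fun u => \sum_l f l u i j)); last first.
  by apply/funext => u; rewrite summxE.
by apply: measurable_sum => l; exact: measurable_coef.
Qed.

Lemma measurable_invr_ge0 (f : T -> R) : (forall x, 0 <= f x) ->
  measurable_fun D f -> measurable_fun D (fun u => (f u)^-1).
Proof.
move=> f0 mf; rewrite (_ : (fun _ => _) = (fun u => f u `^ (- 1))).
  exact: (measurableT_comp (measurable_powR _)).
by apply/funext => u; rewrite powR_inv1.
Qed.

End measurable_linear_algebra.

Section euclidean_theory.
Context {R : realType} {d : nat}.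
Implicit Types (u v w : 'cV[R]_d) (A : 'M[R]_d).

Lemma dotvC u v : dotv u v = dotv v u.
Proof. by apply: eq_bigr => i _; rewrite mulrC. Qed.

Lemma dotvDr u v w : dotv u (v + w) = dotv u v + dotv u w.
Proof. by rewrite -big_split; apply: eq_bigr => i _; rewrite mxE mulrDr. Qed.

Lemma dotvZr a u v : dotv u (a *: v) = a * dotv u v.
Proof. by rewrite mulr_sumr; apply: eq_bigr => i _; rewrite mxE mulrCA. Qed.

Lemma dotvZl a u v : dotv (a *: u) v = a * dotv u v.
Proof. by rewrite dotvC dotvZr dotvC. Qed.

Lemma dotvNr u v : dotv u (- v) = - dotv u v.
Proof. by rewrite -scaleN1r dotvZr mulN1r. Qed.

Lemma dotvBr u v w : dotv u (v - w) = dotv u v - dotv u w.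
Proof. by rewrite dotvDr dotvNr. Qed.

Lemma dotv0r u : dotv u 0 = 0.
Proof. by rewrite /dotv big1// => i _; rewrite mxE mulr0. Qed.

Lemma dotv0l u : dotv 0 u = 0.
Proof. by rewrite dotvC dotv0r. Qed.

Lemma dotv_sumr (n : nat) u (f : 'I_n -> 'cV[R]_d) :
  dotv u (\sum_i f i) = \sum_i dotv u (f i).
Proof.
rewrite (big_morph (dotv u) (id1 := 0) (op1 := +%R))//; last exact: dotv0r.
by move=> v w; rewrite dotvDr.
Qed.

Lemma dotv_deltal i u : dotv (delta_mx i ord0) u = u i ord0.
Proof.
rewrite /dotv (bigD1 i)//= big1 ?addr0 => [|j ji]; first by rewrite mxE !eqxx mul1r.
by rewrite mxE (negbTE ji) mul0r.
Qed.

Lemma dotvE u v : dotv u v = (u^T *m v) ord0 ord0.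
Proof. by rewrite mxE; apply: eq_bigr => i _; rewrite mxE. Qed.

Lemma dotv_mulmx A u v : dotv u (A *m v) = dotv (A^T *m u) v.
Proof. by rewrite !dotvE trmx_mul trmxK mulmxA. Qed.

Lemma dotv_ge0 u : 0 <= dotv u u.
Proof. by apply: sumr_ge0 => i _; rewrite -expr2 sqr_ge0. Qed.

Lemma enorm_ge0 u : 0 <= enorm u.
Proof. exact: sqrtr_ge0. Qed.

Lemma enorm_sqr u : enorm u ^+ 2 = dotv u u.
Proof. by rewrite sqr_sqrtr// dotv_ge0. Qed.

Lemma enorm_eq0 u : (enorm u == 0) = (u == 0).
Proof.
apply/idP/eqP => [|->]; last by rewrite /enorm dotv0r sqrtr0.
rewrite -sqrf_eq0 enorm_sqr => u0; apply/matrixP => i j; rewrite (ord1 j) mxE.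
have := u0; rewrite /dotv psumr_eq0; last by move=> k _; rewrite -expr2 sqr_ge0.
by move/allP/(_ i); rewrite mem_index_enum => /(_ isT)/=; rewrite -expr2 sqrf_eq0 => /eqP.
Qed.

Lemma enormZ a u : enorm (a *: u) = `|a| * enorm u.
Proof.
rewrite /enorm dotvZl dotvZr mulrA -expr2 sqrtrM ?sqr_ge0//.
by rewrite sqrtr_sqr.
Qed.

(** Cauchy-Schwarz, from the expansion of the square of [|v| u - |u| v]; zero vectors are split off
    so that the factor [2 |u| |v|] can be cancelled. *)
Lemma dotv_le_enorm u v : dotv u v <= enorm u * enorm v.
Proof.
have [/eqP u0|u0] := boolP (enorm u == 0).
  by move/eqP: (u0); rewrite enorm_eq0 => /eqP ->; rewrite dotv0l mulr_ge0 ?enorm_ge0.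
have [/eqP v0|v0] := boolP (enorm v == 0).
  by move/eqP: (v0); rewrite enorm_eq0 => /eqP ->; rewrite dotv0r mulr_ge0 ?enorm_ge0.
have ug : 0 < enorm u by rewrite lt_neqAle eq_sym u0 enorm_ge0.
have vg : 0 < enorm v by rewrite lt_neqAle eq_sym v0 enorm_ge0.
have := dotv_ge0 ((enorm v) *: u - (enorm u) *: v).
rewrite dotvBr ![dotv (_ - _) _]dotvC !dotvBr !dotvZl !dotvZr -!enorm_sqr (dotvC v u).
set a := enorm u; set b := enorm v; set x := dotv u v => h.
have : 0 <= (2 * a * b) * (a * b - x) by nra.
by rewrite pmulr_rge0 ?subr_ge0// !mulr_gt0.
Qed.

Lemma abs_coord_le_enorm u i : `|u i ord0| <= enorm u.
Proof.
rewrite -sqrtr_sqr ler_wsqrtr// /dotv (bigD1 i)//= expr2 lerDl.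
by apply: sumr_ge0 => j _; rewrite -expr2 sqr_ge0.
Qed.

(** Cauchy-Schwarz against the all-ones vector. *)
Lemma sum_abs_le_enorm u : \sum_i `|u i ord0| <= Num.sqrt d%:R * enorm u.
Proof.
have := dotv_le_enorm (\col_i (1 : R)) (\col_i `|u i ord0|).
have -> : dotv (\col_i (1 : R)) (\col_i `|u i ord0|) = \sum_i `|u i ord0|.
  by apply: eq_bigr => i _; rewrite !mxE mul1r.
have -> : enorm (\col_(i < d) (1 : R)) = Num.sqrt d%:R.
  congr Num.sqrt; rewrite /dotv (eq_bigr (fun _ => 1)) ?sumr_const ?card_ord//.
  by move=> i _; rewrite mxE mulr1.
suff -> : enorm (\col_i `|u i ord0|) = enorm u by [].
by congr Num.sqrt; apply: eq_bigr => i _; rewrite !mxE -normrM ger0_norm// -expr2 sqr_ge0.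
Qed.

Lemma enorm_le_sum_abs u : enorm u <= \sum_i `|u i ord0|.
Proof.
have s0 : 0 <= \sum_i `|u i ord0| by exact: sumr_ge0.
rewrite -(ger0_norm s0) -sqrtr_sqr ler_wsqrtr// expr2 mulr_suml.
apply: ler_sum => i _; rewrite mulr_sumr (bigD1 i)//= -normrM ger0_norm.
  by rewrite lerDl sumr_ge0// => j _; rewrite mulr_ge0.
by rewrite -expr2 sqr_ge0.
Qed.

(** The supremum in [opnorm] is meaningful only for a bounded set; the sum of the absolute entries
    is a crude bound that suffices. *)
Lemma opnorm_has_ubound A : has_ubound [set enorm (A *m u) | u in [set u | enorm u <= 1]].
Proof.
exists (\sum_i \sum_j `|A i j|) => _ [u /= u1 <-].
apply: (le_trans (enorm_le_sum_abs _)); apply: ler_sum => i _.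
rewrite mxE (le_trans (ler_norm_sum _ _ _))//; apply: ler_sum => j _.
by rewrite normrM ler_piMr// (le_trans (abs_coord_le_enorm u j)).
Qed.

Lemma opnorm_ge0 A : 0 <= opnorm A.
Proof.
apply: ub_le_sup; first exact: opnorm_has_ubound.
by exists 0 => /=; rewrite ?mulmx0 /enorm dotv0r sqrtr0.
Qed.

Lemma enorm_mulmx_le A u : enorm (A *m u) <= opnorm A * enorm u.
Proof.
have [->|u0] := eqVneq u 0; first by rewrite mulmx0 /enorm dotv0r sqrtr0 mulr0.
have ug : 0 < enorm u by rewrite lt_neqAle eq_sym enorm_eq0 u0 enorm_ge0.
rewrite -ler_pdivrMr// mulrC -(@ger0_norm _ (enorm u)^-1) ?invr_ge0 ?enorm_ge0//.
rewrite -enormZ scalemxAr; apply: ub_le_sup; first exact: opnorm_has_ubound.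
exists ((enorm u)^-1 *: u) => //=.
by rewrite enormZ ger0_norm ?invr_ge0 ?enorm_ge0// mulVf// gt_eqF.
Qed.

End euclidean_theory.

(** * Lebesgue integrals of product functions *)

(** Induction on the dimension: the measure on dimension [d + 1] is the image of a product measure
    under [cV_cons], so Tonelli separates the first coordinate. *)
Lemma ge0_integral_lebesgue_cV_prod (R : realType) (d : nat) (f : 'I_d -> R -> R) :
  (forall i, measurable_fun setT (f i)) -> (forall i x, 0 <= f i x) ->
  (\int[lebesgue_cV R d]_u (\prod_i f i (u i ord0))%:E =
   \prod_i \int[lebesgue_measure]_x (f i x)%:E)%E.
Proof.
elim: d f => [|d IH] f mf f0.
  rewrite big_ord0 /=.
  rewrite (@integral_dirac _ _ _ _ _ measurableT)/=; last first.
    by under eq_fun do rewrite big_ord0; exact: measurable_cst.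
  by rewrite diracT mul1e big_ord0.
rewrite big_ord_recl -IH//.
rewrite [LHS](@ge0_integral_pushforward _ _ _ _ _ (@cV_cons R d) (@measurable_cV_cons R d)
  (lebesgue_measure \x lebesgue_cV R d)%E setT)//=; first last.
- by move=> u _; rewrite lee_fin prodr_ge0.
- apply/measurable_EFinP; apply: measurable_prod => i _.
  exact: (measurableT_comp (mf i) (measurable_mxE i ord0)).
rewrite preimage_setT.
have mg : measurable_fun [set: 'cV[R]_d] (fun u => \prod_(i < d) f (lift ord0 i) (u i ord0)).
  apply: measurable_prod => i _.
  exact: (measurableT_comp (mf _) (measurable_mxE i ord0)).
have g0 (u : 'cV[R]_d) : 0 <= \prod_(i < d) f (lift ord0 i) (u i ord0) by rewrite prodr_ge0.
under eq_integral => p _.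
  rewrite /comp /= big_ord_recl cV_cons0.
  under eq_bigr do rewrite cV_consS.
  over.
rewrite fubini_tonelli1/=; first last.
- by move=> p; rewrite lee_fin mulr_ge0.
- apply/measurable_EFinP; apply: measurable_funM.
    exact: (measurableT_comp (mf _) measurable_fst).
  exact: (measurableT_comp mg measurable_snd).
rewrite /fubini_F/=.
under eq_integral => x _.
  under eq_integral do rewrite EFinM.
  rewrite ge0_integralZl//; last 3 first.
  - exact/measurable_EFinP.
  - by move=> u _; rewrite lee_fin.
  - by rewrite lee_fin.
  over.
rewrite ge0_integralZr//.
- by apply/measurable_EFinP; exact: mf.
- by move=> u _; rewrite lee_fin.
- by apply: integral_ge0 => u _; rewrite lee_fin.
Qed.

Lemma sqrtr_expn (R : rcfType) (x : R) n : 0 <= x -> Num.sqrt (x ^+ n) = Num.sqrt x ^+ n.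
Proof.
by move=> x0; elim: n => [|n IH]; rewrite ?expr0 ?sqrtr1// !exprS sqrtrM// IH.
Qed.

Lemma integral_gaussian_pdf1 (R : realType) (d : nat) (m : 'cV[R]_d) :
  (\int[lebesgue_cV R d]_u (gaussian_pdf m 1%:M u)%:E = 1)%E.
Proof.
transitivity (\int[lebesgue_cV R d]_u (\prod_i normal_pdf (m i ord0) 1 (u i ord0))%:E)%E.
  apply: eq_integral => u _; congr EFin.
  rewrite /gaussian_pdf det1 mulr1 invmx1 mul1mx /dotv.
  rewrite /normal_pdf oner_eq0 /normal_peak /normal_fun big_split/=; congr (_ * _).
    rewrite prodr_const card_ord expr1n mul1r exprVn; congr (_^-1).
    by rewrite sqrtr_expn ?mulr_ge0 ?pi_ge0// mulr_natl.
  rewrite -expR_sum; congr expR; rewrite mulr_suml -sumrN; apply: eq_bigr => i _.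
  by rewrite !mxE expr1n -expr2 mulNr.
rewrite (@ge0_integral_lebesgue_cV_prod _ _ (fun i => normal_pdf (m i ord0) 1))//.
- by under eq_bigr do rewrite integral_normal_pdf; rewrite big1.
- by move=> i; exact: measurable_normal_pdf.
- by move=> i x; exact: normal_pdf_ge0.
Qed.

(** By symmetry this is twice the integral over the half line, which the normalization of the
    exponential density gives as [1 / b]. *)
Lemma integral_exp_abs (R : realType) (b : R) : 0 < b ->
  (\int[lebesgue_measure]_x (expR (- (b * `|x|)))%:E = (2 / b)%:E)%E.
Proof.
move=> b0; rewrite ge0_symfun_integralT/=; first last.
- by move=> x /=; rewrite normrN.
- move=> x; apply: continuous_comp; last exact: continuous_expR.
  apply: continuousN; apply: continuousM; first exact: cst_continuous.
  exact: norm_continuous.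
- by move=> x; exact: expR_ge0.
have := integral_exponential_pdf b0.
rewrite /exponential_pdf.
rewrite (_ : integral _ _ _ =
    \int[lebesgue_measure]_(x in `[0%R, +oo[) (b * expR (- b * x))%:E)%E; last first.
  by rewrite [RHS]integral_mkcond; apply: eq_integral => x _; rewrite /= !patchE; case: ifP.
under eq_integral do rewrite EFinM.
rewrite ge0_integralZl//; last 2 first.
- apply/measurable_EFinP; apply: measurableT_comp => //; exact: measurable_funM.
- by rewrite lee_fin ltW.
have -> : (\int[lebesgue_measure]_(x in `[0%R, +oo[) (expR (- b * x))%:E =
  \int[lebesgue_measure]_(x in [set x | (0 <= x)%R]) (expR (- (b * `|x|)))%:E)%E.
  rewrite (_ : `[0, +oo[%classic = [set x : R | 0 <= x]).
    by apply: eq_integral => x; rewrite inE/= => x0; rewrite ger0_norm// mulNr.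
  by apply/seteqP; split => x /=; rewrite in_itv/= andbT.
set I := (\int[_]_(_ in _) _)%E => bI.
have I0 : (0 <= I)%E by apply: integral_ge0 => x _; rewrite lee_fin expR_ge0.
have : I \is a fin_num.
  rewrite ge0_fin_numE//; rewrite ltNge leye_eq; apply/negP => /eqP Ioo.
  by move: bI; rewrite Ioo gt0_muley ?lte_fin.
move: bI; case: I {I0} => //= r [br] _.
by rewrite -EFinM -[r](mulKf (lt0r_neq0 b0)) br mulr1.
Qed.

(** Since [sqrt d |u|] dominates the l1 norm, the integrand is at most a product of one-dimensional
    functions. The loss is exponential in [d], which the factor [exp (- rho^2 / 32)] of the tail
    bound later absorbs. *)
Lemma integral_exp_enorm_le (R : realType) (d : nat) (b : R) : 0 < b ->
  (\int[lebesgue_cV R d]_u (expR (- (b * enorm u)))%:E <=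
   ((2 * Num.sqrt d%:R / b) ^+ d)%:E)%E.
Proof.
move=> b0; case: d => [|d].
  (* In dimension 0 one cannot divide by [sqrt d]; there the integrand is 1, as is the Gaussian
     density, whose integral is known. *)
  rewrite expr0; apply: (@le_trans _ _ (\int[lebesgue_cV R 0]_u (gaussian_pdf 0 1%:M u)%:E)%E);
    last by rewrite integral_gaussian_pdf1.
  apply: ge0_le_integral => //.
  - apply/measurable_EFinP; apply: measurableT_comp => //; apply: measurableT_comp => //.
    by apply: measurable_funM => //; exact: measurable_enorm.
  - apply/measurable_EFinP; apply: measurable_funM => //.
    apply: measurableT_comp => //; apply: measurableT_comp => //.
    apply: measurable_funM => //; rewrite /dotv.
    under eq_fun do rewrite big_ord0; exact: measurable_cst.
  - move=> u _; rewrite lee_fin /gaussian_pdf /enorm /dotv !big_ord0 sqrtr0 mulr0 mul0r.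
    by rewrite det_mx00 expr0 mulr1 sqrtr1 invr1 mul1r.
set s := Num.sqrt d.+1%:R.
have s0 : 0 < s by rewrite sqrtr_gt0 ltr0n.
apply: (@le_trans _ _ (\int[lebesgue_cV R d.+1]_u (\prod_i expR (- (b / s * `|u i ord0|)))%:E)%E).
  apply: ge0_le_integral => //.
  - apply/measurable_EFinP; apply: measurableT_comp => //; apply: measurableT_comp => //.
    by apply: measurable_funM => //; exact: measurable_enorm.
  - apply/measurable_EFinP; apply: measurable_prod => i _.
    apply: measurableT_comp => //; apply: measurableT_comp => //.
    by apply: measurable_funM => //; apply: measurableT_comp => //; exact: measurable_mxE.
  - move=> u _; rewrite lee_fin -expR_sum ler_expR sumrN lerN2 -mulr_sumr.
    by rewrite mulrAC -mulrA ler_pM2l// ler_pdivrMr// mulrC; exact: sum_abs_le_enorm.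
rewrite (@ge0_integral_lebesgue_cV_prod _ _ (fun _ x => expR (- (b / s * `|x|))))//; last first.
  move=> _; apply: measurableT_comp => //; apply: measurableT_comp => //.
  by apply: measurable_funM.
under eq_bigr do rewrite integral_exp_abs ?divr_gt0//.
by rewrite prodEFin lee_fin prodr_const card_ord invf_div mulrA.
Qed.

(** * Measures with a density *)

Section density.
Local Open Scope ereal_scope.
Context (disp : measure_display) (T : measurableType disp) (R : realType).
Variables (mu nu : {measure set T -> \bar R}) (f : T -> R).
Hypothesis f0 : forall x, (0 <= f x)%R.
Hypothesis mf : measurable_fun setT f.
Hypothesis nuE : forall A, measurable A -> nu A = \int[mu]_(x in A) (f x)%:E.

Import HBNNSimple.

(** For simple functions the identity is the hypothesis [nuE] on each level set, combined by
    linearity. No sigma-finiteness of [mu] enters. *)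
Let integral_density_nnsfun (h : {nnsfun T >-> R}) :
  \int[nu]_x (h x)%:E = \int[mu]_x (h x * f x)%:E.
Proof.
under [LHS]eq_integral do rewrite fimfunE -fsumEFin//.
rewrite [LHS]ge0_integral_fsum//; last 2 first.
  - by move=> r; exact/measurable_EFinP/measurableT_comp.
  - by move=> n x _; rewrite EFinM nnfun_muleindic_ge0.
under [RHS]eq_integral.
  move=> x _; rewrite EFinM fimfunE -fsumEFin// ge0_mule_fsuml; last first.
    by move=> r; rewrite EFinM nnfun_muleindic_ge0.
  over.
rewrite [RHS]ge0_integral_fsum//; last 2 first.
  - move=> r; apply: emeasurable_funM; last exact/measurable_EFinP.
    exact/measurable_EFinP/measurableT_comp.
  - by move=> r x _; apply: mule_ge0; [rewrite EFinM nnfun_muleindic_ge0|rewrite lee_fin].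
apply: eq_fsbigr => r _.
rewrite integralZl_indic_nnsfun// integral_indic// setIT nuE//.
under [RHS]eq_integral do rewrite EFinM -muleA.
(* A negative value is never attained, so its level set is empty; for the others the scalar can be
   pulled out of a nonnegative integral. *)
have [r0|r0] := leP 0%R r; last first.
  rewrite preimage_nnfun0// integral_set0 mule0 integral0_eq// => x _.
  by rewrite indic0 mul0e mule0.
rewrite [RHS]ge0_integralZl//; last 2 first.
  - apply: emeasurable_funM; last exact/measurable_EFinP.
    exact/measurable_EFinP.
  - by move=> x _; rewrite mule_ge0 ?lee_fin.
congr (_ * _); rewrite integral_mkcond; apply: eq_integral => x _.
by rewrite patchE indicE; case: (x \in _); rewrite ?mul1e ?mul0e.
Qed.

Lemma ge0_integral_density (g : T -> R) : measurable_fun setT g ->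
  (forall x, 0 <= g x)%R ->
  \int[nu]_x (g x)%:E = \int[mu]_x (g x * f x)%:E.
Proof.
move=> mg g0.
have mg' : measurable_fun [set: T] (EFin \o g) by exact/measurable_EFinP.
pose g_ := nnsfun_approx measurableT mg'.
have gE (m : {measure set T -> \bar R}) : \int[m]_x (g x)%:E = limn (fun n => \int[m]_x (g_ n x)%:E) :> \bar R.
  rewrite -monotone_convergence//=.
  - apply: eq_integral => x _; apply/esym/cvg_lim => //=.
    by apply: cvg_nnsfun_approx => // y _; rewrite lee_fin.
  - by move=> n; apply: measurableT_comp => //; exact: measurable_funTS.
  - by move=> n x _; rewrite lee_fin.
  - by move=> x _ a b ab; rewrite lee_fin//; exact/lefP/nd_nnsfun_approx.
rewrite gE.
under eq_fun do rewrite integral_density_nnsfun.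
rewrite -monotone_convergence//=.
- apply: eq_integral => x _; apply/cvg_lim => //=.
  under eq_fun do rewrite EFinM; rewrite EFinM.
  apply: cvgeM; [by rewrite mule_def_fin| |exact: cvg_cst].
  by apply: (@cvg_nnsfun_approx _ _ _ _ measurableT _ mg') => // y _; rewrite lee_fin.
- move=> n; apply/measurable_EFinP; apply: measurable_funM => //.
- by move=> n x _; rewrite lee_fin mulr_ge0.
- move=> x _ a b ab; rewrite lee_fin ler_wpM2r//.
  by apply/lefP/nd_nnsfun_approx.
Qed.

(** As [f] is nonnegative, multiplying by it commutes with taking positive and negative parts; the
    identity therefore holds without integrability of [g]. *)
Lemma integral_density (g : T -> R) : measurable_fun setT g ->
  \int[nu]_x (g x)%:E = \int[mu]_x (g x * f x)%:E.
Proof.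
move=> mg; rewrite [LHS]integralE [RHS]integralE; congr (_ - _).
  under eq_integral do rewrite funeposE -EFin_max.
  rewrite ge0_integral_density//; last 2 first.
  - exact: measurable_maxr.
  - by move=> x; rewrite le_max lexx orbT.
  apply: eq_integral => x _; rewrite funeposE -EFin_max; congr EFin.
  by rewrite maxr_pMl// mul0r.
under eq_integral do rewrite funenegE -EFinN -EFin_max.
rewrite ge0_integral_density//; last 2 first.
- by apply: measurable_maxr => //; exact: measurableT_comp.
- by move=> x; rewrite le_max lexx orbT.
apply: eq_integral => x _; rewrite funenegE -EFinN -EFin_max; congr EFin.
by rewrite maxr_pMl// mul0r mulNr.
Qed.

End density.

(** * Calculus of the cumulant function *)

(** Only restrictions to lines are ever differentiated; this converts their ordinary derivatives
    into directional ones. *)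
Lemma is_derive_line (R : realType) (V W : normedModType R) (f : V -> W) (y v : V) (df : W) :
  is_derive (0 : R) 1 (fun t : R => f (y + t *: v)) df -> is_derive y v f df.
Proof.
move=> [dg gE].
have e : (fun h : R => h^-1 *: (((fun t : R => f (y + t *: v)) \o shift 0) (h *: 1)
     - f (y + 0 *: v))) =
   (fun h : R => h^-1 *: ((f \o shift y) (h *: v) - f y)).
  apply/funext => h /=.
  by rewrite scale0r addr0 [h *: 1]mulr1 addr0 (addrC (h *: v)).
split.
  by rewrite /derivable -e; exact: dg.
by rewrite -gE /derive -e.
Qed.

(** * Differentiation of exponential integrals under the integral sign *)

Section exponential_integral.
Context (disp : measure_display) (T : measurableType disp) (R : realType).
Variables (mu : {measure set T -> \bar R}) (w Y : T -> R) (r : R).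
Hypothesis r0 : 0 < r.
Hypothesis mY : measurable_fun setT Y.
Hypothesis iw : forall t, `|t| < r -> mu.-integrable setT (fun x => (w x * expR (t * Y x))%:E).

Let mw : measurable_fun setT w.
Proof.
have i0 : mu.-integrable setT (fun x => (w x * expR (0 * Y x))%:E).
  by apply: iw; rewrite normr0.
have /measurable_EFinP := measurable_int _ i0.
by under eq_fun do rewrite mul0r expR0 mulr1.
Qed.

Let mexp t : measurable_fun setT (fun x => expR (t * Y x)).
Proof. by apply: measurableT_comp => //; exact: measurable_funM. Qed.

(** A factor [Y] costs only a slight enlargement of the exponent, because
    [e |Y| <= exp (e Y) + exp (- e Y)]. *)
Lemma integrable_mul_exp t : `|t| < r ->
  mu.-integrable setT (fun x => (w x * Y x * expR (t * Y x))%:E).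
Proof.
(* With this [e], both [t + e] and [t - e] stay inside the interval of integrability. *)
move=> tr; pose e := (r - `|t|) / 2.
have e0 : 0 < e by rewrite /e; lra.
have i1 : mu.-integrable setT (fun x => (w x * expR ((t + e) * Y x))%:E).
  by apply: iw; rewrite (le_lt_trans (ler_normD _ _))// (gtr0_norm e0) /e; lra.
have i2 : mu.-integrable setT (fun x => (w x * expR ((t - e) * Y x))%:E).
  by apply: iw; rewrite (le_lt_trans (ler_normB _ _))// (gtr0_norm e0) /e; lra.
have := integrableD measurableT (integrable_abse i1) (integrable_abse i2).
move=> /(integrableZl measurableT e^-1).
apply: le_integrable => //.
  apply/measurable_EFinP; apply: measurable_funM => //; exact: measurable_funM.
move=> x _ /=; rewrite lee_fin.
rewrite [leRHS]ger0_norm; last by rewrite mulr_ge0 ?invr_ge0 ?(ltW e0)// addr_ge0.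
rewrite !normrM !(ger0_norm (expR_ge0 _)) -!mulrA -mulrDr [leRHS]mulrCA; apply: ler_wpM2l => //.
rewrite !mulrDl mulNr !expRD -mulrDr mulrCA mulrC; apply: ler_wpM2l; first exact: expR_ge0.
rewrite mulrC ler_pdivlMr//.
have h1 := expR_ge1Dx (e * Y x); have h2 := expR_ge1Dx (- (e * Y x)).
have h3 := expR_ge0 (e * Y x); have h4 := expR_ge0 (- (e * Y x)).
have [y0|y0] := ger0P (Y x).
  by rewrite mulrC; lra.
by rewrite mulrC mulrN; lra.
Qed.

Lemma is_derive_exp_integral :
  is_derive (0 : R) 1 (fun t => \int[mu]_x (w x * expR (t * Y x)))
    (\int[mu]_x (w x * Y x)).
Proof.
pose e := r / 2.
have e0 : 0 < e by rewrite divr_gt0.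
have r_0 := r0.
have er t : t \in `]-e, e[ -> `|t| < r.
  rewrite in_itv/= /e => /andP[h1 h2].
  by rewrite ltr_norml; apply/andP; split; lra.
have dw t x : is_derive t (1 : R) (fun t => w x * expR (t * Y x)) (w x * Y x * expR (t * Y x)).
  apply: is_derive_eq.
  by rewrite /GRing.scale/= mulr1 mulr0 add0r mulrA mulrAC.
have p1 t x : partial1of2 (fun t x => w x * expR (t * Y x)) t x = w x * Y x * expR (t * Y x).
  by rewrite /partial1of2 derive1E; exact: derive_val.
(* For [|t| < e] the factor [exp (t Y)] is at most [exp (e Y)] or [exp (- e Y)], according to the
   sign of [Y]; the sum of both dominates the derivative uniformly in [t]. *)
pose G x := `|w x * Y x * expR (e * Y x)| + `|w x * Y x * expR ((- e) * Y x)|.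
have iG : mu.-integrable setT (EFin \o G).
  have i1 := @integrable_mul_exp e; have i2 := @integrable_mul_exp (- e).
  apply: (integrableD measurableT (integrable_abse (i1 _)) (integrable_abse (i2 _))).
    by rewrite ger0_norm /e; lra.
  by rewrite normrN ger0_norm /e; lra.
have GP x y : `]-e, e[%classic x -> setT y ->
    `|partial1of2 (fun t x => w x * expR (t * Y x)) x y| <= G y.
  move=> /=; rewrite in_itv/= => /andP[xe1 xe2] _; rewrite p1 /G !normrM -mulrDr.
  rewrite ler_wpM2l ?mulr_ge0// !ger0_norm ?expR_ge0//.
  have [y0|y0] := lerP 0 (Y y).
    by rewrite ler_wpDr ?expR_ge0// ler_expR ler_wpM2r// ltW.
  by rewrite ler_wpDl ?expR_ge0// ler_expR ler_wnM2r// ltW.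
have := @cvg_differentiation_under_integral R _ T mu (fun t x => w x * expR (t * Y x)) setT
  measurableT 0 (- e) e.
have e00 : `]-e, e[%classic 0 by rewrite /= in_itv/= e0 oppr_lt0 e0.
move=> /(_ e00) /(_ (fun x xe => iw (er _ xe))).
move=> /(_ (fun x y _ _ => @ex_derive _ _ _ _ _ _ _ (dw x y))).
move=> /(_ G (fun y => addr_ge0 (normr_ge0 _) (normr_ge0 _)) iG GP).
have -> : \int[mu]_y partial1of2 (fun t x => w x * expR (t * Y x)) 0 y = \int[mu]_x (w x * Y x).
  by apply: eq_Rintegral => x _; rewrite p1 mul0r expR0 mulr1.
move=> H.
have H' : (h^-1 *: (((fun t => \int[mu]_x (w x * expR (t * Y x))) \o shift 0) (h *: 1)
   - \int[mu]_x (w x * expR (0 * Y x))))  @[h --> (0 : R)^'] --> \int[mu]_x (w x * Y x).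
  apply: cvg_trans H; apply: near_eq_cvg; near=> h => /=.
  by rewrite [h *: 1]mulr1.
split; first by apply/cvg_ex; eexists; exact: H'.
by rewrite /derive; exact: cvg_lim H'.
Unshelve. all: by end_near.
Qed.

End exponential_integral.

(** * Tilted integrals; mean and covariance as derivatives of [psi] *)

Section expfam_calculus.
Context {R : realType} {d : nat} (E : expfam R d).
Variable nu : probability 'cV[R]_d R.
Hypothesis nuE : forall A, measurable A ->
  nu A = (\int[dominating E]_(x in A) (pdf E (theta0 E) x)%:E)%E.
Implicit Types (th b x : 'cV[R]_d) (w : 'cV[R]_d -> R).

Local Notation t0 := (theta0 E).

(** Up to the factor [exp (psi th - psi theta0)], the density of the model at [th] relative to the
    law [nu] at the true parameter. Accordingly the expectation of [w] at [th] is
    [tint w th / tint 1 th]. *)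
Definition tilt th x : R := expR (dotv x (th - t0)).

Definition tint w th : R := \int[nu]_x (w x * tilt th x).

Definition tintegrable w := forall th, Theta E th ->
  nu.-integrable setT (fun x => (w x * tilt th x)%:E).

Lemma tilt0 x : tilt t0 x = 1.
Proof. by rewrite /tilt subrr dotv0r expR0. Qed.

Lemma tilt_line th b t x : tilt (th + t *: b) x = tilt th x * expR (t * dotv x b).
Proof. by rewrite /tilt -expRD -dotvZr -dotvDr addrAC. Qed.

Lemma measurable_dotvr b : measurable_fun [set: 'cV[R]_d] (fun x => dotv x b).
Proof. exact: measurable_dotv. Qed.

Lemma measurable_tilt th : measurable_fun setT (tilt th).
Proof. by apply: measurableT_comp => //; exact: measurable_dotvr. Qed.

Lemma tilt_gt0 th x : 0 < tilt th x.
Proof. exact: expR_gt0. Qed.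

Lemma pdf_tilt th x :
  pdf E th x = pdf E t0 x * tilt th x * expR (- (psi E th - psi E t0)).
Proof.
rewrite /pdf /expfam_pdf /tilt -!mulrA -!expRD; congr (_ * expR _).
by rewrite dotvBr; ring.
Qed.

Lemma pdf_ge0 th x : 0 <= pdf E th x.
Proof. by rewrite mulr_ge0 ?expR_ge0 ?h_ge0. Qed.

Lemma measurable_pdf th : measurable_fun setT (pdf E th).
Proof.
apply: measurable_funM; first exact: h_measurable.
by apply: measurableT_comp => //; apply: measurable_funB => //; exact: measurable_dotvr.
Qed.

Lemma expectE th g : measurable_fun setT g ->
  expect E th g = (\int[nu]_x (g x * tilt th x * expR (- (psi E th - psi E t0)))%:E)%E.
Proof.
move=> mg; rewrite (integral_density (pdf_ge0 t0) (measurable_pdf t0) nuE).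
  apply: eq_integral => x _; congr EFin.
  by rewrite pdf_tilt; ring.
by apply: measurable_funM => //; apply: measurable_funM => //; exact: measurable_tilt.
Qed.

(** The normalization of the density at [th], read under [nu]. It exhibits [psi] as a log moment
    generating function, which is the source of all its regularity. *)
Lemma integral_tilt th : Theta E th ->
  (\int[nu]_x (tilt th x)%:E = (expR (psi E th - psi E t0))%:E)%E.
Proof.
move=> Tth; rewrite (integral_density (pdf_ge0 t0) (measurable_pdf t0) nuE); last first.
  exact: measurable_tilt.
rewrite -[RHS]mule1 -(psi_normalizing Tth) -ge0_integralZl//; last 2 first.
- by apply/measurable_EFinP; exact: (measurable_pdf th).
- by move=> x _; rewrite lee_fin; exact: (pdf_ge0 th).
apply: eq_integral => x _; rewrite -EFinM; congr EFin.
rewrite -/(pdf E th x) (pdf_tilt th) expRN; set e := expR _.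
by rewrite [RHS]mulrC divfK 1?mulrC// gt_eqF// expR_gt0.
Qed.

Lemma tintegrable1 : tintegrable (fun _ => 1).
Proof.
move=> th Tth; apply/integrableP; split.
  by apply/measurable_EFinP; apply: measurable_funM => //; exact: measurable_tilt.
under eq_integral do rewrite mul1r gee0_abs ?lee_fin ?(ltW (tilt_gt0 _ _))//.
by rewrite integral_tilt// ltry.
Qed.

Lemma tint1 th : Theta E th -> tint (fun _ => 1) th = expR (psi E th - psi E t0).
Proof.
move=> Tth; rewrite /tint /Rintegral.
by under eq_integral do rewrite mul1r; rewrite integral_tilt.
Qed.

Lemma tint1_gt0 th : Theta E th -> 0 < tint (fun _ => 1) th.
Proof. by move=> Tth; rewrite tint1// expR_gt0. Qed.

Lemma tint1_theta0 : tint (fun _ => 1) t0 = 1.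
Proof. by rewrite tint1 ?subrr ?expR0//; exact: theta0_Theta. Qed.

Lemma Theta_line th b : Theta E th ->
  exists2 r : R, 0 < r & forall t : R, `|t| < r -> Theta E (th + t *: b).
Proof.
move=> Tth.
have : nbhs (0 : R) ((fun t => th + t *: b) @^-1` (Theta E)).
  have c : {for (0 : R), continuous (fun t : R => th + t *: b)}.
    apply: continuousD; first exact: cst_continuous.
    exact: scalel_continuous.
  apply: c; rewrite scale0r addr0; apply: open_nbhs_nbhs; split => //.
  exact: Theta_open.
move=> /nbhs_ballP[r /= r0 H]; exists r => // t tr; apply: H.
by rewrite -ball_normE/= sub0r normrN.
Qed.

Lemma measurable_tintegrable w : tintegrable w -> measurable_fun setT w.
Proof.
move=> /(_ t0 (theta0_Theta E)) /measurable_int/measurable_EFinP.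
by under eq_fun do rewrite tilt0 mulr1.
Qed.

Let tintegrable_near w th b : tintegrable w -> Theta E th ->
  exists2 r : R, 0 < r & forall t, `|t| < r ->
    nu.-integrable setT (fun x => (w x * tilt th x * expR (t * dotv x b))%:E).
Proof.
move=> iw Tth; have [r r0 H] := Theta_line b Tth; exists r => // t /H/iw.
by under eq_fun do rewrite tilt_line mulrA.
Qed.

(** Because [Theta] is open, the tilt may be moved a little in both directions along [b], which pays
    for one linear factor. Starting from the constant 1, all polynomials become integrable. *)
Lemma tintegrableM w b : tintegrable w -> tintegrable (fun x => w x * dotv x b).
Proof.
move=> iw th Tth; have [r r0 H] := tintegrable_near b iw Tth.
have := @integrable_mul_exp _ _ _ nu (fun x => w x * tilt th x) (fun x => dotv x b) r r0
  (measurable_dotvr b) H 0.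
rewrite normr0 => /(_ r0).
under eq_fun do rewrite mul0r expR0 mulr1.
by under eq_fun do rewrite mulrAC.
Qed.

Lemma is_derive_tint w th b : tintegrable w -> Theta E th ->
  is_derive (0 : R) 1 (fun t : R => tint w (th + t *: b)) (tint (fun x => w x * dotv x b) th).
Proof.
move=> iw Tth; have [r r0 H] := tintegrable_near b iw Tth.
have := @is_derive_exp_integral _ _ _ nu (fun x => w x * tilt th x) (fun x => dotv x b) r r0
  (measurable_dotvr b) H.
rewrite /tint.
have -> : \int[nu]_x (w x * dotv x b * tilt th x) = \int[nu]_x (w x * tilt th x * dotv x b).
  by apply: eq_Rintegral => x _; rewrite mulrAC.
suff -> : (fun t : R => \int[nu]_x (w x * tilt (th + t *: b) x)) =
  (fun t : R => \int[nu]_x (w x * tilt th x * expR (t * dotv x b))) by [].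
by apply/funext => t; apply: eq_Rintegral => x _; rewrite tilt_line mulrA.
Qed.

Lemma tintegrableD w1 w2 : tintegrable w1 -> tintegrable w2 ->
  tintegrable (fun x => w1 x + w2 x).
Proof.
move=> i1 i2 th Tth; have := integrableD measurableT (i1 _ Tth) (i2 _ Tth).
by under eq_fun do rewrite -EFinD -mulrDl.
Qed.

Lemma tintegrableZ c w : tintegrable w -> tintegrable (fun x => c * w x).
Proof.
move=> i1 th Tth; have := integrableZl measurableT c (i1 _ Tth).
by under eq_fun do rewrite -EFinM mulrA.
Qed.

Lemma tintD w1 w2 th : tintegrable w1 -> tintegrable w2 -> Theta E th ->
  tint (fun x => w1 x + w2 x) th = tint w1 th + tint w2 th.
Proof.
move=> i1 i2 Tth; rewrite /tint -RintegralD//; last 2 first.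
- exact: i1.
- exact: i2.
by apply: eq_Rintegral => x _; rewrite mulrDl.
Qed.

Lemma tintZ c w th : tintegrable w -> Theta E th ->
  tint (fun x => c * w x) th = c * tint w th.
Proof.
move=> i1 Tth; rewrite /tint -RintegralZl//; last exact: i1.
by apply: eq_Rintegral => x _; rewrite mulrA.
Qed.

Lemma tintegrable_sum (k : nat) (f : 'I_k -> 'cV[R]_d -> R) :
  (forall i, tintegrable (f i)) -> tintegrable (fun x => \sum_i f i x).
Proof.
elim: k f => [|k IH] f fi.
  have := tintegrableZ 0 tintegrable1.
  by under eq_fun do rewrite mul0r; under [X in _ -> tintegrable X]eq_fun do rewrite big_ord0.
under [X in tintegrable X]eq_fun do rewrite big_ord_recl.
by apply: tintegrableD => //; exact: IH.
Qed.

Lemma tint_sum (k : nat) (f : 'I_k -> 'cV[R]_d -> R) th :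
  (forall i, tintegrable (f i)) -> Theta E th ->
  tint (fun x => \sum_i f i x) th = \sum_i tint (f i) th.
Proof.
move=> fi Tth; elim: k f fi => [|k IH] f fi.
  rewrite big_ord0; transitivity (tint (fun x => 0 * 1) th).
    by apply: eq_Rintegral => x _; rewrite big_ord0 !mul0r.
  by rewrite (tintZ 0 tintegrable1 Tth) mul0r.
rewrite big_ord_recl -IH// -tintD//; last exact: tintegrable_sum.
by apply: eq_Rintegral => x _; rewrite big_ord_recl.
Qed.

Lemma expect_tint th g : tintegrable g -> Theta E th ->
  expect E th g = (tint g th / tint (fun _ => 1) th)%:E.
Proof.
move=> ig Tth; rewrite expectE; last exact: measurable_tintegrable.
rewrite tint1// -expRN.
under eq_integral do rewrite EFinM.
rewrite integralZr//; last exact: ig.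
rewrite EFinM /tint; congr (_ * _)%E.
by rewrite fineK//; exact: integrable_fin_num (ig _ Tth).
Qed.

(** Near [th] the function [psi] agrees, up to a constant, with the logarithm of [tint 1], which can
    be differentiated along lines. *)
Lemma is_derive_psi th b : Theta E th ->
  is_derive (0 : R) 1 (fun t : R => psi E (th + t *: b))
    (tint (fun x => dotv x b) th / tint (fun _ => 1) th).
Proof.
move=> Tth; have [r r0 H] := Theta_line b Tth.
apply: (@near_eq_is_derive _ _ _ (fun t : R => psi E t0 + ln (tint (fun _ => 1) (th + t *: b)))).
  near=> t; rewrite tint1; last first.
    apply: H; near: t; apply/nbhs_ballP; exists r => //= t.
    by rewrite -ball_normE/= sub0r normrN.
  by rewrite expRK addrC subrK.
have h : is_derive (0 : R) 1 (fun t : R => tint (fun _ => 1) (th + t *: b))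
    (tint (fun x => dotv x b) th).
  have := @is_derive_tint (fun _ => 1) th b tintegrable1 Tth.
  by under [X in tint X th]eq_fun do rewrite mul1r.
have l0 : 0 < tint (fun _ => 1) (th + (0 : R) *: b) by rewrite scale0r addr0 tint1_gt0.
have := is_derive1_comp (is_derive1_ln l0) h.
rewrite scale0r addr0 => h2.
have h3 : is_derive (0 : R) 1 (fun t : R => ln (tint (fun _ => 1) (th + t *: b)))
  ((tint (fun=> 1) th)^-1 * tint (dotv^~ b) th) := h2.
have h4 := is_deriveD (is_derive_cst (psi E t0) (0 : R) 1) h3.
by apply: is_derive_eq; rewrite add0r mulrC.
Unshelve. all: by end_near.
Qed.

Lemma tintegrable_coord b : tintegrable (fun x => dotv x b).
Proof.
have := @tintegrableM (fun _ => 1) b tintegrable1.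
by under [X in _ -> tintegrable X]eq_fun do rewrite -[dotv _ _]mul1r.
Qed.

Lemma meanE th i : Theta E th ->
  mean E th i ord0 = tint (fun x => x i ord0) th / tint (fun _ => 1) th.
Proof.
move=> Tth; rewrite mxE expect_tint//.
have := tintegrable_coord (delta_mx i ord0).
by under [X in tintegrable X -> _]eq_fun do rewrite dotvC dotv_deltal.
Qed.

Lemma dotv_mean th b : Theta E th ->
  dotv (mean E th) b = tint (fun x => dotv x b) th / tint (fun _ => 1) th.
Proof.
move=> Tth; rewrite /dotv tint_sum//; last first.
  move=> i; have := tintegrableZ (b i ord0) (tintegrable_coord (delta_mx i ord0)).
  by under [X in tintegrable X -> _]eq_fun do rewrite dotvC dotv_deltal mulrC.
rewrite mulr_suml; apply: eq_bigr => i _; rewrite meanE//.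
rewrite [LHS]mulrC mulrA -tintZ//; last first.
  have := tintegrable_coord (delta_mx i ord0).
  by under [X in tintegrable X -> _]eq_fun do rewrite dotvC dotv_deltal.
by congr (_ / _); apply: eq_Rintegral => x _; rewrite (mulrC (b i ord0)).
Qed.

Lemma derive_psi th b : Theta E th -> 'D_b (psi E) th = dotv (mean E th) b.
Proof.
by move=> Tth; rewrite dotv_mean//; apply: derive_val; exact: is_derive_line (is_derive_psi b Tth).
Qed.

Lemma mu_mean : mu E = mean E t0.
Proof.
apply/matrixP => i j; rewrite (ord1 j) mxE derive_psi; last exact: theta0_Theta.
by rewrite dotvC dotv_deltal.
Qed.

(** The quotient rule applied to the mean, a ratio of tilted integrals; at the true parameter the
    denominator is 1 and the covariance remains. *)
Lemma hessian_psi i j :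
  F E i j = tint (fun x => x i ord0 * x j ord0) t0 - mu E i ord0 * mu E j ord0.
Proof.
have T0 := theta0_Theta E.
pose ei : 'cV[R]_d := delta_mx i ord0; pose ej : 'cV[R]_d := delta_mx j ord0.
rewrite mxE; apply: derive_val; apply: is_derive_line.
have [r r0 H] := Theta_line ei T0.
apply: (@near_eq_is_derive _ _ _ (fun t : R => tint (fun x => dotv x ej) (t0 + t *: ei) *
   (tint (fun _ => 1) (t0 + t *: ei))^-1)).
  near=> t; rewrite derive_psi ?dotv_mean//.
    apply: H; near: t; apply/nbhs_ballP; exists r => //= t.
    by rewrite -ball_normE/= sub0r normrN.
  apply: H; near: t; apply/nbhs_ballP; exists r => //= t.
  by rewrite -ball_normE/= sub0r normrN.
have h1 := is_derive_tint ei (tintegrable_coord ej) T0.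
have h2 := is_derive_tint ei tintegrable1 T0.
have h3 : tint (fun=> 1) (t0 + (0 : R) *: ei) != 0 by rewrite scale0r addr0 gt_eqF// tint1_gt0.
have h4 := is_deriveV h3 h2.
apply: is_derive_eq.
rewrite scale0r addr0 tint1_theta0 invr1 expr1n invr1 /GRing.scale/= mulN1r mulrN mul1r.
rewrite addrC mu_mean !meanE// tint1_theta0 !divr1; congr (_ - _).
  by apply: eq_Rintegral => x _; rewrite !(dotvC x) !dotv_deltal (mulrC (x i ord0)).
by rewrite mulrC; congr (_ * _); apply: eq_Rintegral => x _; rewrite ?mul1r (dotvC x) dotv_deltal.
Unshelve. all: by end_near.
Qed.

(** The quadratic form of [F] is the variance of [<x, b>]. *)
Lemma dotv_F b : dotv b (F E *m b) =
  tint (fun x => dotv x b ^+ 2) t0 - dotv (mu E) b ^+ 2.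
Proof.
have T0 := theta0_Theta E.
have ii i j : tintegrable (fun x => x i ord0 * x j ord0).
  have := tintegrableM (delta_mx j ord0) (tintegrable_coord (delta_mx i ord0)).
  by under [X in tintegrable X -> _]eq_fun => x do rewrite !(dotvC x) !dotv_deltal.
have -> : tint (fun x => dotv x b ^+ 2) t0 =
    \sum_i \sum_j b i ord0 * b j ord0 * tint (fun x => x i ord0 * x j ord0) t0.
  transitivity (tint (fun x => \sum_i \sum_j b i ord0 * b j ord0 * (x i ord0 * x j ord0)) t0).
    apply: eq_Rintegral => x _; congr (_ * _); rewrite expr2 /dotv mulr_suml.
    by apply: eq_bigr => i _; rewrite mulr_sumr; apply: eq_bigr => j _; ring.
  rewrite tint_sum//; last first.
    by move=> i; apply: tintegrable_sum => j; apply: tintegrableZ.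
  apply: eq_bigr => i _; rewrite tint_sum//; last by move=> j; exact: tintegrableZ.
  by apply: eq_bigr => j _; rewrite tintZ.
have -> : dotv (mu E) b ^+ 2 =
    \sum_i \sum_j b i ord0 * b j ord0 * (mu E i ord0 * mu E j ord0).
  rewrite expr2 /dotv mulr_suml.
  by apply: eq_bigr => i _; rewrite mulr_sumr; apply: eq_bigr => j _; ring.
rewrite -sumrB /dotv; apply: eq_bigr => i _; rewrite -sumrB mxE mulr_sumr.
by apply: eq_bigr => j _; rewrite hessian_psi; ring.
Qed.

End expfam_calculus.

(** * Taylor estimate of order four on an interval *)

Lemma ler_of_derive (R : realType) (f g f' g' : R -> R) (T : R) :
  f 0 = g 0 ->
  (forall t, 0 <= t <= T -> is_derive t 1 f (f' t)) ->
  (forall t, 0 <= t <= T -> is_derive t 1 g (g' t)) ->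
  (forall t, 0 <= t <= T -> f' t <= g' t) ->
  forall t, 0 <= t <= T -> f t <= g t.
Proof.
move=> fg0 df dg fg t /andP[t0 tT].
pose k x := g x - f x.
have dk x : 0 <= x <= T -> is_derive x 1 k (g' x - f' x).
  by move=> xT; have := df x xT; have := dg x xT => *; exact: is_deriveB.
have sub x : x \in `[0, t] -> 0 <= x <= T.
  by rewrite in_itv/= => /andP[-> /=] /le_trans; apply.
have [c /sub cT] : exists2 c, c \in `[0, t] & k t - k 0 = (g' c - f' c) * (t - 0).
  apply: MVT_segment => // [x xt|].
    by apply: dk; apply: sub; exact: subset_itv_oo_cc xt.
  apply: derivable_within_continuous => x /sub /dk h.
  exact: ex_derive.
rewrite {2}/k fg0 subrr subr0 subr0 /k => e.
by rewrite -subr_ge0 e mulr_ge0// subr_ge0 fg.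
Qed.

Section taylor4.
Context {R : realType}.

(** The bound on the fourth derivative is integrated four times by comparing derivatives; the
    two-sided estimate follows by applying this to [g] and to [- g]. *)
Let taylor4_le (g g1 g2 g3 g4 : R -> R) (T C : R) :
  (forall t, 0 <= t <= T -> is_derive t 1 g (g1 t)) ->
  (forall t, 0 <= t <= T -> is_derive t 1 g1 (g2 t)) ->
  (forall t, 0 <= t <= T -> is_derive t 1 g2 (g3 t)) ->
  (forall t, 0 <= t <= T -> is_derive t 1 g3 (g4 t)) ->
  (forall t, 0 <= t <= T -> g4 t <= C) ->
  forall t, 0 <= t <= T ->
  g t <= g 0 + g1 0 * t + g2 0 / 2 * t ^+ 2 + g3 0 / 6 * t ^+ 3 + C / 24 * t ^+ 4.
Proof.
move=> d0 d1 d2 d3 d4.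
have b3 t : 0 <= t <= T -> g3 t <= g3 0 + C * t.
  move: t; apply: (ler_of_derive (f' := g4) (g' := fun=> C)) => //.
    by rewrite mulr0 addr0.
  move=> t _; apply: is_derive_eq.
  by rewrite /GRing.scale/= ?expr0n ?expr0 ?expr1; lra.
have b2 t : 0 <= t <= T -> g2 t <= g2 0 + g3 0 * t + C / 2 * t ^+ 2.
  move: t; apply: (ler_of_derive (f' := g3) (g' := fun t => g3 0 + C * t)) => //.
    by rewrite expr0n/= !mulr0 !addr0.
  move=> t _; apply: is_derive_eq.
  by rewrite /GRing.scale/= ?expr0n ?expr0 ?expr1; lra.
have b1 t : 0 <= t <= T -> g1 t <= g1 0 + g2 0 * t + g3 0 / 2 * t ^+ 2 + C / 6 * t ^+ 3.
  move: t; apply: (ler_of_derive (f' := g2)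
    (g' := fun t => g2 0 + g3 0 * t + C / 2 * t ^+ 2)) => //.
    by rewrite !expr0n/= !mulr0 !addr0.
  move=> t _; apply: is_derive_eq.
  by rewrite /GRing.scale/= ?expr0n ?expr0 ?expr1; lra.
apply: (ler_of_derive (f' := g1)
    (g' := fun t => g1 0 + g2 0 * t + g3 0 / 2 * t ^+ 2 + C / 6 * t ^+ 3)) => //.
  by rewrite !expr0n/= !mulr0 !addr0.
move=> t _; apply: is_derive_eq.
by rewrite /GRing.scale/= ?expr0n ?expr0 ?expr1; lra.
Qed.

Lemma taylor4 (g g1 g2 g3 g4 : R -> R) (T C : R) : 0 <= T ->
  (forall t, 0 <= t <= T -> is_derive t 1 g (g1 t)) ->
  (forall t, 0 <= t <= T -> is_derive t 1 g1 (g2 t)) ->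
  (forall t, 0 <= t <= T -> is_derive t 1 g2 (g3 t)) ->
  (forall t, 0 <= t <= T -> is_derive t 1 g3 (g4 t)) ->
  (forall t, 0 <= t <= T -> `|g4 t| <= C) ->
  `|g T - (g 0 + g1 0 * T + g2 0 / 2 * T ^+ 2 + g3 0 / 6 * T ^+ 3)| <= C / 24 * T ^+ 4.
Proof.
move=> T0 d0 d1 d2 d3 d4.
have TT : 0 <= T <= T by rewrite T0 lexx.
have h1 := taylor4_le d0 d1 d2 d3 (fun t h => le_trans (ler_norm _) (d4 t h)) TT.
have d4' t : 0 <= t <= T -> - g4 t <= C.
  by move=> h; rewrite (le_trans _ (d4 t h))// -normrN ler_norm.
have h2 := taylor4_le (fun t h => is_deriveN (d0 t h)) (fun t h => is_deriveN (d1 t h))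
  (fun t h => is_deriveN (d2 t h)) (fun t h => is_deriveN (d3 t h)) d4' TT.
move: h1 h2; rewrite !fctE => h1 h2.
by rewrite ler_norml; apply/andP; split; lra.
Qed.

End taylor4.

(** * Moments and cumulants along a ray; convexity of [psi] *)

Section cumulants.
Context {R : realType} {d : nat} (E : expfam R d).
Variable nu : probability 'cV[R]_d R.
Hypothesis nuE : forall A, measurable A ->
  nu A = (\int[dominating E]_(x in A) (pdf E (theta0 E) x)%:E)%E.
Implicit Types (th b x : 'cV[R]_d) (t : R).

Local Notation t0 := (theta0 E).
Local Notation tint := (tint E nu).
Local Notation tintegrable := (tintegrable E nu).

Lemma tintegrable_pow b k : tintegrable (fun x => dotv x b ^+ k).
Proof.
elim: k => [|k IH]; first exact: tintegrable1.
have := tintegrableM b IH.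
by under [X in tintegrable X -> _]eq_fun do rewrite -exprSr.
Qed.

(** The [k]-th raw moment of [<x, b>] under the parameter [th]. *)
Definition rawm b k th := tint (fun x => dotv x b ^+ k) th / tint (fun _ => 1) th.

Lemma rawm0 b th : Theta E th -> rawm b 0 th = 1.
Proof. by move=> Tth; rewrite /rawm divff// gt_eqF// (tint1_gt0 nuE). Qed.

Lemma rawm1E b th : rawm b 1 th = tint (fun x => dotv x b) th / tint (fun _ => 1) th.
Proof. by rewrite /rawm; under eq_fun do rewrite expr1. Qed.

(** Third and fourth central moments, and the square behind [centm2_sqr_le], are all polynomials of
    degree at most four in [<x, b>]; this handles them at once. *)
Lemma tint_quartic b th (p0 p1 p2 p3 p4 : R) : Theta E th ->
  let q x := p0 + p1 * dotv x b + p2 * dotv x b ^+ 2 + p3 * dotv x b ^+ 3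
             + p4 * dotv x b ^+ 4 in
  tintegrable q /\
  tint q th / tint (fun _ => 1) th =
  p0 + p1 * rawm b 1 th + p2 * rawm b 2 th + p3 * rawm b 3 th + p4 * rawm b 4 th.
Proof.
move=> Tth q.
have i0 : tintegrable (fun x => p0 * dotv x b ^+ 0) by exact: tintegrableZ (tintegrable_pow b 0).
have i1 : tintegrable (fun x => p1 * dotv x b ^+ 1) by exact: tintegrableZ (tintegrable_pow b 1).
have i2 : tintegrable (fun x => p2 * dotv x b ^+ 2) by exact: tintegrableZ (tintegrable_pow b 2).
have i3 : tintegrable (fun x => p3 * dotv x b ^+ 3) by exact: tintegrableZ (tintegrable_pow b 3).
have i4 : tintegrable (fun x => p4 * dotv x b ^+ 4) by exact: tintegrableZ (tintegrable_pow b 4).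
have qE : q = fun x => p0 * dotv x b ^+ 0 + p1 * dotv x b ^+ 1 + p2 * dotv x b ^+ 2
   + p3 * dotv x b ^+ 3 + p4 * dotv x b ^+ 4.
  by apply/funext => x; rewrite /q expr0 expr1 mulr1.
have j1 := tintegrableD i0 i1.
have j2 := tintegrableD j1 i2.
have j3 := tintegrableD j2 i3.
have j4 := tintegrableD j3 i4.
rewrite qE; split=> //.
rewrite (tintD j3 i4 Tth) (tintD j2 i3 Tth) (tintD j1 i2 Tth) (tintD i0 i1 Tth).
rewrite (tintZ _ (tintegrable_pow b 0) Tth) (tintZ _ (tintegrable_pow b 1) Tth)
  (tintZ _ (tintegrable_pow b 2) Tth) (tintZ _ (tintegrable_pow b 3) Tth)
  (tintZ _ (tintegrable_pow b 4) Tth).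
have p0E : p0 = p0 * rawm b 0 th by rewrite rawm0// mulr1.
by rewrite [in RHS]p0E /rawm !mulrDl !mulrA.
Qed.

(** This recursion generates the cumulants: repeated differentiation of [psi] along the ray only
    needs it and the product rule. *)
Lemma is_derive_rawm b k t : Theta E (t0 + t *: b) ->
  is_derive t 1 (fun t => rawm b k (t0 + t *: b))
   (rawm b k.+1 (t0 + t *: b) - rawm b k (t0 + t *: b) * rawm b 1 (t0 + t *: b)).
Proof.
move=> Tth; apply: is_derive_line.
have h1 := is_derive_tint b (tintegrable_pow b k) Tth.
have h2 := is_derive_tint b (tintegrable1 nuE) Tth.
have n0 : tint (fun _ => 1) (t0 + t *: b) != 0 by rewrite gt_eqF// (tint1_gt0 nuE).
have h3 : tint (fun=> 1) (t0 + t *: b + (0 : R) *: b) != 0 by rewrite scale0r addr0.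
have h4 := is_deriveV h3 h2.
have -> : (fun s : R => rawm b k (t0 + (t + s *: 1) *: b)) =
   (fun s : R => tint (fun x => dotv x b ^+ k) (t0 + t *: b + s *: b) *
     (tint (fun _ => 1) (t0 + t *: b + s *: b))^-1).
  by apply/funext => s; rewrite /rawm [s *: 1]mulr1 scalerDl addrA.
apply: is_derive_eq.
rewrite scale0r addr0 /GRing.scale/= /rawm.
have -> : tint (fun x => dotv x b ^+ k * dotv x b) (t0 + t *: b) =
  tint (fun x => dotv x b ^+ k.+1) (t0 + t *: b).
  by apply: eq_Rintegral => x _; rewrite exprSr.
have -> : tint (fun x => 1 * dotv x b) (t0 + t *: b) =
  tint (fun x => dotv x b ^+ 1) (t0 + t *: b).
  by apply: eq_Rintegral => x _; rewrite mul1r expr1.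
move: n0; move: (tint (fun=> 1) _) (tint (fun x => dotv x b ^+ k.+1) _)
  (tint (fun x => dotv x b ^+ k) _) (tint (fun x => dotv x b ^+ 1) _) => z p q r n0.
by field.
Qed.

Lemma is_derive_psi_line b t : Theta E (t0 + t *: b) ->
  is_derive t 1 (fun t => psi E (t0 + t *: b)) (rawm b 1 (t0 + t *: b)).
Proof.
move=> Tth; apply: is_derive_line.
have -> : (fun s : R => psi E (t0 + (t + s *: 1) *: b)) =
   (fun s : R => psi E (t0 + t *: b + s *: b)).
  by apply/funext => s; rewrite [s *: 1]mulr1 scalerDl addrA.
have h := is_derive_psi nuE b Tth.
by apply: is_derive_eq; rewrite rawm1E.
Qed.

(** The fourth central moment of [<x, b>] expanded in raw moments; the next two definitions are the
    third central moment and the variance. *)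
Definition centm4 b th := rawm b 4 th - 4 * rawm b 3 th * rawm b 1 th
  + 6 * rawm b 2 th * rawm b 1 th ^+ 2 - 3 * rawm b 1 th ^+ 4.

Definition centm3 b th := rawm b 3 th - 3 * rawm b 2 th * rawm b 1 th
  + 2 * rawm b 1 th ^+ 3.

Definition centm2 b th := rawm b 2 th - rawm b 1 th ^+ 2.

Lemma Vproj_dotv a th x : Theta E th -> 
  Vproj E th a x = dotv x (invmx (J E) *m a) - rawm (invmx (J E) *m a) 1 th.
Proof.
move=> Tth; have [Jt _ _] := J_sqrt E.
rewrite /Vproj dotv_mulmx trmx_inv Jt dotvBr dotvC; congr (_ - _).
by rewrite dotvC (dotv_mean nuE)// rawm1E.
Qed.

Lemma expect_Vproj4 a th : Theta E th ->
  expect E th (fun x => Vproj E th a x ^+ 4) = (centm4 (invmx (J E) *m a) th)%:E.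
Proof.
move=> Tth; set b := invmx (J E) *m a; set m := rawm b 1 th.
have [iq qE] := @tint_quartic b th (m ^+ 4) (- 4 * m ^+ 3) (6 * m ^+ 2) (- 4 * m) 1 Tth.
have e : (fun x => Vproj E th a x ^+ 4) = fun x => m ^+ 4 + (- 4 * m ^+ 3) * dotv x b
    + (6 * m ^+ 2) * dotv x b ^+ 2 + (- 4 * m) * dotv x b ^+ 3 + 1 * dotv x b ^+ 4.
  by apply/funext => x; rewrite Vproj_dotv// -/b -/m; ring.
rewrite e (expect_tint nuE)// qE /centm4 -/m; congr EFin; ring.
Qed.

Lemma expect_Vproj3 a th : Theta E th ->
  expect E th (fun x => Vproj E th a x ^+ 3) = (centm3 (invmx (J E) *m a) th)%:E.
Proof.
move=> Tth; set b := invmx (J E) *m a; set m := rawm b 1 th.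
have [iq qE] := @tint_quartic b th (- m ^+ 3) (3 * m ^+ 2) (- 3 * m) 1 0 Tth.
have e : (fun x => Vproj E th a x ^+ 3) = fun x => - m ^+ 3 + (3 * m ^+ 2) * dotv x b
    + (- 3 * m) * dotv x b ^+ 2 + 1 * dotv x b ^+ 3 + 0 * dotv x b ^+ 4.
  by apply/funext => x; rewrite Vproj_dotv// -/b -/m; ring.
rewrite e (expect_tint nuE)// qE /centm3 -/m; congr EFin; ring.
Qed.

(** With [Y = <x, b>], mean [m] and variance [v], the difference of the two sides is the expectation
    of [((Y - m)^2 - v)^2]. *)
Lemma centm2_sqr_le b th : Theta E th -> centm2 b th ^+ 2 <= centm4 b th.
Proof.
move=> Tth; set m := rawm b 1 th; set v := centm2 b th.
(* Chosen so that [Y^2 - 2 m Y + w = (Y - m)^2 - v]. *)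
pose w := m ^+ 2 - v.
have [iq] := @tint_quartic b th (w ^+ 2) (- 4 * m * w) (4 * m ^+ 2 + 2 * w) (- 4 * m) 1 Tth.
set q := fun x => _; move=> qE.
have : 0 <= tint q th / tint (fun _ => 1) th.
  apply: divr_ge0; last by rewrite ltW// (tint1_gt0 nuE).
  apply: Rintegral_ge0 => x _; rewrite mulr_ge0 ?(ltW (tilt_gt0 _ _ _))//.
  rewrite (_ : q x = (dotv x b ^+ 2 - 2 * m * dotv x b + w) ^+ 2) ?sqr_ge0//.
  by rewrite /q; ring.
rewrite qE -/m => h; rewrite -subr_ge0; apply: (le_trans h).
have vE : rawm b 2 th = v + m ^+ 2 by rewrite /v /centm2 -/m subrK.
rewrite le_eqVlt; apply/orP; left; apply/eqP.
by rewrite /centm4 -/m /w vE; ring.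
Qed.

(** The derivatives of [psi] along the ray are the cumulants of [<x, b>]: mean, variance, third
    central moment, and fourth central moment minus three times the squared variance. The last is
    bounded by [2 B2r], whence [B2r / 12 = 2 B2r / 24]. *)
Lemma psi_taylor a t (B1r B2r : R) : enorm a = 1 -> 0 <= t ->
  let b := invmx (J E) *m a in
  (forall s, 0 <= s <= t -> Theta E (t0 + s *: b)) ->
  `|centm3 b t0| <= B1r ->
  (forall s, 0 <= s <= t -> centm4 b (t0 + s *: b) <= B2r) ->
  `|psi E (t0 + t *: b) - psi E t0 - t * dotv (mu E) b - t ^+ 2 / 2| <=
  B1r / 6 * t ^+ 3 + B2r / 12 * t ^+ 4.
Proof.
move=> a1 tge0 b Tb B1P B2P.
have T0 := theta0_Theta E.
pose m k s := rawm b k (t0 + s *: b).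
have dm k s : 0 <= s <= t -> is_derive s 1 (m k) (m k.+1 s - m k s * m 1 s).
  by move=> st; exact: is_derive_rawm (Tb _ st).
have dpsi s : 0 <= s <= t -> is_derive s 1 (fun s => psi E (t0 + s *: b)) (m 1%N s).
  by move=> st; exact: is_derive_psi_line (Tb _ st).
pose g2 s := m 2 s - m 1 s ^+ 2.
pose g3 s := m 3 s - 3 * m 1 s * m 2 s + 2 * m 1 s ^+ 3.
pose g4 s := m 4 s - 4 * m 1 s * m 3 s - 3 * m 2 s ^+ 2 + 12 * m 1 s ^+ 2 * m 2 s - 6 * m 1 s ^+ 4.
have d1 s : 0 <= s <= t -> is_derive s 1 (m 1) (g2 s).
  move=> st; have h1 := dm 1%N _ st; apply: is_derive_eq; rewrite /g2; ring.
have d2 s : 0 <= s <= t -> is_derive s 1 g2 (g3 s).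
  move=> st; have h1 := dm 1%N _ st; have h2 := dm 2 _ st; rewrite /g2.
  by apply: is_derive_eq; rewrite /g3 /GRing.scale/= ?expr1; ring.
have d3 s : 0 <= s <= t -> is_derive s 1 g3 (g4 s).
  move=> st; have h1 := dm 1%N _ st; have h2 := dm 2 _ st; have h3 := dm 3 _ st; rewrite /g3.
  by apply: is_derive_eq; rewrite /g4 /GRing.scale/= ?expr1; ring.
(* With [v^2 <= m4 <= B2r], the cumulant [m4 - 3 v^2] lies between [- 2 m4] and [m4]. *)
have d4 s : 0 <= s <= t -> `|g4 s| <= 2 * B2r.
  move=> st; have h := B2P _ st; have h' := centm2_sqr_le b (Tb _ st).
  have e : g4 s = centm4 b (t0 + s *: b) - 3 * centm2 b (t0 + s *: b) ^+ 2.
    rewrite /g4 /centm4 /centm2 /m; ring.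
  rewrite e ler_norml; have := sqr_ge0 (centm2 b (t0 + s *: b)).
  by move=> ?; apply/andP; split; lra.
have := taylor4 tge0 dpsi d1 d2 d3 d4.
have m0 k : m k 0 = rawm b k t0 by rewrite /m scale0r addr0.
(* The variance at the true parameter is [<b, F b> = |a|^2 = 1], since [b = J^-1 a]. *)
have -> : g2 0 = 1.
  rewrite /g2 !m0.
  have -> : rawm b 2 t0 = tint (fun x => dotv x b ^+ 2) t0.
    by rewrite /rawm (tint1_theta0 nuE) divr1.
  have -> : rawm b 1 t0 = dotv (mu E) b.
    by rewrite (mu_mean nuE) (dotv_mean nuE)// rawm1E.
  rewrite -(dotv_F nuE).
  have [Jt _ JJ] := J_sqrt E.
  have Ju : J E \in unitmx.
    by have := hessian_unit E; rewrite -JJ unitmx_mul => /andP[].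
  rewrite /F -JJ -mulmxA dotv_mulmx Jt /b mulKVmx// -enorm_sqr a1 expr1n//.
have -> : g3 0 = centm3 b t0 by rewrite /g3 !m0 /centm3; ring.
have -> : m 1 0 = dotv (mu E) b.
  by rewrite m0 (mu_mean nuE) (dotv_mean nuE)// rawm1E.
rewrite scale0r addr0 => h.
have t3 : 0 <= t ^+ 3 by exact: exprn_ge0.
have h3 : `|centm3 b t0 / 6 * t ^+ 3| <= B1r / 6 * t ^+ 3.
  by rewrite normrM (ger0_norm t3) ler_wpM2r// normrM (@ger0_norm _ 6^-1) ?invr_ge0// ler_wpM2r ?invr_ge0.
move: h h3; rewrite !ler_norml => /andP[h1 h2] /andP[h3 h4].
by apply/andP; split; lra.
Qed.

(** Weighted arithmetic-geometric mean under the integral: with [y = <x, v>], [exp (s y) <= exp (s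
    k) (s exp (y - k) + 1 - s)], and the right side integrates to [exp (s k)]. The pointwise
    inequality combines the tangent bounds of the exponential at [s (y - k)], evaluated at [y - k]
    and at 0. *)
Lemma psi_ray_convex (v : 'cV[R]_d) (s : R) : 0 <= s <= 1 -> Theta E (t0 + v) -> Theta E (t0 + s *: v) ->
  psi E (t0 + s *: v) - psi E t0 <= s * (psi E (t0 + v) - psi E t0).
Proof.
move=> /andP[s0 s1] T1 Ts; set k := psi E (t0 + v) - psi E t0.
have e1 := tint1 nuE Ts; have e2 := tint1 nuE T1; rewrite -/k in e2.
have i1 := tintegrable1 nuE T1; have iS := tintegrable1 nuE Ts.
have ia : nu.-integrable setT (fun x => (s * expR (- k) * (1 * tilt E (t0 + v) x))%:E).
  exact: (integrableZl measurableT (s * expR (- k)) i1).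
have ic : nu.-integrable setT (fun x : 'cV[R]_d => ((1 - s) * 1)%:E).
  exact: (finite_measure_integrable_cst nu ((1 - s) * 1) measurableT).
have iac : nu.-integrable setT
    (fun x => (s * expR (- k) * (1 * tilt E (t0 + v) x) + (1 - s) * 1)%:E).
  exact: (integrableD measurableT ia ic).
rewrite -ler_expR -e1.
have : tint (fun _ => 1) (t0 + s *: v) <=
   \int[nu]_x (expR (s * k) * (s * expR (- k) * (1 * tilt E (t0 + v) x) + (1 - s) * 1)).
  apply: le_Rintegral => //.
    exact: (integrableZl measurableT (expR (s * k)) iac).
  move=> x _; rewrite !mul1r mulr1 /tilt !(addrC t0) !addrK dotvZr.
  set y := dotv x v.
  have h1 := expR_ge1Dx ((1 - s) * (y - k)); have h2 := expR_ge1Dx (- s * (y - k)).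
  rewrite -mulrA -expRD.
  have -> : s * y = s * (y - k) + s * k by ring.
  rewrite [leLHS]expRD [leLHS]mulrC ler_wpM2l ?expR_ge0//.
  have h3 : s * (expR (s * (y - k)) * expR ((1 - s) * (y - k))) >=
     s * (expR (s * (y - k)) * (1 + (1 - s) * (y - k))).
    by rewrite ler_wpM2l// ler_wpM2l// expR_ge0.
  have h4 : (1 - s) * (expR (s * (y - k)) * expR (- s * (y - k))) >=
     (1 - s) * (expR (s * (y - k)) * (1 + (- s) * (y - k))).
    by rewrite ler_wpM2l ?subr_ge0// ler_wpM2l// expR_ge0.
  have e3 : s * (y - k) + (1 - s) * (y - k) = - k + y by ring.
  have e4 : s * (y - k) + (- s) * (y - k) = 0 by ring.
  move: h3 h4; rewrite -!expRD e3 e4 expR0.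
  by move: (expR (s * (y - k))) (expR (- k + y)) => p q h3 h4;
    apply: le_trans (le_trans (lerD h3 h4) _); rewrite le_eqVlt; apply/orP; left; apply/eqP; ring.
move=> /le_trans; apply.
rewrite RintegralZl// RintegralD//.
rewrite (@RintegralZl _ _ _ nu setT (fun x => 1 * tilt E (t0 + v) x) _ measurableT i1).
rewrite -/(tint _ _) e2 -[s * _ * _]mulrA [expR (- k) * _]mulrC expRxMexpNx_1 mulr1.
by rewrite Rintegral_cst// [fine _](_ : _ = 1) ?(congr1 fine (probability_setT nu))// !mulr1 addrC subrK mulr1.
Qed.

End cumulants.

(** * The score vector *)

Section iid_second_moment.
Context {R : realType} {disp : measure_display} {Omega : measurableType disp}
  (P : probability Omega R) {d n : nat} (E : expfam R d).
Variables (X : 'I_n -> {RV P >-> 'cV[R]_d}) (i0 : 'I_n).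
Hypothesis Xiid : iid_from E X.

(** The common law of the sample, read off an arbitrary index; the index also certifies that the
    sample is not empty. *)
Let nu : probability 'cV[R]_d R := distribution P (X i0).

Lemma distributionE A : measurable A ->
  nu A = (\int[dominating E]_(x in A) (pdf E (theta0 E) x)%:E)%E.
Proof. by move=> mA; exact: Xiid.2. Qed.

Lemma eq_distribution i A : measurable A -> distribution P (X i) A = nu A.
Proof. by move=> mA; rewrite Xiid.2// distributionE. Qed.

Lemma ge0_integral_X i (f : 'cV[R]_d -> R) : measurable_fun setT f ->
  (forall x, 0 <= f x) ->
  (\int[P]_w (f (X i w))%:E = \int[nu]_x (f x)%:E)%E.
Proof.
move=> mf f0; rewrite -[LHS](@ge0_integral_distribution _ _ _ _ _ P (X i) (EFin \o f)).
- by apply: eq_measure_integral => A mA _; exact: eq_distribution.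
- exact/measurable_EFinP.
- by move=> x; rewrite lee_fin.
Qed.

Lemma integral_X i (f : 'cV[R]_d -> R) : measurable_fun setT f ->
  P.-integrable setT (fun w => (f (X i w))%:E) ->
  (\int[P]_w (f (X i w))%:E = \int[nu]_x (f x)%:E)%E.
Proof.
move=> mf fi; rewrite -[LHS](@integral_distribution _ _ _ _ _ P (X i) (EFin \o f)).
- by apply: eq_measure_integral => A mA _; exact: eq_distribution.
- exact/measurable_EFinP.
- exact: fi.
Qed.

Lemma integrable_X i (f : 'cV[R]_d -> R) :
  nu.-integrable setT (EFin \o f) -> P.-integrable setT (fun w => (f (X i w))%:E).
Proof.
move=> /integrableP[/measurable_EFinP mf foo]; apply/integrableP; split.
  exact/measurable_EFinP/measurableT_comp.
rewrite (@ge0_integral_X i (fun x => `|f x|))//.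
exact: measurableT_comp.
Qed.

Lemma independent_pair i j (A B : set 'cV[R]_d) : i != j ->
  measurable A -> measurable B ->
  P ((X i @^-1` A) `&` (X j @^-1` B)) = (nu A * nu B)%E.
Proof.
move=> ij mA mB.
pose C k := if k == i then A else B.
have mC k : k \in [set i; j]%SET -> measurable (C k) by rewrite /C; case: ifP.
have := Xiid.1 [set i; j]%SET C mC.
rewrite big_setU1/=; last by rewrite inE.
rewrite big_set1 /C eqxx eq_sym (negbTE ij) => h.
have -> : X i @^-1` A `&` X j @^-1` B =
    \bigcap_(k in [set` [set i; j]%SET]) (X k @^-1` (if k == i then A else B)).
  apply/seteqP; split => [w [Aw Bw] k /=|w H].
    by rewrite !inE => /orP[/eqP ->|/eqP ->]; rewrite ?eqxx// eq_sym (negbTE ij).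
  split.
    by have := H i; rewrite /= !inE eqxx => /(_ isT).
  by have := H j; rewrite /= !inE eqxx orbT eq_sym (negbTE ij) => /(_ isT).
rewrite h EFinM.
have fk k D : measurable D -> (fine (P (X k @^-1` D)))%:E = nu D.
  move=> mD; rewrite fineK; first exact: eq_distribution.
  apply: fin_num_measure; rewrite -[X in measurable X]setTI.
  by have mX : measurable_fun setT (X k) by []; exact: mX.
by rewrite !fk.
Qed.

(** By uniqueness of product measures the pair [(X i, X j)] has law [nu x nu], and Fubini splits the
    integral. *)
Lemma expectation_independent i j (f g : 'cV[R]_d -> R) : i != j ->
  nu.-integrable setT (EFin \o f) -> nu.-integrable setT (EFin \o g) ->
  P.-integrable setT (fun w => (f (X i w) * g (X j w))%:E) ->
  \int[P]_w (f (X i w) * g (X j w)) = (\int[nu]_x f x) * (\int[nu]_x g x).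
Proof.
move=> ij fi gi fgi.
have /measurable_EFinP mf := measurable_int _ fi.
have /measurable_EFinP mg := measurable_int _ gi.
pose XY w := (X i w, X j w).
have mXY : measurable_fun setT XY by apply: measurable_fun_pair.
pose k (z : 'cV[R]_d * 'cV[R]_d) := (f z.1 * g z.2)%:E.
have mk : measurable_fun setT k.
  apply/measurable_EFinP; apply: measurable_funM.
    exact: measurableT_comp.
  exact: measurableT_comp.
have pE : (\int[P]_w (f (X i w) * g (X j w))%:E = \int[nu \x nu]_z k z)%E.
  rewrite -[LHS](@integral_pushforward _ _ _ _ _ XY mXY P setT k)//.
  apply: eq_measure_integral => A mA _; apply/esym.
  apply: product_measure_unique => // B C mB mC.
  by rewrite /= /pushforward -(independent_pair ij).
rewrite /Rintegral pE.
have ki : (nu \x nu)%E.-integrable setT k.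
  apply/integrable12ltyP => //.
  have -> : (\int[nu]_x \int[nu]_y `|k (x, y)| =
     \int[nu]_x (`|f x|%:E * \int[nu]_y `|g y|%:E))%E.
    apply: eq_integral => x _; rewrite -ge0_integralZl//.
      by apply: eq_integral => y _; rewrite /k/= normrM.
    by apply/measurable_EFinP; exact: measurableT_comp.
  move/integrableP : fi => [_ fi]; move/integrableP : gi => [_ gi].
  rewrite ge0_integralZr//; last 2 first.
  - by apply/measurable_EFinP; exact: measurableT_comp.
  - by apply: integral_ge0 => y _; rewrite lee_fin.
  rewrite lte_mul_pinfty//.
  - by apply: integral_ge0 => y _; rewrite lee_fin.
  - by rewrite ge0_fin_numE//; apply: integral_ge0 => y _; rewrite lee_fin.
rewrite -integral12_prod_meas1//.
have -> : (\int[nu]_x fubini_F nu k x = \int[nu]_x ((f x)%:E * \int[nu]_y (g y)%:E))%E.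
  apply: eq_integral => x _; rewrite /fubini_F -integralZl//.
have fg : (\int[nu]_y (g y)%:E)%E \is a fin_num by exact: integrable_fin_num gi.
rewrite -{1}(fineK fg) integralZr// fineM//; exact: integrable_fin_num fi.
Qed.

(** Expanding the square, the off-diagonal terms are products of zero means and only the [n]
    diagonal ones survive. *)
Lemma integral_sum_sqr (f : 'cV[R]_d -> R) :
  nu.-integrable setT (EFin \o f) ->
  nu.-integrable setT (fun x => (f x ^+ 2)%:E) ->
  \int[nu]_x f x = 0 ->
  (\int[P]_w ((\sum_i f (X i w)) ^+ 2)%:E = (n%:R * \int[nu]_x (f x ^+ 2))%:E)%E.
Proof.
move=> fi f2i f0.
have /measurable_EFinP mf := measurable_int _ fi.
(* Products are dominated through [|a b| <= a^2 + b^2], so square integrability suffices. *)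
have fij i j : P.-integrable setT (fun w => (f (X i w) * f (X j w))%:E).
  have := integrableD measurableT (integrable_X i f2i) (integrable_X j f2i).
  apply: le_integrable => //.
    by apply/measurable_EFinP; apply: measurable_funM; exact: measurableT_comp.
  move=> w _ /=; rewrite lee_fin (ger0_norm (addr_ge0 (sqr_ge0 _) (sqr_ge0 _))).
  move: (f (X i w)) (f (X j w)) => a b; rewrite ler_norml.
  by apply/andP; split; nra.
under eq_integral => w _.
  rewrite expr2 mulr_suml.
  under eq_bigr do rewrite mulr_sumr.
  rewrite -sumEFin; under eq_bigr do rewrite -sumEFin.
  over.
rewrite /= integral_sum//; last by move=> i; apply: (integrable_sum measurableT) => j _; exact: fij.
have ifj i j : (\int[P]_w (f (X i w) * f (X j w))%:E =
    (if i == j then \int[nu]_x (f x ^+ 2) else 0)%:E)%E.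
  rewrite -[LHS]fineK; last exact: integrable_fin_num (fij i j).
  congr EFin; case: eqP => [<-|/eqP ij].
    by congr fine; rewrite -(@integral_X i (fun x => f x ^+ 2))//; [
      apply: measurable_funX|exact: (@integrable_X i (fun x => f x ^+ 2) f2i)].
  by have := expectation_independent ij fi fi (fij i j); rewrite /Rintegral => ->;
    rewrite -/(Rintegral _ _ _) f0 mul0r.
under eq_bigr => i _.
  rewrite integral_sum//.
  under eq_bigr do rewrite ifj.
  rewrite sumEFin -big_mkcond/= (big_pred1 i); last by move=> j; rewrite eq_sym.
  over.
by rewrite sumEFin sumr_const card_ord mulr_natl.
Qed.

End iid_second_moment.

Lemma measurable_Delta (R : realType) (disp : measure_display) (T : measurableType disp)
    (d n : nat) (E : expfam R d) (X : 'I_n -> T -> 'cV[R]_d) :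
  (forall i, measurable_fun setT (X i)) ->
  measurable_fun setT (fun w => Delta E (fun i => X i w)).
Proof.
move=> mX; rewrite /Delta; apply: measurable_scalemx => //; apply: measurable_mulmx.
apply: measurable_addmx => //; apply: measurable_scalemx => //.
exact: measurable_summx.
Qed.

(** * Second moment of the score and Markov's inequality *)

Section score_norm.
Context {R : realType} {disp : measure_display} {Omega : measurableType disp}
  (P : probability Omega R) {d n : nat} (E : expfam R d).
Variables (X : 'I_n -> {RV P >-> 'cV[R]_d}) (i0 : 'I_n).
Hypothesis Xiid : iid_from E X.

Let nu : probability 'cV[R]_d R := distribution P (X i0).
Let nuE : forall A, measurable A ->
  nu A = (\int[dominating E]_(x in A) (pdf E (theta0 E) x)%:E)%E.
Proof. exact: distributionE. Qed.

Local Notation t0 := (theta0 E).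

Lemma J_unit : J E \in unitmx.
Proof.
have [_ _ JJ] := J_sqrt E.
by have := hessian_unit E; rewrite -JJ unitmx_mul => /andP[].
Qed.

Lemma invmx_J_tr : (invmx (J E))^T = invmx (J E).
Proof. by have [Jt _ _] := J_sqrt E; rewrite trmx_inv Jt. Qed.

Lemma dotv_F_invJ (a : 'cV[R]_d) :
  dotv (invmx (J E) *m a) (F E *m (invmx (J E) *m a)) = enorm a ^+ 2.
Proof.
have [Jt _ JJ] := J_sqrt E.
by rewrite /F -JJ -mulmxA dotv_mulmx Jt mulKVmx ?J_unit// enorm_sqr.
Qed.

Lemma tint_theta0 w : tint E nu w t0 = \int[nu]_x w x.
Proof. by apply: eq_Rintegral => x _; rewrite tilt0 mulr1. Qed.

Lemma tintegrable_theta0 w : tintegrable E nu w -> nu.-integrable setT (EFin \o w).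
Proof.
move=> /(_ t0 (theta0_Theta E)); apply: eq_integrable => // x _ /=.
by rewrite tilt0 mulr1.
Qed.

Lemma centered_moments (b : 'cV[R]_d) : let f x := dotv x b - dotv (mu E) b in
  [/\ nu.-integrable setT (EFin \o f),
      nu.-integrable setT (fun x => (f x ^+ 2)%:E),
      \int[nu]_x f x = 0 &
      \int[nu]_x (f x ^+ 2) = dotv b (F E *m b)].
Proof.
have T0 := theta0_Theta E; set m := dotv (mu E) b => f.
have [i1 e1] := @tint_quartic R d E nu nuE b t0 (- m) 1 0 0 0 T0.
have [i2 e2] := @tint_quartic R d E nu nuE b t0 (m ^+ 2) (- 2 * m) 1 0 0 T0.
have r1 : rawm E nu b 1 t0 = m.
  by rewrite rawm1E -(dotv_mean nuE)// -(mu_mean nuE).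
have r2 : rawm E nu b 2 t0 = dotv b (F E *m b) + m ^+ 2.
  by rewrite (dotv_F nuE) /rawm (tint1_theta0 nuE) divr1 -/m subrK.
have f1 : (fun x => - m + 1 * dotv x b + 0 * dotv x b ^+ 2 + 0 * dotv x b ^+ 3
    + 0 * dotv x b ^+ 4) = f.
  by apply/funext => x; rewrite /f; ring.
have f2 : (fun x => m ^+ 2 + (- 2 * m) * dotv x b + 1 * dotv x b ^+ 2
    + 0 * dotv x b ^+ 3 + 0 * dotv x b ^+ 4) = fun x => f x ^+ 2.
  by apply/funext => x; rewrite /f; ring.
rewrite f1 in i1 e1; rewrite f2 in i2 e2.
rewrite (tint1_theta0 nuE) divr1 tint_theta0 r1 in e1.
rewrite (tint1_theta0 nuE) divr1 tint_theta0 r1 r2 in e2.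
split.
- exact: tintegrable_theta0.
- exact: tintegrable_theta0 i2.
- by rewrite e1; ring.
- by rewrite e2; ring.
Qed.

(** Exhibits each coordinate as a normalized sum of centred linear forms in [b = J^-1 e_k], to which
    the second moment identity applies. *)
Lemma Delta_coord w k :
  Delta E (fun i => X i w) k ord0 = (Num.sqrt n%:R)^-1 *
   \sum_i (dotv (X i w) (invmx (J E) *m delta_mx k ord0)
           - dotv (mu E) (invmx (J E) *m delta_mx k ord0)).
Proof.
have n0 : (0 : R) < n%:R by rewrite ltr0n (leq_ltn_trans _ (ltn_ord i0)).
rewrite -[LHS]dotv_deltal /Delta dotvZr dotv_mulmx invmx_J_tr.
set b := invmx (J E) *m _.
rewrite dotvBr dotvZr dotv_sumr sumrB sumr_const card_ord.
under eq_bigr do rewrite dotvC.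
rewrite (dotvC b); move: (\sum_i _) (dotv (mu E) b) => s m.
have : Num.sqrt n%:R != 0 :> R by rewrite gt_eqF// sqrtr_gt0.
have : n%:R = Num.sqrt n%:R ^+ 2 :> R by rewrite sqr_sqrtr// ltW.
rewrite -(mulr_natl m); move: (Num.sqrt (n%:R : R)); move: (n%:R : R) => N q -> q0.
by field.
Qed.

(** The score is whitened: each coordinate has variance [<b, F b> = |e_k|^2 = 1]. *)
Lemma integral_Delta_sqr :
  (\int[P]_w (enorm (Delta E (fun i => X i w)) ^+ 2)%:E = d%:R%:E)%E.
Proof.
have n0 : (0 : R) < n%:R by rewrite ltr0n (leq_ltn_trans _ (ltn_ord i0)).
under eq_integral do rewrite enorm_sqr /dotv -sumEFin.
rewrite ge0_integral_sum//=; last 2 first.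
- move=> k; apply/measurable_EFinP.
  by apply: measurable_funM; apply: measurable_coef; exact: measurable_Delta.
- by move=> k w _; rewrite lee_fin -expr2 sqr_ge0.
rewrite (eq_bigr (fun=> 1%:E)); first by rewrite sumEFin sumr_const card_ord.
move=> k _; pose b : 'cV[R]_d := invmx (J E) *m delta_mx k ord0.
have [i1 i2 e1 e2] := centered_moments b.
under eq_integral do rewrite Delta_coord -/b -expr2 exprMn EFinM.
rewrite ge0_integralZl//; last 2 first.
- apply/measurable_EFinP; apply: measurable_funX; apply: measurable_sum => i.
  by apply: measurable_funB => //; exact: measurable_dotv.
- by move=> w _; rewrite lee_fin sqr_ge0.
rewrite (@integral_sum_sqr _ _ _ P d n E X i0 Xiid (fun x => dotv x b - dotv (mu E) b))//.
rewrite e2 dotv_F_invJ enorm_sqr dotv_deltal mxE !eqxx mulr1 -EFinM exprVn sqr_sqrtr ?(ltW n0)//.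
by rewrite mulVf// gt_eqF.
Qed.

Lemma Delta_markov (a : R) : 0 < a ->
  (P [set w | (a <= enorm (Delta E (fun i => X i w)) ^+ 2)%R] <= (d%:R / a)%:E)%E.
Proof.
move=> a0.
have mD : measurable_fun setT (fun w => (enorm (Delta E (fun i => X i w)) ^+ 2)%:E).
  apply/measurable_EFinP; apply: measurable_funX; apply: measurable_enorm.
  exact: measurable_Delta.
have := le_integral_abse P measurableT mD a0; rewrite setTI.
under eq_integral do rewrite gee0_abs ?lee_fin ?sqr_ge0//.
rewrite integral_Delta_sqr.
have -> : [set w | (a%:E <= `|(enorm (Delta E (fun i => X i w)) ^+ 2)%:E|)%E] =
   [set w | a <= enorm (Delta E (fun i => X i w)) ^+ 2].
  by apply/seteqP; split => w /=; rewrite lee_fin (ger0_norm (sqr_ge0 _)).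
by move=> h; rewrite EFinM lee_pdivlMr// muleC.
Qed.

End score_norm.

(** * Distance between normalized densities *)

Section normalized_weighted_l1.
Context (disp : measure_display) (T : measurableType disp) (R : realType).
Variables (m : {measure set T -> \bar R}) (U N : set T) (p q w : T -> R) (B W e h : R).
Hypotheses (mU : measurable U) (mN : measurable N) (NU : N `<=` U).
Hypotheses (mp : measurable_fun U p) (mq : measurable_fun setT q) (mw : measurable_fun setT w).
Hypotheses (p0 : forall u, U u -> 0 <= p u) (q0 : forall u, 0 <= q u) (w0 : forall u, 0 <= w u).
Hypotheses (B0 : 0 < B) (W1 : 1 <= W) (e0 : 0 <= e) (h0 : 0 <= h).
Hypothesis intq : (\int[m]_u (q u)%:E = B%:E)%E.
Hypothesis pq : forall u, N u -> `|p u - q u| <= e * q u.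
Hypothesis wN : forall u, N u -> w u <= W.
Hypothesis wNC : forall u, ~ N u -> W <= w u.
Hypothesis tailp : (\int[m]_(u in U `\` N) (w u * p u)%:E <= (h * B)%:E)%E.
Hypothesis tailq : (\int[m]_(u in ~` N) (w u * q u)%:E <= (h * B)%:E)%E.
Hypothesis small : e * W + 2 * h <= 2^-1.

Let A := \int[m]_(u in U) p u.

Let mUN : measurable (U `\` N). Proof. exact: measurableD. Qed.
Let mNC : measurable (~` N). Proof. exact: measurableC. Qed.
Let mpN : measurable_fun N p. Proof. exact: measurable_funS mp. Qed.
Let mpUN : measurable_fun (U `\` N) p.
Proof. by apply: measurable_funS mp => // u []. Qed.
Let mq' D : measurable_fun D q. Proof. exact: measurable_funS mq. Qed.
Let mw' D : measurable_fun D w. Proof. exact: measurable_funS mw. Qed.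

Let qE0 u : (0 <= (q u)%:E)%E. Proof. by rewrite lee_fin. Qed.
Let pE0 u : U u -> (0 <= (p u)%:E)%E. Proof. by move=> Uu; rewrite lee_fin p0. Qed.
Let eqE0 u : (0 <= e%:E * (q u)%:E)%E. Proof. by rewrite -EFinM lee_fin mulr_ge0. Qed.

Let ge0_fin (D : set T) (f : T -> R) (c : R) : (forall u, D u -> 0 <= f u) ->
  (\int[m]_(u in D) (f u)%:E <= c%:E)%E ->
  exists2 r : R, 0 <= r & (\int[m]_(u in D) (f u)%:E = r%:E)%E.
Proof.
move=> f0 fc.
have i0 : (0 <= \int[m]_(u in D) (f u)%:E)%E.
  by apply: integral_ge0 => u Du; rewrite lee_fin f0.
have ifin : (\int[m]_(u in D) (f u)%:E)%E \is a fin_num.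
  by rewrite ge0_fin_numE// (le_lt_trans fc)// ltry.
by exists (fine (\int[m]_(u in D) (f u)%:E)%E); rewrite ?fine_ge0// fineK.
Qed.

(** Off [N] the weight is at least [W], so a bound on the weighted tail bounds [W] times the plain
    mass. This is what allows the normalizing constants to be compared with a precision of order
    [1 / W]. *)
Let tail_le (D : set T) (f : T -> R) : measurable D -> D `<=` ~` N ->
  measurable_fun D f -> (forall u, D u -> 0 <= f u) ->
  (\int[m]_(u in D) (w u * f u)%:E <= (h * B)%:E)%E ->
  exists r : R, [/\ 0 <= r, (\int[m]_(u in D) (f u)%:E = r%:E)%E & W * r <= h * B].
Proof.
move=> mD DN mf f0 ht.
have W0 : 0 <= W by rewrite (le_trans _ W1).
have hW : (W%:E * \int[m]_(u in D) (f u)%:E <= (h * B)%:E)%E.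
  apply: le_trans ht; rewrite -ge0_integralZl//; last exact/measurable_EFinP.
  apply: ge0_le_integral => //.
  - by move=> u Du; rewrite -EFinM lee_fin mulr_ge0 ?f0.
  - by apply/measurable_EFinP; exact: measurable_funM.
  - by apply/measurable_EFinP; exact: measurable_funM.
  - by move=> u Du; rewrite -EFinM lee_fin ler_wpM2r ?f0// wNC//; exact: DN.
have hf : (\int[m]_(u in D) (f u)%:E <= (h * B)%:E)%E.
  apply: le_trans hW; rewrite -[leLHS]mul1e lee_wpmul2r ?lee_fin//.
  by apply: integral_ge0 => u Du; rewrite lee_fin f0.
have [r r0 rE] := ge0_fin f0 hf.
by exists r; split => //; move: hW; rewrite rE -EFinM lee_fin.
Qed.

(** Writing [A] and [B] for the two masses, [W |A - B| <= (e W + 2 h) B], so normalization is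
    harmless even after multiplication by [W]. On [N] this costs [4 e W + 4 h]; off [N] the two
    weighted tails cost [2 h + h]. *)
Lemma normalized_weighted_l1_le :
  (\int[m]_(u in U) (w u * `|p u / A - q u / B|)%:E <= (4 * (e * W) + 7 * h)%:E)%E.
Proof.
have W0 : 0 <= W by rewrite (le_trans _ W1).
have [Q2 [Q20 Q2E Q2W]] := @tail_le (~` N) q mNC (@subset_refl _ _) (@mq' _) (fun u _ => q0 u) tailq.
have [P2 [P20 P2E P2W]] := @tail_le (U `\` N) p mUN (fun u h => h.2) mpUN (fun u h => p0 h.1) tailp.
have [Q Qg0 QE] : exists2 r : R, 0 <= r & (\int[m]_(u in N) (q u)%:E = r%:E)%E.
  apply: (@ge0_fin N q B) => //; rewrite -intq; apply: ge0_subset_integral => //.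
  exact/measurable_EFinP.
have BE : B = Q + Q2.
  apply: EFin_inj; rewrite -intq EFinD -QE -Q2E -ge0_integral_setU//.
  - by rewrite setUv.
  - by apply/measurable_EFinP; exact: mq'.
  - by rewrite disj_set2E setICr.
have [P1 P10 P1E] : exists2 r : R, 0 <= r & (\int[m]_(u in N) (p u)%:E = r%:E)%E.
  apply: (@ge0_fin N p ((1 + e) * Q)) => [u /NU|]; first exact: p0.
  rewrite EFinM -QE -ge0_integralZl//; last 2 first.
  - by apply/measurable_EFinP; exact: mq'.
  - by rewrite lee_fin addr_ge0.
  apply: ge0_le_integral => //.
  - by move=> u /NU; rewrite lee_fin; exact: p0.
  - exact/measurable_EFinP.
  - by apply/measurable_EFinP; apply: measurable_funM => //; exact: mq'.
  - move=> u Nu; rewrite -EFinM lee_fin; have := pq Nu; rewrite ler_norml => /andP[_].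
    by rewrite lerBlDr mulrDl mul1r addrC.
have PQ : P1 <= Q + e * Q.
  rewrite -lee_fin EFinD EFinM -P1E -QE -ge0_integralZl//; last first.
    by apply/measurable_EFinP; exact: mq'.
  rewrite -ge0_integralD//; last 2 first.
  - by apply/measurable_EFinP; exact: mq'.
  - by apply/measurable_EFinP; apply: measurable_funM => //; exact: mq'.
  apply: ge0_le_integral => //.
  - by move=> u /NU; rewrite lee_fin; exact: p0.
  - exact/measurable_EFinP.
  - by apply/measurable_EFinP; apply: measurable_funD; [exact: mq'|
      apply: measurable_funM => //; exact: mq'].
  - move=> u Nu; rewrite -EFinM -EFinD lee_fin; have := pq Nu; rewrite ler_norml => /andP[_].
    by rewrite lerBlDr addrC.
have QP : Q <= P1 + e * Q.
  rewrite -lee_fin EFinD EFinM -P1E -QE -ge0_integralZl//; last first.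
    by apply/measurable_EFinP; exact: mq'.
  rewrite -ge0_integralD//; last 3 first.
  - by move=> u /NU; rewrite lee_fin; exact: p0.
  - exact/measurable_EFinP.
  - by apply/measurable_EFinP; apply: measurable_funM => //; exact: mq'.
  apply: ge0_le_integral => //.
  - by apply/measurable_EFinP; exact: mq'.
  - by apply/measurable_EFinP; apply: measurable_funD; [exact: mpN|
      apply: measurable_funM => //; exact: mq'].
  - move=> u Nu; rewrite -EFinM -EFinD lee_fin; have := pq Nu; rewrite ler_norml => /andP[h1 _].
    by move: h1; rewrite lerBrDr addrC lerBlDr.
have NUU : N `|` (U `\` N) = U by rewrite setDUK.
have disjN : [disjoint N & U `\` N] by rewrite disj_set2E setDE setICA setICr setI0.
have AE : A = P1 + P2.
  rewrite /A /Rintegral -NUU ge0_integral_setU//.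
  - by rewrite P1E P2E.
  - by apply/measurable_EFinP; rewrite NUU.
  - by rewrite NUU => u Uu; rewrite lee_fin p0.
have e1 : e <= e * W by rewrite ler_peMr.
have eQB : e * Q <= e * B by rewrite ler_wpM2l// BE lerDl.
have hB : 0 <= h * B by rewrite mulr_ge0// ltW.
have WP2 : 0 <= W * P2 by rewrite mulr_ge0.
have WQ2 : 0 <= W * Q2 by rewrite mulr_ge0.
(* On [N] the masses differ by at most [e Q <= e B]; off [N], [W] times each mass is at most
   [h B]. *)
have WAB1 : W * (A - B) <= e * W * B + 2 * h * B.
  have -> : W * (A - B) = W * (P1 - Q) + W * P2 - W * Q2 by rewrite AE BE; ring.
  have : W * (P1 - Q) <= W * (e * B) by rewrite ler_wpM2l//; lra.
  by lra.
have WAB2 : W * (B - A) <= e * W * B + 2 * h * B.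
  have -> : W * (B - A) = W * (Q - P1) + W * Q2 - W * P2 by rewrite AE BE; ring.
  have : W * (Q - P1) <= W * (e * B) by rewrite ler_wpM2l//; lra.
  by lra.
(* Here [small] and [W >= 1] enter: the mass of [p] cannot fall below half that of [q], so
   [1 / A <= 2 / B]. *)
have AB2 : B / 2 <= A.
  have : B - A <= B / 2.
    have [BA|BA] := leP B A; first by have := B0; lra.
    apply: (@le_trans _ _ (W * (B - A))); first by rewrite ler_peMl// subr_ge0 ltW.
    apply: (le_trans WAB2); rewrite -mulrDl mulrC ler_wpM2l ?(ltW B0)//.
  by lra.
have A0 : 0 < A by rewrite (lt_le_trans _ AB2)// divr_gt0.
have iAB : A^-1 <= 2 / B.
  by rewrite -[2]invrK -invfM lef_pV2 ?posrE ?mulr_gt0 ?invr_gt0// mulrC.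
(* On [N], [p / A - q / B = (p - q) / A + (1 / A - 1 / B) q], hence [c q] bounds the weighted
   integrand. *)
pose c := W * (e / A + `|A^-1 - B^-1|).
have c0 : 0 <= c by rewrite mulr_ge0// addr_ge0// divr_ge0// ltW.
have cB : c * B <= 4 * (e * W) + 4 * h.
  have c1 : e / A * B <= 2 * e.
    by rewrite -mulrA (mulrC 2) ler_wpM2l// mulrC -ler_pdivlMl// mulrC.
  have c2 : `|A^-1 - B^-1| * B <= 2 / B * `|A - B|.
    have -> : A^-1 - B^-1 = (B - A) * A^-1 * B^-1.
      by field; rewrite !gt_eqF.
    rewrite normrM (@gtr0_norm _ B^-1) ?invr_gt0// divfK ?gt_eqF// normrM.
    by rewrite mulrC distrC ler_wpM2r// gtr0_norm ?invr_gt0.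
  have c3 : W * `|A - B| <= e * W * B + 2 * h * B.
    by have [AB|AB] := ger0P (A - B); rewrite ?opprB.
  have c4 : W * (2 / B * `|A - B|) <= 2 * (e * W) + 4 * h.
    have -> : W * (2 / B * `|A - B|) = 2 * (W * `|A - B|) / B by field; rewrite gt_eqF.
    by rewrite ler_pdivrMr//; lra.
  rewrite /c -mulrA mulrDl mulrDr.
  have c5 : W * (e / A * B) <= W * (2 * e) by rewrite ler_wpM2l.
  have c6 : W * (`|A^-1 - B^-1| * B) <= W * (2 / B * `|A - B|) by rewrite ler_wpM2l.
  by lra.
have mpA D : measurable_fun D p -> measurable_fun D (fun u => w u * `|p u / A - q u / B|).
  move=> mpD; apply: measurable_funM => //; apply: measurableT_comp => //.
  apply: measurable_funB; apply: measurable_funM => //; exact: mq'.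
rewrite -NUU ge0_integral_setU//; last 2 first.
- by apply/measurable_EFinP; rewrite NUU; exact: mpA.
- by move=> u _; rewrite lee_fin mulr_ge0.
have -> : 4 * (e * W) + 7 * h = (4 * (e * W) + 4 * h) + 3 * h by ring.
rewrite EFinD; apply: leeD.
  apply: (@le_trans _ _ (c%:E * Q%:E)%E); last first.
    by rewrite -EFinM lee_fin (le_trans _ cB)// ler_wpM2l// BE lerDl.
  rewrite -QE -ge0_integralZl//; last by apply/measurable_EFinP; exact: mq'.
  apply: ge0_le_integral => //.
  - by move=> u _; rewrite lee_fin mulr_ge0.
  - by apply/measurable_EFinP; exact: mpA.
  - by apply/measurable_EFinP; apply: measurable_funM => //; exact: mq'.
  move=> u Nu; rewrite -EFinM lee_fin /c -mulrA; apply: ler_pM => //; first exact: wN.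
  have -> : p u / A - q u / B = (p u - q u) / A + (A^-1 - B^-1) * q u by ring.
  apply: (le_trans (ler_normD _ _)); rewrite [leRHS]mulrDl; apply: lerD.
    by rewrite normrM (@gtr0_norm _ A^-1) ?invr_gt0// [leRHS]mulrAC ler_wpM2r ?pq// ltW ?invr_gt0.
  by rewrite normrM (ger0_norm (q0 u)).
apply: (@le_trans _ _ ((A^-1)%:E * \int[m]_(u in U `\` N) (w u * p u)%:E +
    (B^-1)%:E * \int[m]_(u in U `\` N) (w u * q u)%:E)%E).
  have A0' : 0 <= A^-1 by rewrite invr_ge0 ltW.
  have B0' : 0 <= B^-1 by rewrite invr_ge0 ltW.
  have wp0 u : (U `\` N) u -> (0 <= (w u * p u)%:E)%E.
    by move=> [Uu _]; rewrite lee_fin mulr_ge0 ?p0.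
  have wq0 u : (U `\` N) u -> (0 <= (w u * q u)%:E)%E by rewrite lee_fin mulr_ge0.
  have mwp : measurable_fun (U `\` N) (fun u => (w u * p u)%:E).
    by apply/measurable_EFinP; exact: measurable_funM.
  have mwq : measurable_fun (U `\` N) (fun u => (w u * q u)%:E).
    by apply/measurable_EFinP; apply: measurable_funM => //; exact: mq'.
  rewrite -!ge0_integralZl//.
  have wp0' u : (U `\` N) u -> (0 <= (A^-1)%:E * (w u * p u)%:E)%E.
    by move=> [Uu _]; rewrite -EFinM lee_fin !mulr_ge0 ?p0.
  have wq0' u : (U `\` N) u -> (0 <= (B^-1)%:E * (w u * q u)%:E)%E.
    by rewrite -EFinM lee_fin !mulr_ge0.
  have mwp' : measurable_fun (U `\` N) (fun u => (A^-1)%:E * (w u * p u)%:E)%E.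
    exact: emeasurable_funM.
  have mwq' : measurable_fun (U `\` N) (fun u => (B^-1)%:E * (w u * q u)%:E)%E.
    exact: emeasurable_funM.
  rewrite -ge0_integralD//.
  apply: ge0_le_integral => //.
  - by move=> u _; rewrite lee_fin mulr_ge0.
  - by apply/measurable_EFinP; exact: mpA.
  - exact: emeasurable_funD.
  move=> u [Uu _]; rewrite -!EFinM -EFinD lee_fin.
  rewrite (mulrCA A^-1) (mulrCA B^-1) -mulrDr ler_wpM2l//.
  rewrite (le_trans (ler_normB _ _))// !normrM.
  by rewrite !(@ger0_norm _ _^-1)// (ger0_norm (q0 u)) (ger0_norm (p0 Uu)) !(mulrC _^-1).
(* The tail of [p] contributes [h B / A <= 2 h] and that of [q] at most [h]. *)
have -> : 3 * h = A^-1 * (h * B) + (3 * h - A^-1 * (h * B)) by ring.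
rewrite EFinD; apply: leeD.
  by rewrite EFinM lee_wpmul2l// lee_fin invr_ge0 ltW.
apply: (@le_trans _ _ ((B^-1)%:E * (h * B)%:E)%E).
  apply: lee_wpmul2l; first by rewrite lee_fin invr_ge0 ltW.
  apply: le_trans tailq; apply: ge0_subset_integral => //.
  - by apply/measurable_EFinP; apply: measurable_funM.
  - by move=> u _; rewrite lee_fin mulr_ge0.
rewrite -EFinM lee_fin (mulrC h) mulKf ?gt_eqF//.
have : A^-1 * (B * h) <= 2 / B * (B * h) by rewrite ler_wpM2r// mulr_ge0// ltW.
have -> : 2 / B * (B * h) = 2 * h by field; rewrite gt_eqF.
by lra.
Qed.

End normalized_weighted_l1.

(** * The local likelihood *)

Section local_geometry.
Context {R : realType} {d : nat} (E : expfam R d) (n : nat).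
Hypothesis n0 : (0 < n)%N.
Implicit Types u : 'cV[R]_d.

Local Notation t0 := (theta0 E).
Local Notation th := (of_local E n).
Local Notation s := (Num.sqrt (n%:R : R)).

Let s0 : 0 < s. Proof. by rewrite sqrtr_gt0 ltr0n. Qed.

Lemma local_spaceE : local_space E n = [set u | Theta E (th u)].
Proof.
apply/seteqP; split => [_ [theta Tt <-]|u Tu] /=.
  rewrite /of_local -scalemxAr scalerA mulVf ?gt_eqF// scale1r mulKmx ?J_unit//.
  by rewrite addrC subrK.
exists (th u) => //; rewrite /of_local addrAC subrr add0r -scalemxAr scalerA.
by rewrite divff ?gt_eqF// scale1r mulKVmx ?J_unit.
Qed.

Lemma measurable_of_local : measurable_fun setT th.
Proof.
apply: measurable_addmx => //; apply: measurable_scalemx => //.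
exact: measurable_mulmx.
Qed.

Lemma measurable_Theta : measurable (Theta E).
Proof. by apply: open_cV_measurable; exact: Theta_open. Qed.

Lemma measurable_local_space : measurable (local_space E n).
Proof.
rewrite local_spaceE -[X in measurable X]setTI.
by apply: measurable_of_local => //; exact: measurable_Theta.
Qed.

(** Because [|J^-1 u|^2 = <u, F^-1 u>], only the operator norm of [F^-1] is needed. *)
Lemma enorm_invJ u : enorm (invmx (J E) *m u) <= Num.sqrt (normFV E) * enorm u.
Proof.
have [Jt _ JJ] := J_sqrt E.
have FV : invmx (F E) = invmx (J E) *m invmx (J E).
  have Fu : F E \in unitmx by exact: hessian_unit.
  have h : F E *m (invmx (J E) *m invmx (J E)) = 1%:M.
    by rewrite /F -JJ mulmxA -(mulmxA (J E)) mulmxV ?J_unit// mulmx1 mulmxV ?J_unit.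
  by rewrite -[LHS]mulmx1 -h mulKmx.
rewrite -ler_sqr ?nnegrE ?mulr_ge0 ?enorm_ge0 ?sqrtr_ge0// exprMn (sqr_sqrtr (opnorm_ge0 _)).
rewrite [leLHS]enorm_sqr dotv_mulmx invmx_J_tr mulmxA -FV.
apply: (le_trans (dotv_le_enorm _ _)).
by rewrite expr2 mulrA ler_wpM2r ?enorm_ge0//; exact: enorm_mulmx_le.
Qed.

Lemma enorm_of_local u :
  enorm (th u - t0) <= Num.sqrt (normFV E) * enorm u / s.
Proof.
rewrite /of_local addrAC subrr add0r enormZ gtr0_norm ?invr_gt0// mulrC.
by rewrite ler_wpM2r ?invr_ge0 ?(ltW s0)// enorm_invJ.
Qed.

Variable nu : probability 'cV[R]_d R.
Hypothesis nuE : forall A, measurable A ->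
  nu A = (\int[dominating E]_(x in A) (pdf E (theta0 E) x)%:E)%E.

(** The function [G] of the overview: [n] times the Bregman divergence of [psi] between [th u] and
    the true parameter. *)
Definition logrem u : R :=
  n%:R * (psi E (th u) - psi E t0 - dotv (mu E) (th u - t0)).

(** The relation between [c] and [rho] makes the ball of radius [rho] coincide in local coordinates
    with the region over which [B2] is taken. Along the ray of length [t = |u| / sqrt n] one factor
    [n t^2 = |u|^2] comes out, and bounding the remaining [t] by [rho / sqrt n] leaves the formula
    of [lambda]. *)
Lemma logrem_taylor (rho c B1r B2r : R) :
  0 <= rho -> c * d%:R / n%:R = (rho / s) ^+ 2 ->
  (B1 E n 0 <= B1r%:E)%E -> (B2 E n c <= B2r%:E)%E ->
  (forall u, enorm u <= rho -> Theta E (th u)) ->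
  forall u, enorm u <= rho ->
  `|logrem u - enorm u ^+ 2 / 2| <=
   6^-1 * (rho / s * B1r + (rho / s) ^+ 2 * B2r) * enorm u ^+ 2.
Proof.
move=> rho0 cE B1P B2P ball u urho.
have T0 := theta0_Theta E.
have [->|u0] := eqVneq u 0.
  by rewrite /logrem /of_local mulmx0 scaler0 addr0 !subrr dotv0r subr0 mulr0
    /enorm dotv0r sqrtr0 expr0n/= mul0r subrr normr0 mulr0.
have ug : 0 < enorm u by rewrite lt_neqAle eq_sym enorm_eq0 u0 enorm_ge0.
pose a := (enorm u)^-1 *: u; pose t := enorm u / s; pose b := invmx (J E) *m a.
have a1 : enorm a = 1 by rewrite enormZ gtr0_norm ?invr_gt0// mulVf// gt_eqF.
have tge0 : 0 <= t by rewrite divr_ge0 ?enorm_ge0// ltW.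
have tT : t <= rho / s by rewrite ler_pM2r// invr_gt0.
have thE : th u = t0 + t *: b.
  rewrite /of_local /b /a -scalemxAr scalerA; congr (_ + _ *: _).
  by rewrite /t mulrAC divff ?mul1r// gt_eqF.
have Jb r : J E *m (t0 + r *: b - t0) = r *: a.
  by rewrite addrAC subrr add0r -scalemxAr mulKVmx ?J_unit.
have sb r : 0 <= r <= t -> enorm (J E *m (t0 + r *: b - t0)) ^+ 2 <= c * d%:R / n%:R.
  move=> /andP[r0 rt]; rewrite Jb enormZ a1 mulr1 ger0_norm// cE.
  rewrite ler_sqr ?nnegrE ?divr_ge0 ?(ltW s0)//.
  exact: le_trans tT.
have Tb r : 0 <= r <= t -> Theta E (t0 + r *: b).
  move=> /andP[r0 rt].
  have := ball (r * s *: a); rewrite enormZ a1 mulr1 ger0_norm; last by rewrite mulr_ge0// ltW.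
  rewrite -ler_pdivlMr// => /(_ (le_trans rt tT)).
  rewrite /of_local -scalemxAr scalerA (mulrC r) mulrA mulVf ?gt_eqF// mul1r//.
have c3 : `|centm3 E nu b t0| <= B1r.
  rewrite -lee_fin; apply: le_trans B1P; apply: ereal_sup_ubound.
  exists a, t0; split => //.
    by split => //; rewrite subrr mulmx0 /enorm dotv0r sqrtr0 expr0n/= !mul0r.
  by rewrite (expect_Vproj3 nuE).
have c4 r : 0 <= r <= t -> centm4 E nu b (t0 + r *: b) <= B2r.
  move=> rt; rewrite -lee_fin; apply: le_trans B2P; apply: ereal_sup_ubound.
  exists a, (t0 + r *: b); split => //.
    by split; [exact: Tb|exact: sb].
  by rewrite (expect_Vproj4 nuE)//; exact: Tb.
have := psi_taylor nuE a1 tge0 Tb c3 c4; rewrite -/b -thE => h.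
have B1r0 : 0 <= B1r by rewrite (le_trans _ c3).
have B2r0 : 0 <= B2r.
  have := c4 0; rewrite lexx tge0 => /(_ isT); apply: le_trans.
  by apply: le_trans (centm2_sqr_le nuE b (Tb _ _)); rewrite ?sqr_ge0// lexx tge0.
have lE : logrem u - enorm u ^+ 2 / 2 =
   n%:R * (psi E (th u) - psi E t0 - t * dotv (mu E) b - t ^+ 2 / 2).
  rewrite /logrem (_ : th u - t0 = t *: b); last by rewrite thE addrAC subrr add0r.
  rewrite dotvZr [in RHS]mulrBr; congr (_ - _).
  have nE : n%:R = s ^+ 2 by rewrite sqr_sqrtr// ler0n.
  rewrite nE /t exprMn exprVn mulrA mulrCA divff ?mulr1// gt_eqF// exprn_gt0//.
rewrite lE normrM ger0_norm ?ler0n//.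
apply: (le_trans (ler_wpM2l (ler0n _ _) h)).
have nt2 : n%:R * t ^+ 2 = enorm u ^+ 2.
  have nE : n%:R = s ^+ 2 by rewrite sqr_sqrtr// ler0n.
  by rewrite nE /t exprMn exprVn mulrCA divff ?mulr1// gt_eqF// exprn_gt0.
have -> : n%:R * (B1r / 6 * t ^+ 3 + B2r / 12 * t ^+ 4) =
   (n%:R * t ^+ 2) * (6^-1 * (t * B1r + t ^+ 2 * (B2r / 2))).
  by move: (n%:R : R) => N; field.
rewrite nt2 mulrC ler_wpM2r ?sqr_ge0// ler_wpM2l ?invr_ge0//.
have h1 : t * B1r <= rho / s * B1r by rewrite ler_wpM2r.
have h2 : t ^+ 2 * (B2r / 2) <= (rho / s) ^+ 2 * B2r.
  apply: ler_pM; rewrite ?sqr_ge0 ?divr_ge0//.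
    by rewrite ler_sqr ?nnegrE ?divr_ge0// ltW.
  by lra.
by lra.
Qed.

(** At the true parameter the variance in a unit direction is 1, and the fourth moment dominates its
    square. Thus a small [lambda] limits [c d / n]. *)
Lemma B2_ge1 (c : R) : (0 < d)%N -> 0 <= c -> (1%:E <= B2 E n c)%E.
Proof.
move=> d0 c0; have T0 := theta0_Theta E.
pose a : 'cV[R]_d := delta_mx (Ordinal d0) ord0.
have a1 : enorm a = 1 by rewrite /enorm dotv_deltal mxE !eqxx sqrtr1.
apply: (@le_trans _ _ (centm4 E nu (invmx (J E) *m a) t0)%:E).
  rewrite lee_fin; apply: le_trans (centm2_sqr_le nuE _ T0).
  suff -> : centm2 E nu (invmx (J E) *m a) t0 = 1 by rewrite expr1n.
  rewrite /centm2 {1}/rawm (tint1_theta0 nuE) divr1 rawm1E -(dotv_mean nuE)//.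
  by rewrite -(mu_mean nuE) -(dotv_F nuE) dotv_F_invJ a1 expr1n.
apply: ereal_sup_ubound; exists a, t0; split => //.
  split => //; rewrite subrr mulmx0 /enorm dotv0r sqrtr0 expr0n/=.
  by rewrite divr_ge0 ?mulr_ge0 ?ler0n.
by rewrite (expect_Vproj4 nuE).
Qed.

(** Shrink [u] to the point [v = (rho / |u|) u] of the sphere. As the remainder is convex along rays
    and vanishes at 0, it grows at least linearly from its value at [v]. *)
Lemma logrem_ge_outside (rho : R) u : 0 < rho -> rho <= enorm u ->
  (forall v, enorm v = rho -> Theta E (th v) /\ rho ^+ 2 / 4 <= logrem v) ->
  Theta E (th u) -> rho * enorm u / 4 <= logrem u.
Proof.
move=> rho0 urho ball Tu.
have ug : 0 < enorm u by exact: lt_le_trans urho.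
pose k := rho / enorm u; pose v := k *: u.
have k01 : 0 <= k <= 1 by rewrite divr_ge0 ?(ltW rho0) ?(ltW ug)//= ler_pdivrMr// mul1r.
have vrho : enorm v = rho.
  by rewrite enormZ ger0_norm ?divr_ge0 ?(ltW rho0) ?(ltW ug)// divfK ?gt_eqF.
have [Tv Gv] := ball v vrho.
have thv : th v = t0 + k *: (th u - t0).
  rewrite /of_local addrAC subrr add0r; congr (_ + _).
  by rewrite /v -scalemxAr !scalerA mulrC.
have := @psi_ray_convex R d E nu nuE (th u - t0) k k01.
rewrite -thv (addrC t0) subrK => /(_ Tu Tv) h.
have Gle : logrem v <= k * logrem u.
  have dv : dotv (mu E) (th v - t0) = k * dotv (mu E) (th u - t0).
    by rewrite thv (addrC t0) addrK dotvZr.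
  by rewrite /logrem mulrCA ler_wpM2l ?ler0n// dv mulrBr lerB.
have : rho ^+ 2 / 4 <= k * logrem u by exact: le_trans Gle.
rewrite /k [leRHS]mulrAC ler_pdivlMr// => h2.
rewrite -(ler_pM2l rho0); apply: le_trans h2; rewrite le_eqVlt; apply/orP; left; apply/eqP.
by field.
Qed.

End local_geometry.

Section measurable_psi.
Context {R : realType} {d : nat} (E : expfam R d).
Variable nu : probability 'cV[R]_d R.
Hypothesis nuE : forall A, measurable A ->
  nu A = (\int[dominating E]_(x in A) (pdf E (theta0 E) x)%:E)%E.

(** On [Theta], [psi] is a constant plus the logarithm of a partial integral of the jointly
    measurable function [(th, x) -> tilt th x], so Tonelli yields measurability. *)
Lemma measurable_psi : measurable_fun (Theta E) (psi E).
Proof.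
pose f (z : 'cV[R]_d * 'cV[R]_d) : \bar R := (tilt E z.1 z.2)%:E.
have mf : measurable_fun setT f.
  apply/measurable_EFinP; apply: measurableT_comp => //.
  apply: measurable_dotv => //; apply: measurable_addmx => //.
have f0 z : (0 <= f z)%E by rewrite lee_fin ltW// tilt_gt0.
have := @measurable_fun_fubini_tonelli_F _ _ _ _ _ nu f mf f0; rewrite /fubini_F /f /= => mF.
apply: (@eq_measurable_fun _ _ _ _ _
  (fun th => psi E (theta0 E) + ln (fine (\int[nu]_x (tilt E th x)%:E)))).
  by move=> th; rewrite inE => Tth; rewrite (integral_tilt nuE)//= expRK addrC subrK.
apply: measurable_funTS; apply: measurable_funD => //.
apply: (measurableT_comp (@measurable_ln R)).
by apply: (measurableT_comp (fine_measurable _)) => //.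
Qed.

End measurable_psi.

Lemma expR_sub1_le (R : realType) (x e : R) : `|x| <= e -> e <= 2^-1 ->
  `|expR x - 1| <= 2 * e.
Proof.
rewrite !ler_norml => /andP[xe1 xe2] e1; apply/andP; split.
  by have h := expR_ge1Dx x; lra.
have h1 := expR_ge1Dx (- x); have xx : expR x * expR (- x) = 1 by exact: expRxMexpNx_1.
have p := expR_gt0 x.
have : expR x * (1 - x) <= 1 by rewrite -[leRHS]xx ler_wpM2l// ltW.
by move: (expR x) p => y p h; nra.
Qed.

(** * Unnormalized posterior and Gaussian kernels *)

Section posterior_reduction.
Context {R : realType} {d n : nat} (E : expfam R d).
Hypothesis n0 : (0 < n)%N.
Variables (prior : 'cV[R]_d -> R) (x : 'I_n -> 'cV[R]_d).
Implicit Types u : 'cV[R]_d.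

Local Notation t0 := (theta0 E).
Local Notation th := (of_local E n).
Local Notation s := (Num.sqrt (n%:R : R)).
Local Notation D := (Delta E x).

Let s0 : 0 < s. Proof. by rewrite sqrtr_gt0 ltr0n. Qed.

Definition post_kernel u : R :=
  prior (th u) / prior t0 * expR (dotv D u - logrem E n u).

Definition gauss_kernel u : R := expR (dotv D u - enorm u ^+ 2 / 2).

(** The total mass of [gauss_kernel], by completing the square around the score. *)
Definition gauss_mass : R := Num.sqrt ((2 * pi) ^+ d) * expR (enorm D ^+ 2 / 2).

(** The identity is exact: the log density is linear in the observation, so the sample enters only
    through its mean, that is through [D], and the rest is deterministic. *)
Lemma likelihood_ratio u : \prod_i pdf E (th u) (x i) =
  (\prod_i pdf E t0 (x i)) * expR (dotv D u - logrem E n u).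
Proof.
under eq_bigr do rewrite pdf_tilt -mulrA /tilt -expRD.
rewrite big_split/= -expR_sum; congr (_ * expR _).
rewrite big_split/= sumr_const card_ord.
have -> : dotv D u = n%:R * (dotv (n%:R^-1 *: (\sum_i x i) - mu E) (th u - t0)).
  rewrite /of_local addrAC subrr add0r dotvZr /Delta dotvZl.
  rewrite dotvC dotv_mulmx invmx_J_tr dotvC.
  rewrite mulrA; congr (_ * _).
  by rewrite -{2}(sqr_sqrtr (ler0n R n)) expr2 mulfK// gt_eqF.
have -> : dotv (n%:R^-1 *: (\sum_i x i) - mu E) (th u - t0) =
    n%:R^-1 * (\sum_i dotv (x i) (th u - t0)) - dotv (mu E) (th u - t0).
  rewrite [LHS]dotvC [LHS]dotvBr dotvZr dotv_sumr [in LHS](dotvC _ (mu E)).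
  by congr (_ * _ - _); apply: eq_bigr => i _; rewrite dotvC.
rewrite /logrem -(mulr_natl (- _)).
have : n%:R != 0 :> R by rewrite gt_eqF// ltr0n.
move: (n%:R : R) (\sum_i _) (dotv (mu E) _) (psi E (th u)) (psi E t0) => N S m p1 p2 N0.
by field.
Qed.

Lemma pdf_gt0 th y : 0 < h E y -> 0 < pdf E th y.
Proof. by move=> hy; rewrite mulr_gt0 ?expR_gt0. Qed.

(** An infinite normalizing integral becomes 0 on both sides, so constants cancel in the posterior
    without knowing that integral to be finite. *)
Lemma fineM_gt0 (c : R) (y : \bar R) : 0 < c -> fine (c%:E * y)%E = c * fine y.
Proof.
move=> c0; case: y => [r| |] //=.
  by rewrite gt0_muley ?lte_fin//= mulr0.
by rewrite gt0_muleNy ?lte_fin//= mulr0.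
Qed.

(** Numerator and denominator share the factor [prior t0] times the likelihood at the true
    parameter. It is positive when every [h (x i)] is, which holds almost surely. *)
Lemma posteriorE u : measurable_fun (local_space E n) post_kernel ->
  (forall theta, Theta E theta -> 0 <= prior theta) ->
  0 < prior t0 -> (forall i, 0 < h E (x i)) ->
  posterior E prior x u =
  post_kernel u / \int[lebesgue_cV R d]_(v in local_space E n) post_kernel v.
Proof.
move=> mk prior0 pt0 hx.
set c := prior t0 * \prod_i pdf E t0 (x i).
have c0 : 0 < c by rewrite mulr_gt0// prodr_gt0// => i _; exact: pdf_gt0.
have numE v : posterior_num E prior x v = c * post_kernel v.
  rewrite /posterior_num likelihood_ratio /c /post_kernel.
  have : prior t0 != 0 by rewrite gt_eqF.
  move: (prior t0) (prior (th v)) (\prod_i _) (expR _) => a b e f a0.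
  by field.
rewrite /posterior numE /Rintegral.
under eq_integral do rewrite numE EFinM.
rewrite ge0_integralZl//; last 4 first.
- exact: measurable_local_space.
- exact/measurable_EFinP.
- move=> v; rewrite local_spaceE//= => Tv.
  by rewrite lee_fin /post_kernel mulr_ge0 ?expR_ge0// divr_ge0 ?prior0 ?(ltW pt0)//; exact: theta0_Theta.
- by rewrite lee_fin ltW.
rewrite fineM_gt0// invfM mulrACA divff ?mul1r// gt_eqF//.
Qed.

(** Lets an absolute tail bound count as a bound relative to the Gaussian mass. *)
Lemma gauss_mass_ge1 : 1 <= gauss_mass.
Proof.
rewrite /gauss_mass -[leLHS]mulr1 ler_pM//.
  rewrite -{1}sqrtr1 ler_wsqrtr// exprn_ege1//.
  by have := pi_ge2 R; lra.
by rewrite -expR0 ler_expR divr_ge0 ?sqr_ge0.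
Qed.

Lemma gaussian_pdfE u : gaussian_pdf D 1%:M u = gauss_kernel u / gauss_mass.
Proof.
rewrite /gaussian_pdf det1 mulr1 invmx1 mul1mx /gauss_mass invfM mulrCA; congr (_ * _).
rewrite -expRN -expRD; congr expR.
rewrite !enorm_sqr !dotvBr ![dotv (u - D) _]dotvC !dotvBr (dotvC u D).
by move: (dotv _ _) (dotv _ _) (dotv _ _) => a b c; field.
Qed.

Lemma measurable_gauss_kernel : measurable_fun setT gauss_kernel.
Proof.
apply: measurableT_comp => //; apply: measurable_funB.
  exact: measurable_dotv.
by apply: measurable_funM => //; apply: measurable_funX; exact: measurable_enorm.
Qed.

Lemma integral_gauss_kernel :
  (\int[lebesgue_cV R d]_u (gauss_kernel u)%:E = gauss_mass%:E)%E.
Proof.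
have g0 : 0 < gauss_mass by exact: lt_le_trans gauss_mass_ge1.
have := @integral_gaussian_pdf1 R d D.
under eq_integral do rewrite gaussian_pdfE mulrC EFinM.
rewrite ge0_integralZl//; last 3 first.
- by apply/measurable_EFinP; exact: measurable_gauss_kernel.
- by move=> u _; rewrite lee_fin expR_ge0.
- by rewrite lee_fin invr_ge0 ltW.
set I := integral _ _ _ => H.
have : (gauss_mass%:E * ((gauss_mass^-1)%:E * I) = gauss_mass%:E)%E by rewrite H mule1.
by rewrite muleA -EFinM divff ?mul1e// gt_eqF.
Qed.

Variable nu : probability 'cV[R]_d R.
Hypothesis nuE : forall A, measurable A ->
  nu A = (\int[dominating E]_(x in A) (pdf E (theta0 E) x)%:E)%E.

Lemma measurable_comp_of_local (f : 'cV[R]_d -> R) :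
  measurable_fun (Theta E) f -> measurable_fun (local_space E n) (fun u => f (th u)).
Proof.
move=> mf; apply: (measurable_comp (measurable_Theta E) _ mf).
  by move=> _ [u + <-]; rewrite local_spaceE.
by apply: measurable_funTS; exact: measurable_of_local.
Qed.

Lemma measurable_logrem : measurable_fun (local_space E n) (logrem E n).
Proof.
apply: measurable_funM => //; apply: measurable_funB.
  apply: measurable_funB => //; apply: measurable_comp_of_local.
  exact: measurable_psi nuE.
apply: measurable_dotv => //; apply: measurable_addmx => //.
by apply: measurable_funTS; exact: measurable_of_local.
Qed.

Lemma measurable_post_kernel : measurable_fun (Theta E) prior ->
  measurable_fun (local_space E n) post_kernel.
Proof.
move=> mprior; apply: measurable_funM.
  by apply: measurable_funM => //; exact: measurable_comp_of_local.
apply: measurableT_comp => //; apply: measurable_funB; last exact: measurable_logrem.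
exact: measurable_dotv.
Qed.

End posterior_reduction.

(** Split [a ln t = a ln rho + a ln (t / rho)]. The first term is at most [rho^2 / 64], the second
    at most [(rho^2 / 64) (t / rho)], and both are below [rho t / 64]. *)
Lemma powR_le_exp (R : realType) (rho a t : R) : 1 <= rho -> 0 <= a ->
  a <= rho ^+ 2 / 64 -> a * ln rho <= rho ^+ 2 / 64 -> rho <= t ->
  t `^ a <= expR (rho * t / 32).
Proof.
move=> rho1 a0 ha hl rt.
have rho0 : 0 < rho by lra.
have t0 : 0 < t by lra.
rewrite /powR gt_eqF// ler_expR.
have -> : ln t = ln rho + ln (t / rho).
  by rewrite -lnM ?posrE ?divr_gt0// mulrC divfK// gt_eqF.
have h1 : ln (t / rho) <= t / rho.
  have e : t / rho = 1 + (t / rho - 1) by ring.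
  have tr0 : 0 < t / rho by exact: divr_gt0.
  by rewrite {1}e; apply: le_trans (le_ln1Dx _) _; lra.
have h2 : a * ln (t / rho) <= rho ^+ 2 / 64 * (t / rho).
  apply: (@le_trans _ _ (a * (t / rho))); first by rewrite ler_wpM2l.
  by rewrite ler_wpM2r// divr_ge0// ltW.
have h3 : rho ^+ 2 / 64 * (t / rho) = rho * t / 64 by field; rewrite gt_eqF.
have h4 : rho ^+ 2 <= rho * t by rewrite expr2 ler_wpM2l// ltW.
by rewrite mulrDr; lra.
Qed.

(** * Tail integrals and the weighted distance for a given sample *)

Section posterior_bound.
Context {R : realType} {d n : nat} (E : expfam R d).
Hypothesis n0 : (0 < n)%N.
Variables (prior : 'cV[R]_d -> R) (x : 'I_n -> 'cV[R]_d).
Variable nu : probability 'cV[R]_d R.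
Hypothesis nuE : forall A, measurable A ->
  nu A = (\int[dominating E]_(x in A) (pdf E (theta0 E) x)%:E)%E.
Implicit Types u : 'cV[R]_d.

Local Notation t0 := (theta0 E).
Local Notation th := (of_local E n).
Local Notation D := (Delta E x).
Local Notation leb := (lebesgue_cV R d).

Variables (rho lam kap C a : R).
Hypotheses (mprior : measurable_fun (Theta E) prior)
  (prior0 : forall theta, Theta E theta -> 0 <= prior theta)
  (pt0 : 0 < prior t0) (hx : forall i, 0 < h E (x i)).
Hypotheses (rho1 : 1 <= rho) (rhod : Num.sqrt d%:R <= rho) (a0 : 0 <= a)
  (ha : a <= rho ^+ 2 / 64) (hl : a * ln rho <= rho ^+ 2 / 64).
Hypothesis Drho : enorm D <= rho / 8.
Hypothesis ball : forall u, enorm u <= rho -> Theta E (th u).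
Hypotheses (lam0 : 0 <= lam) (lam4 : lam <= 4^-1)
  (lamP : forall u, enorm u <= rho -> `|logrem E n u - enorm u ^+ 2 / 2| <= lam * enorm u ^+ 2).
Hypotheses (kap0 : 0 <= kap)
  (kapP : forall u, enorm u <= rho ->
     0 < prior (th u) /\ `|ln (prior (th u)) - ln (prior t0)| <= kap).
Hypotheses (C0 : 0 <= C)
  (CP : forall u, Theta E (th u) -> prior (th u) / prior t0 <= expR (C * d%:R)).

(** The factor [64 ^ d] bounds the integral of [exp (- rho |u| / 32)], namely
    [(64 sqrt d / rho) ^ d], using [sqrt d <= rho]. *)
Definition tail_bound : R := expR (C * d%:R - rho ^+ 2 / 32) * 64 ^+ d.

Let rho0 : 0 < rho. Proof. exact: lt_le_trans rho1. Qed.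

Let N : set 'cV[R]_d := [set u | enorm u <= rho].

Let mw : measurable_fun [set: 'cV[R]_d] (fun u => enorm u `^ a).
Proof. by apply: (measurableT_comp (measurable_powR _)); exact: measurable_enorm. Qed.

Lemma tail_integral_le (S : set 'cV[R]_d) (f : 'cV[R]_d -> R) :
  measurable S -> measurable_fun S f -> (forall u, S u -> 0 <= f u) ->
  (forall u, S u -> rho < enorm u) ->
  (forall u, S u -> f u <= expR (C * d%:R) * expR (- (rho * enorm u / 8))) ->
  (\int[leb]_(u in S) (enorm u `^ a * f u)%:E <= tail_bound%:E)%E.
Proof.
move=> mS mf f0 Srho fb.
pose k := expR (C * d%:R - rho ^+ 2 / 32).
have me : measurable_fun [set: 'cV[R]_d] (fun u => (expR (- (rho / 32 * enorm u)))%:E).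
  apply/measurable_EFinP; apply: measurableT_comp => //; apply: measurableT_comp => //.
  by apply: measurable_funM => //; exact: measurable_enorm.
apply: (@le_trans _ _ (\int[leb]_(u in S) (k%:E * (expR (- (rho / 32 * enorm u)))%:E))%E).
  apply: ge0_le_integral => //.
  - by move=> u Su; rewrite lee_fin mulr_ge0 ?powR_ge0 ?f0.
  - apply/measurable_EFinP; apply: measurable_funM => //.
    exact: measurable_funS mw.
  - by apply: emeasurable_funM => //; exact: measurable_funS me.
  move=> u Su; rewrite -EFinM lee_fin.
  have ru := ltW (Srho _ Su).
  apply: (@le_trans _ _ (expR (rho * enorm u / 32) *
     (expR (C * d%:R) * expR (- (rho * enorm u / 8))))).
    by apply: ler_pM => //; [exact: powR_ge0|exact: f0|exact: powR_le_exp|exact: fb].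
  (* The decay [rho |u| / 8] pays [rho |u| / 32] for the weight and [rho^2 / 32 <= rho |u| / 32] for
     the constant; a further [rho |u| / 32] is kept for the integration. *)
  rewrite /k -!expRD ler_expR.
  have : rho ^+ 2 <= rho * enorm u by rewrite expr2 ler_wpM2l// ltW.
  have := sqr_ge0 rho.
  by move: (rho ^+ 2) (C * d%:R) => r2 cd h1 h2; lra.
rewrite ge0_integralZl//; last 2 first.
- exact: measurable_funS me.
- by rewrite lee_fin expR_ge0.
rewrite /tail_bound EFinM; apply: lee_wpmul2l; first by rewrite lee_fin expR_ge0.
apply: (@le_trans _ _ (\int[leb]_u (expR (- (rho / 32 * enorm u)))%:E)%E).
  by apply: ge0_subset_integral.
apply: (le_trans (integral_exp_enorm_le _ _)); first by rewrite divr_gt0.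
rewrite lee_fin lerXn2r ?nnegrE//.
  by rewrite !mulr_ge0 ?sqrtr_ge0// invr_ge0 divr_ge0// ltW.
rewrite invf_div.
have -> : 2 * Num.sqrt d%:R * (32 / rho) = 64 * (Num.sqrt d%:R / rho).
  by move: (Num.sqrt d%:R) => z; field; rewrite gt_eqF.
by rewrite -[leRHS]mulr1 ler_wpM2l// ler_pdivrMr// mul1r.
Qed.

Hypothesis small : 2 * (lam * rho ^+ 2 + kap) * rho `^ a + 2 * tail_bound <= 2^-1.

Let W1 : 1 <= rho `^ a.
Proof. by rewrite -(powRr0 rho) ler_powR. Qed.

Let tb0 : 0 <= tail_bound.
Proof. by rewrite mulr_ge0 ?expR_ge0// exprn_ge0. Qed.

Let e0 : 0 <= lam * rho ^+ 2 + kap.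
Proof. by rewrite addr_ge0// mulr_ge0// sqr_ge0. Qed.

Let e12 : lam * rho ^+ 2 + kap <= 2^-1.
Proof.
have := e0; have := W1; have := tb0; have := small.
by move: (lam * rho ^+ 2 + kap) tail_bound (rho `^ a) => e t w; nra.
Qed.

Let dotD u : dotv D u <= rho / 8 * enorm u.
Proof. by apply: (le_trans (dotv_le_enorm _ _)); rewrite ler_wpM2r ?enorm_ge0. Qed.

Lemma posterior_l1_bound :
  (\int[leb]_(u in local_space E n)
     (enorm u `^ a * `|posterior E prior x u - gaussian_pdf D 1%:M u|)%:E <=
   (8 * ((lam * rho ^+ 2 + kap) * rho `^ a) + 7 * tail_bound)%:E)%E.
Proof.
have mk := @measurable_post_kernel R d n E n0 prior x nu nuE mprior.
have B1 := @gauss_mass_ge1 R d n E x.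
under eq_integral do rewrite posteriorE// gaussian_pdfE.
have -> : 8 * ((lam * rho ^+ 2 + kap) * rho `^ a) + 7 * tail_bound =
  4 * (2 * (lam * rho ^+ 2 + kap) * rho `^ a) + 7 * tail_bound by ring.
have mN : measurable N.
  rewrite /N -[X in measurable X]setTI (_ : [set u | _] = (@enorm R d) @^-1` `]-oo, rho]).
    by apply: measurable_enorm.
  by apply/seteqP; split => u /=; rewrite in_itv.
(* The weight increases with [|u|], so [rho ^ a] separates its values inside and outside the ball.
   The factor 2 in the relative error comes from [expR_sub1_le]. *)
apply: (@normalized_weighted_l1_le _ _ R leb (local_space E n) N
  (post_kernel E prior x) (gauss_kernel E x) (fun u => enorm u `^ a) (gauss_mass E x)
  (rho `^ a) (2 * (lam * rho ^+ 2 + kap)) tail_bound) => //.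
- exact: measurable_local_space.
- by move=> u Nu; rewrite local_spaceE//=; exact: ball.
- exact: measurable_gauss_kernel.
- move=> u; rewrite local_spaceE//= => Tu.
  by rewrite /post_kernel mulr_ge0 ?expR_ge0// divr_ge0 ?prior0 ?(ltW pt0)//; exact: theta0_Theta.
- by move=> u; exact: expR_ge0.
- by move=> u; exact: powR_ge0.
- exact: lt_le_trans B1.
- by rewrite mulr_ge0.
- exact: integral_gauss_kernel.
(* Inside the ball the ratio of the kernels is [exp z], where [z] is the change of log prior minus
   the error of the quadratic approximation. *)
- move=> u Nu; have [pu kP] := kapP Nu; have lP := lamP Nu.
  have -> : post_kernel E prior x u = gauss_kernel E x u *
     expR ((ln (prior (th u)) - ln (prior t0)) - (logrem E n u - enorm u ^+ 2 / 2)).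
    rewrite /post_kernel /gauss_kernel -{1}(lnK pu) -{1}(lnK pt0) -expRN -!expRD.
    by congr expR; move: (dotv D u) (enorm u ^+ 2) => A2 A3; ring.
  set z := _ - (_ - _ / 2).
  have -> : gauss_kernel E x u * expR z - gauss_kernel E x u =
     (expR z - 1) * gauss_kernel E x u by ring.
  rewrite normrM (ger0_norm (expR_ge0 _)) ler_wpM2r ?expR_ge0//.
  apply: expR_sub1_le e12; rewrite /z (le_trans (ler_normB _ _))// addrC lerD//.
  apply: (le_trans lP); rewrite ler_wpM2l// ler_sqr ?nnegrE ?enorm_ge0 ?(ltW rho0)//.
- by move=> u Nu; rewrite ge0_ler_powR ?nnegrE ?enorm_ge0 ?(ltW rho0).
- move=> u /negP; rewrite -ltNge => ru.
  by rewrite ge0_ler_powR ?nnegrE ?enorm_ge0 ?(ltW rho0)// ltW.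
- apply: (@le_trans _ _ tail_bound%:E); last by rewrite lee_fin ler_peMr.
  apply: tail_integral_le.
  + by apply: measurableD => //; exact: measurable_local_space.
  + by apply: measurable_funS mk => //; exact: measurable_local_space.
  + move=> u []; rewrite local_spaceE//= => Tu _.
    by rewrite /post_kernel mulr_ge0 ?expR_ge0// divr_ge0 ?prior0 ?(ltW pt0)//; exact: theta0_Theta.
  + by move=> u [_ /negP]; rewrite -ltNge.
  move=> u []; rewrite local_spaceE//= => Tu /negP; rewrite -ltNge => ru.
  rewrite /post_kernel; apply: ler_pM.
  + by rewrite divr_ge0 ?prior0 ?(ltW pt0)//; exact: theta0_Theta.
  + exact: expR_ge0.
  + exact: CP.
  rewrite ler_expR.
  have := @logrem_ge_outside R d E n nu nuE rho u rho0 (ltW ru).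
  (* On the sphere [lam <= 1 / 4] leaves [G >= rho^2 / 4]. Outside, [G >= rho |u| / 4] then beats
     the linear term [<D, u> <= rho |u| / 8] by [rho |u| / 8]. *)
  have hv v : enorm v = rho -> Theta E (th v) /\ rho ^+ 2 / 4 <= logrem E n v.
    move=> vr; have vN : enorm v <= rho by rewrite vr.
    split; first exact: ball.
    have := lamP vN; rewrite vr ler_norml => /andP[h1 _].
    have : lam * rho ^+ 2 <= 4^-1 * rho ^+ 2 by rewrite ler_wpM2r// sqr_ge0.
    by move: h1; move: (rho ^+ 2) => r2; lra.
  move=> /(_ hv Tu) h; have := dotD u; move: h.
  have -> : rho / 8 * enorm u = rho * enorm u / 8 by ring.
  by move: (rho * enorm u) (dotv D u) => A2 A3; lra.
- apply: (@le_trans _ _ tail_bound%:E); last by rewrite lee_fin ler_peMr.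
  apply: tail_integral_le.
  + exact: measurableC.
  + by apply: measurable_funTS; exact: measurable_gauss_kernel.
  + by move=> u _; exact: expR_ge0.
  + by move=> u /negP; rewrite -ltNge.
  move=> u /negP; rewrite -ltNge => ru.
  (* Since [exp (C d) >= 1], the Gaussian tail obeys the same bound as the posterior tail. *)
  rewrite /gauss_kernel -[leLHS]mul1r; apply: ler_pM => //.
    by rewrite -expR0 ler_expR mulr_ge0.
  rewrite ler_expR; have := dotD u.
  have : rho * enorm u <= enorm u ^+ 2 by rewrite expr2 ler_wpM2r ?enorm_ge0// ltW.
  have : 0 <= rho * enorm u by rewrite mulr_ge0 ?enorm_ge0// ltW.
  have -> : rho / 8 * enorm u = rho * enorm u / 8 by ring.
  by move: (rho * enorm u) (dotv D u) (enorm u ^+ 2) => A2 A3 A4; lra.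
Qed.

End posterior_bound.

(** * Measurability of the weighted distance as a function of the sample *)

Section measurable_l1.
Context {R : realType} {disp : measure_display} {Omega : measurableType disp}
  {d n : nat} (E : expfam R d).
Hypothesis n0 : (0 < n)%N.
Variables (prior : 'cV[R]_d -> R) (X : 'I_n -> Omega -> 'cV[R]_d).
Hypothesis mX : forall i, measurable_fun setT (X i).
Variable nu : probability 'cV[R]_d R.
Hypothesis nuE : forall A, measurable A ->
  nu A = (\int[dominating E]_(x in A) (pdf E (theta0 E) x)%:E)%E.
Hypotheses (mprior : measurable_fun (Theta E) prior)
  (prior0 : forall theta, Theta E theta -> 0 <= prior theta).
Variable a : R.

Local Notation th := (of_local E n).
Local Notation U := (local_space E n).
Local Notation leb := (lebesgue_cV R d).

Let priorU := (prior \o th) \_ U.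
Let psiU := (psi E \o th) \_ U.

Let mpriorU : measurable_fun setT priorU.
Proof.
apply/(measurable_restrictT _ (measurable_local_space E n0)).
exact: measurable_comp_of_local.
Qed.

Let mpsiU : measurable_fun setT psiU.
Proof.
apply/(measurable_restrictT _ (measurable_local_space E n0)).
by apply: measurable_comp_of_local => //; exact: measurable_psi nuE.
Qed.

(** The prior and [psi] are known to be measurable only on [Theta]; cutting both off outside the
    local space gives a jointly measurable numerator, which vanishes there through the prior
    factor. *)
Let num (z : Omega * 'cV[R]_d) : R :=
  priorU z.2 * \prod_i (h E (X i z.1) * expR (dotv (X i z.1) (th z.2) - psiU z.2)).

Let mX1 i : measurable_fun setT (fun z : Omega * 'cV[R]_d => X i z.1).
Proof. exact: measurableT_comp (mX i) measurable_fst. Qed.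

Let mnum : measurable_fun setT num.
Proof.
apply: measurable_funM; first exact: (measurableT_comp mpriorU measurable_snd).
apply: measurable_prod => i _; apply: measurable_funM.
  exact: (measurableT_comp (h_measurable E) (mX1 i)).
apply: measurableT_comp => //; apply: measurable_funB.
  apply: measurable_dotv => //.
  exact: (measurableT_comp (measurable_of_local E n) measurable_snd).
exact: (measurableT_comp mpsiU measurable_snd).
Qed.

Let num_ge0 z : 0 <= num z.
Proof.
rewrite /num mulr_ge0//.
  rewrite /priorU patchE; case: ifPn => //; rewrite inE local_spaceE//= => Tu.
  exact: prior0.
by rewrite prodr_ge0// => i _; rewrite mulr_ge0 ?expR_ge0 ?h_ge0.
Qed.

Let numE w u : U u -> num (w, u) = posterior_num E prior (fun i => X i w) u.
Proof.
by move=> Uu; rewrite /num /priorU /psiU !patchE mem_set.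
Qed.

Let num_out w u : ~ U u -> num (w, u) = 0.
Proof. by move=> Uu; rewrite /num /priorU patchE memNset// mul0r. Qed.

Let Z w := (\int[leb]_u (num (w, u))%:E)%E.

Let mZ : measurable_fun setT Z.
Proof.
have mf : measurable_fun setT (fun z => (num z)%:E) by exact/measurable_EFinP.
exact: (@measurable_fun_fubini_tonelli_F _ _ _ _ _ leb (fun z => (num z)%:E) mf
  (fun z => num_ge0 z)).
Qed.

Let ZE w : fine (Z w) =
  \int[leb]_(v in U) posterior_num E prior (fun i => X i w) v.
Proof.
congr fine; rewrite [RHS]integral_mkcond; apply: eq_integral => u _.
rewrite patchE; case: ifPn => [|]; first by rewrite inE => /numE ->.
by rewrite notin_setE => /num_out ->.
Qed.

(** Tonelli is used twice, for the normalizing integral and for the distance itself. Measurability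
    is needed to bound the probability of the exceptional event by monotonicity. *)
Lemma measurable_posterior_l1 : measurable_fun setT (fun w =>
  (\int[leb]_(u in U) (enorm u `^ a * `|posterior E prior (fun i => X i w) u
    - gaussian_pdf (Delta E (fun i => X i w)) 1%:M u|)%:E)%E).
Proof.
have mD : measurable_fun setT (fun w => Delta E (fun i => X i w)).
  exact: measurable_Delta.
pose f (z : Omega * 'cV[R]_d) : R := \1_U z.2 * (enorm z.2 `^ a *
  `|num z / fine (Z z.1) - gaussian_pdf (Delta E (fun i => X i z.1)) 1%:M z.2|).
have f0 z : 0 <= f z by rewrite mulr_ge0// mulr_ge0 ?powR_ge0.
have mf : measurable_fun setT f.
  apply: measurable_funM.
    apply: (measurableT_comp _ measurable_snd).
    by apply: measurable_indic; exact: measurable_local_space.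
  apply: measurable_funM.
    apply: (measurableT_comp (measurable_powR _)).
    by apply: measurable_enorm; exact: measurable_snd.
  apply: measurableT_comp => //; apply: measurable_funB.
    apply: measurable_funM => //; apply: measurable_invr_ge0.
      by move=> z; rewrite fine_ge0//; apply: integral_ge0 => u _; rewrite lee_fin.
    apply: (measurableT_comp (fine_measurable _)) => //.
    exact: (measurableT_comp mZ measurable_fst).
  have mE : measurable_fun setT (fun z : Omega * 'cV[R]_d =>
      z.2 - Delta E (fun i => X i z.1)).
    apply: measurable_addmx; first exact: measurable_snd.
    under eq_fun do rewrite -scaleN1r.
    apply: measurable_scalemx => //.
    exact: (measurableT_comp mD measurable_fst).
  apply: measurable_funM => //; apply: measurableT_comp => //; apply: measurableT_comp => //.
  by apply: measurable_funM => //; apply: measurable_dotv => //; exact: measurable_mulmx.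
have := @measurable_fun_fubini_tonelli_F _ _ _ _ _ leb (fun z => (f z)%:E).
have mf' : measurable_fun setT (fun z => (f z)%:E) by exact/measurable_EFinP.
move=> /(_ mf' (fun z => f0 z)); apply: eq_measurable_fun => w _.
rewrite /fubini_F/= [RHS]integral_mkcond; apply: eq_integral => u _.
rewrite patchE /f/= indicE; case: ifPn => [|_]; last by rewrite mul0r.
rewrite inE => Uu; rewrite mul1r numE// ZE//.
Qed.

End measurable_l1.

(** * Probability bound for one sample size *)

Section fixed_sample_size.
Context {R : realType} {disp : measure_display} {Omega : measurableType disp}
  (P : probability Omega R) {d n : nat} (E : expfam R d).
Variables (X : 'I_n -> {RV P >-> 'cV[R]_d}) (prior : 'cV[R]_d -> R).
Hypotheses (n0 : (0 < n)%N) (Xiid : iid_from E X).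
Hypotheses (mprior : measurable_fun (Theta E) prior)
  (prior0 : forall theta, Theta E theta -> 0 <= prior theta).

Local Notation th := (of_local E n).
Local Notation t0 := (theta0 E).

(** The density of [X i] has the factor [h], which vanishes on this set because it is
    nonnegative. *)
Lemma null_h i : P [set w | h E (X i w) <= 0] = 0%E.
Proof.
pose A := [set x | h E x <= 0].
have mA : measurable A.
  rewrite /A -[X in measurable X]setTI (_ : [set x | _] = h E @^-1` `]-oo, 0]).
    exact: h_measurable.
  by apply/seteqP; split => x /=; rewrite in_itv.
have -> : [set w | h E (X i w) <= 0] = X i @^-1` A by [].
rewrite -[LHS]/(distribution P (X i) A) Xiid.2//; apply: integral0_eq => x Ax.
have hx : h E x = 0 by apply/le_anti; rewrite h_ge0 andbT.
by rewrite /pdf /expfam_pdf hx mul0r.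
Qed.

(** The distance can exceed [eps] only if [|D| >= rho / 8], controlled by Markov's inequality, or if
    some [h (X i)] vanishes, which has probability 0. *)
Lemma posterior_l1_probability (rho lam kap C a eps : R) :
  0 < prior t0 -> 1 <= rho -> Num.sqrt d%:R <= rho -> 0 <= a ->
  a <= rho ^+ 2 / 64 -> a * ln rho <= rho ^+ 2 / 64 ->
  (forall u, enorm u <= rho -> Theta E (th u)) ->
  0 <= lam -> lam <= 4^-1 ->
  (forall u, enorm u <= rho ->
     `|logrem E n u - enorm u ^+ 2 / 2| <= lam * enorm u ^+ 2) ->
  0 <= kap ->
  (forall u, enorm u <= rho ->
     0 < prior (th u) /\ `|ln (prior (th u)) - ln (prior t0)| <= kap) ->
  0 <= C -> (forall u, Theta E (th u) -> prior (th u) / prior t0 <= expR (C * d%:R)) ->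
  2 * (lam * rho ^+ 2 + kap) * rho `^ a + 2 * tail_bound (d := d) rho C <= 2^-1 ->
  8 * ((lam * rho ^+ 2 + kap) * rho `^ a) + 7 * tail_bound (d := d) rho C < eps ->
  (P [set w | eps%:E <= `|\int[lebesgue_cV R d]_(u in local_space E n)
     (enorm u `^ a * `|posterior E prior (fun i => X i w) u
       - gaussian_pdf (Delta E (fun i => X i w)) 1%:M u|)%:E|] <=
   (64 * d%:R / rho ^+ 2)%:E)%E.
Proof.
move=> pt0 rho1 rhod a0 ha hl ball lam0 lam4 lamP kap0 kapP C0 CP small bnd.
pose i0 : 'I_n := Ordinal n0.
pose nu : probability 'cV[R]_d R := distribution P (X i0).
have nuE : forall A, measurable A ->
  nu A = (\int[dominating E]_(x in A) (pdf E t0 x)%:E)%E by exact: distributionE.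
have rho0 : 0 < rho by exact: lt_le_trans rho1.
pose Z w := (\int[lebesgue_cV R d]_(u in local_space E n)
     (enorm u `^ a * `|posterior E prior (fun i => X i w) u
       - gaussian_pdf (Delta E (fun i => X i w)) 1%:M u|)%:E)%E.
rewrite -[X in P X]/[set w | (eps%:E <= `|Z w|)%E].
have mX i : measurable_fun setT (X i) by [].
have mZ : measurable_fun setT Z by exact: measurable_posterior_l1 nuE _ _ _.
pose S1 := [set w | rho ^+ 2 / 64 <= enorm (Delta E (fun i => X i w)) ^+ 2].
pose S2 := \big[setU/set0]_(i < n) [set w | h E (X i w) <= 0].
have mS1 : measurable S1.
  rewrite /S1 -[X in measurable X]setTI (_ : [set w | _] =
    (fun w => enorm (Delta E (fun i => X i w)) ^+ 2) @^-1` `[rho ^+ 2 / 64, +oo[).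
    apply: (measurable_funX 2 (measurable_enorm (measurable_Delta E mX))) => //.
  by apply/seteqP; split => w /=; rewrite in_itv/= andbT.
have mh i : measurable [set w | h E (X i w) <= 0].
  rewrite -[X in measurable X]setTI (_ : [set w | _] = (h E \o X i) @^-1` `]-oo, 0]).
    by apply: (measurableT_comp (h_measurable E) (mX i)).
  by apply/seteqP; split => w /=; rewrite in_itv.
have [mS2 PS2] : measurable S2 /\ P S2 = 0%E.
  apply: (big_ind (fun A => measurable A /\ P A = 0%E)).
  - by rewrite measure0.
  - move=> A B [mA A0] [mB B0]; split; first exact: measurableU.
    have : (P (A `|` B) <= P A + P B)%E by exact: measureU2.
    by rewrite A0 B0 adde0 => ?; apply/eqP; rewrite eq_le measure_ge0 andbT.
  - by move=> i _; split; [exact: mh|exact: null_h].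
apply: (@le_trans _ _ (P (S1 `|` S2))).
  apply: le_measure; rewrite ?inE.
  - have -> : [set w | (eps%:E <= `|Z w|)%E] = (abse \o Z) @^-1` `[eps%:E, +oo[.
      by apply/seteqP; split => w /=; rewrite in_itv/= andbT.
    rewrite -[X in measurable X]setTI.
    by apply: (measurableT_comp (@abse_measurable _ setT) mZ) => //; exact: emeasurable_itv.
  - exact: measurableU.
  - move=> w /= epsZ; apply: contrapT => /not_orP[nS1 nS2].
    have hx i : 0 < h E (X i w).
      rewrite ltNge; apply/negP => hi; apply: nS2.
      by rewrite /S2 -bigcup_seq; exists i => //=; exact: mem_index_enum.
    have Dr : enorm (Delta E (fun i => X i w)) <= rho / 8.
      move: nS1 => /negP; rewrite -ltNge => Dlt.
      rewrite -ler_sqr ?nnegrE ?enorm_ge0 ?divr_ge0 ?(ltW rho0)//.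
      by rewrite ltW// (lt_le_trans Dlt)// exprMn exprVn -natrX.
    have := @posterior_l1_bound R d n E n0 prior (fun i => X i w) nu nuE rho lam kap C a
      mprior prior0 pt0 hx rho1 rhod a0 ha hl Dr ball lam0 lam4 lamP kap0 kapP C0 CP small.
    rewrite -/(Z w) => Zle; move: epsZ; rewrite gee0_abs; last first.
      by apply: integral_ge0 => u _; rewrite lee_fin mulr_ge0 ?powR_ge0.
    move=> /le_trans/(_ Zle); rewrite lee_fin leNgt; by rewrite bnd.
have : (P (S1 `|` S2) <= P S1 + P S2)%E by exact: measureU2.
rewrite PS2 adde0 => /le_trans; apply.
have r64 : 0 < rho ^+ 2 / 64 by rewrite divr_gt0// exprn_gt0.
have := Delta_markov i0 Xiid r64; rewrite -/S1 => /le_trans; apply.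
by rewrite lee_fin invf_div mulrA (mulrC 64).
Qed.
End fixed_sample_size.

(** * Growth of the truncation radius *)

Lemma expR1_le4 (R : realType) : expR 1 <= 4 :> R.
Proof.
have h := expR_ge1Dx (- (2^-1 : R)); have xx := @expRxMexpNx_1 R 2^-1.
have p := expR_gt0 (2^-1 : R).
have e1 : expR 1 = expR 2^-1 ^+ 2 :> R by rewrite -expRM_natl divff.
have : expR 2^-1 <= 2 :> R by move: (expR 2^-1) (expR (- 2^-1)) h xx p => z z' h xx p; nra.
by rewrite e1; move: (expR 2^-1) p => z p h2; nra.
Qed.

Lemma ln_ge1 (R : realType) (x : R) : 4 <= x -> 1 <= ln x.
Proof.
move=> x4; have x0 : 0 < x by lra.
by rewrite -[leLHS]expRK ler_ln ?posrE ?expR_gt0// (le_trans (expR1_le4 R)).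
Qed.

Lemma ln_le_sub1 (R : realType) (x : R) : 0 < x -> ln x <= x - 1.
Proof.
move=> x0; rewrite -{1}[x](subrK 1) addrC.
by apply: le_ln1Dx; lra.
Qed.

Lemma Mda_bounds (R : realType) (d : nat) (a : R) : 4 <= d%:R :> R -> 0 <= a ->
  [/\ Mda d a = d%:R + a + a * ln (d%:R + a), 1 <= ln (d%:R + a) & Mda d a <= (d%:R + a) ^+ 2].
Proof.
move=> d4 a0; rewrite /Mda; set D := d%:R + a.
have D4 : 4 <= D by rewrite /D; lra.
have D0 : D != 0 by rewrite gt_eqF//; lra.
have l1 := ln_ge1 D4.
have ME : D * (1 + a * ln D / D) = D + a * ln D by rewrite mulrDr mulr1 mulrC divfK.
have D_gt0 : 0 < D by lra.
have l2 := ln_le_sub1 D_gt0.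
split=> //; rewrite ME.
have : a * ln D <= D * ln D by rewrite ler_wpM2r ?/D; lra.
have : D * ln D <= D * (D - 1) by rewrite ler_wpM2l//; lra.
by move: (a * ln D) (D * ln D) => p q h1 h2; nra.
Qed.

(** Writing [c = k^2] makes [ln c = 2 ln k] at most linear in [k]. With [D = d + a] and [M <= D^2],
    this gives [a ln (c M) / 2 <= a k + a ln D <= (k + 1) M], and [k >= 66] ensures
    [k + 1 <= k^2 / 64]. *)
Lemma Mda_scaled_bounds (R : realType) (d : nat) (a k : R) :
  let c := k ^+ 2 in let M := Mda d a in
  4 <= d%:R :> R -> 0 <= a -> 66 <= k ->
  [/\ d%:R <= M /\ 1 <= c, 1 <= c * M, a <= c * M / 64,
      ln (d%:R + a) <= ln (c * M) & a * (ln (c * M) / 2) <= c * M / 64].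
Proof.
move=> c M d4 a0 k66.
have [ME lD1 MD2] := Mda_bounds d4 a0; rewrite -/M in ME MD2.
set D := d%:R + a in ME lD1 MD2 *.
have dD : d%:R <= D by rewrite /D; lra.
have aD : a <= D by rewrite /D; lra.
have alD : 0 <= a * ln D by rewrite mulr_ge0//; lra.
have DM : D <= M by rewrite ME lerDl.
have alM : a * ln D <= M by rewrite ME; lra.
have k0 : 0 < k by lra.
have lk := ln_le_sub1 k0.
have c1 : 64 <= c by rewrite /c; nra.
have kc : k + 1 <= c / 64 by rewrite /c; nra.
have cE : ln c = 2 * ln k by rewrite /c lnXn// mulr_natl.
clearbody c M D.
have M4 : 4 <= M by lra.
have MM : 64 * M <= c * M by rewrite ler_wpM2r//; lra.
have D0 : 0 < D by lra.
have M0 : 0 < M by lra.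
have c0 : 0 < c by lra.
have lncM : ln (c * M) <= 2 * k + 2 * ln D.
  rewrite lnM ?posrE// lerD//; first by lra.
  by rewrite mulr_natl -lnXn// ler_ln// ?posrE// exprn_gt0.
split; [by split; lra|lra|lra| |].
  by rewrite ler_ln ?posrE ?mulr_gt0//; lra.
have h1 : a * (ln (c * M) / 2) <= a * (k + ln D) by rewrite ler_wpM2l//; lra.
have h2 : a * k <= M * k by rewrite ler_wpM2r//; lra.
have h3 : (k + 1) * M <= c / 64 * M by rewrite ler_wpM2r// ltW.
by rewrite mulrDr in h1; lra.
Qed.

(** Taking logarithms, the hypothesis bounds [a] and [a ln (d + a)] by [2 ln N], hence
    [M <= d + 4 ln N]. Then [c M <= 5 c d ln N], which is below [d ln N ^ 2] once
    [ln N >= 5 c + 1]. *)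
Lemma Mda_scaled_le_log (R : realType) (d : nat) (a k N : R) :
  let c := k ^+ 2 in let M := Mda d a in
  4 <= d%:R :> R -> 0 <= a -> 66 <= k -> 0 < N -> 5 * c + 1 <= ln N ->
  c * M * (c * M) `^ (1 + a / 2) <= N -> c * M <= d%:R * ln N ^+ 2.
Proof.
move=> c M d4 a0 k66 N0 lnN hN.
have [[Md c1] cM1 _ lDc _] := @Mda_scaled_bounds R d a k d4 a0 k66.
have [ME lD1 _] := Mda_bounds d4 a0.
rewrite -/c -/M in Md c1 cM1 lDc ME.
set D := d%:R + a in ME lD1 lDc.
have DE : D = d%:R + a by [].
clearbody c M D.
set w := (c * M) `^ (1 + a / 2) in hN.
have w0 : 0 < w by rewrite powR_gt0//; lra.
have h2 : (1 + a / 2) * ln (c * M) <= ln N.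
  rewrite -ln_powR -/w ler_ln ?posrE//.
  by apply: le_trans hN; rewrite ler_peMl// ltW.
have h3 : a / 2 * ln D <= a / 2 * ln (c * M) by rewrite ler_wpM2l// divr_ge0.
have alogn : a * ln D <= 2 * ln N by rewrite mulrDl mul1r in h2; lra.
have h1 : a <= a * ln D by rewrite ler_peMr.
have h4 : M <= d%:R + 4 * ln N by lra.
have l1 : 1 <= ln N by lra.
move: (ln N) l1 h4 lnN => l l1 h4 lnN.
have h5 : c * M <= c * (d%:R + 4 * l) by rewrite ler_wpM2l//; lra.
have cl0 : 0 <= c * l by rewrite mulr_ge0//; lra.
have h6 : c * l <= d%:R * (c * l) by rewrite ler_peMl//; lra.
have h7 : (5 * c + 1) * l <= l ^+ 2 by rewrite expr2 ler_wpM2r//; lra.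
have h8 : c <= c * l by rewrite ler_peMr//; lra.
have h9 : d%:R * (c + 4 * (c * l)) <= d%:R * l ^+ 2 by rewrite ler_wpM2l//; lra.
by lra.
Qed.

Lemma sqrtr_mul_sqr_div (R : realType) (z r m : R) : 0 <= z -> 0 <= r -> 0 <= m ->
  Num.sqrt (z * r ^+ 2 / m) = Num.sqrt z * r / Num.sqrt m.
Proof.
move=> z0 r0 m0; rewrite sqrtrM ?mulr_ge0 ?sqr_ge0// sqrtrV//.
by rewrite sqrtrM// sqrtr_sqr ger0_norm.
Qed.

(** * From the growth conditions to the hypotheses of the probability bound *)

Section fixed_n_asymptotics.
Context {R : realType} {disp : measure_display} {Omega : measurableType disp}
  (P : probability Omega R) {d n : nat} (E : expfam R d).
Variables (X : 'I_n -> {RV P >-> 'cV[R]_d}) (prior : 'cV[R]_d -> R).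
Hypotheses (n0 : (0 < n)%N) (Xiid : iid_from E X).
Hypotheses (mprior : measurable_fun (Theta E) prior)
  (prior0 : forall theta, Theta E theta -> 0 <= prior theta).

Local Notation th := (of_local E n).
Local Notation t0 := (theta0 E).

(** Both suprema are bounded below and have positive coefficients, so an infinite one would make
    [lambda] infinite. *)
Lemma lambda_finite (c w y : R) : (0 < d)%N -> 0 < c -> 0 < w ->
  (lambda E n c * w%:E < y%:E)%E ->
  exists B1r B2r, [/\ (B1 E n 0 <= B1r%:E)%E, (B2 E n c <= B2r%:E)%E,
    0 <= B1r, 1 <= B2r &
    6^-1 * (Num.sqrt (c * d%:R / n%:R) * B1r + c * d%:R / n%:R * B2r) * w < y].
Proof.
move=> d0 c0 w0.
have cdn : 0 < c * d%:R / n%:R by rewrite divr_gt0 ?mulr_gt0 ?ltr0n.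
have scdn : 0 < Num.sqrt (c * d%:R / n%:R) by rewrite sqrtr_gt0.
have nuE := distributionE (Ordinal n0) Xiid.
have B2g := B2_ge1 n nuE d0 (ltW c0).
have B1g : (0 <= B1 E n 0)%E.
  pose a : 'cV[R]_d := delta_mx (Ordinal d0) ord0.
  apply: (@le_trans _ _ `|expect E t0 (fun x => (Vproj E t0 a x ^+ 3)%R)|%E).
    exact: abse_ge0.
  apply: ereal_sup_ubound; exists a, t0; split => //.
    by rewrite /enorm dotv_deltal mxE !eqxx sqrtr1.
  split; first exact: theta0_Theta.
  by rewrite subrr mulmx0 /enorm dotv0r sqrtr0 expr0n/= !mul0r.
rewrite /lambda; move: B1g B2g.
case: (B1 E n 0) => [b1| |]//; case: (B2 E n c) => [b2| |]//.
- rewrite !lee_fin -!EFinM lte_fin => b10 b21 h.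
  by exists b1, b2; split.
- move=> b10 _; rewrite gt0_muley ?lte_fin// -EFinM addey// gt0_muley ?lte_fin ?invr_gt0//.
  by rewrite gt0_mulye ?lte_fin.
- move=> _ b21; rewrite gt0_muley ?lte_fin// -EFinM addye// gt0_muley ?lte_fin ?invr_gt0//.
  by rewrite gt0_mulye ?lte_fin.
- by move=> _ _; rewrite !gt0_muley ?lte_fin ?invr_gt0// gt0_mulye ?lte_fin.
Qed.

(** If an argument is not positive its logarithm is [-oo], and the left side is [+oo], also when
    both are [-oo]; the bound thus carries positivity. *)
Lemma lne_dist_le (x y b : R) : (`|lne x%:E - lne y%:E| <= b%:E)%E ->
  [/\ 0 < x, 0 < y & `|ln x - ln y| <= b].
Proof.
by rewrite /lne; case: (leP x 0) => x0; case: (leP y 0) => y0.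
Qed.

(** With [rho = sqrt (c M)], the powers of [c M] in the assumptions on [lambda] and on the prior are
    exactly those that bound [lam rho^2 rho ^ a] and [kap rho ^ a] by the tolerance [y]. *)
Lemma posterior_l1_probability_Mda (a k C Kc y eps : R) :
  let c := k ^+ 2 in let M := Mda d a in
  4 <= d%:R :> R -> 0 <= a -> 66 <= k -> 0 <= C -> 32 * (C + ln 64 + 1) <= c ->
  (forall theta, enorm (theta - t0) <= Num.sqrt (d%:R * normFV E / n%:R) * ln n%:R ->
    Theta E theta) ->
  5 * c + 1 <= ln (n%:R : R) ->
  0 < y -> 6 * y <= 2^-1 -> 23 * y < eps -> expR (- d%:R) <= y ->
  (lambda E n (c * M / d%:R) * ((c * M) `^ (1 + a / 2))%:E < y%:E)%E ->
  `|Kc * Num.sqrt (normFV E * (c * M) `^ (1 + a) / n%:R)| <= y ->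
  (ereal_sup [set lne (prior theta / prior t0)%:E | theta in Theta E] <= (C * d%:R)%:E)%E ->
  (forall theta, Theta E theta ->
     enorm (theta - t0) <= Num.sqrt (c * M / d%:R * normFV E * d%:R / n%:R) ->
     (`|lne (prior theta)%:E - lne (prior t0)%:E| <= (Kc * enorm (theta - t0))%:E)%E) ->
  (P [set w | eps%:E <= `|\int[lebesgue_cV R d]_(u in local_space E n)
     (enorm u `^ a * `|posterior E prior (fun i => X i w) u
       - gaussian_pdf (Delta E (fun i => X i w)) 1%:M u|)%:E|] <= (64 / c)%:E)%E.
Proof.
move=> c M d4 a0 k66 C0 cC ball lnn y0 y6 yeps ed hlam hK hsup hprior.
have [[Md c1] cM1 aM _ alM] := @Mda_scaled_bounds R d a k d4 a0 k66.
rewrite -/c -/M in Md c1 cM1 aM alM.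
have c0 : 0 < c by exact: lt_le_trans ltr01 c1.
have nR : 0 < n%:R :> R by rewrite ltr0n.
have dR : 0 < d%:R :> R by rewrite (lt_le_trans _ d4)// ltr0n.
have d0 : (0 < d)%N by rewrite -(ltr0n R).
have M0 : 0 < M by exact: lt_le_trans dR Md.
have cM0 : 0 < c * M by exact: mulr_gt0.
pose rho := Num.sqrt (c * M).
have rho2 : rho ^+ 2 = c * M by rewrite sqr_sqrtr// ltW.
have rho1 : 1 <= rho by rewrite -{1}sqrtr1 ler_wsqrtr.
have rho0 : 0 < rho by exact: lt_le_trans ltr01 rho1.
have rhoE : rho = (c * M) `^ 2^-1 by rewrite powR12_sqrt// ltW.
have lnrho : ln rho = ln (c * M) / 2 by rewrite rhoE ln_powR mulrC.
pose w := (c * M) `^ (1 + a / 2).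
have w1 : 1 <= w.
  by rewrite -(powRr0 (c * M)) ler_powR// addr_ge0// divr_ge0.
have w0 : 0 < w by exact: lt_le_trans ltr01 w1.
have wE : w = rho ^+ 2 * rho `^ a.
  rewrite /w powRD; last by rewrite (gt_eqF cM0) implybT.
  by rewrite powRr1 ?(ltW cM0)// rho2 rhoE -powRrM (mulrC a).
pose c' := c * M / d%:R.
have c'0 : 0 < c' by rewrite divr_gt0.
have c'E : c' * d%:R / n%:R = c * M / n%:R by rewrite /c' divfK// gt_eqF.
have [B1r [B2r [B1P B2P B1r0 B2r1 hlamy]]] := @lambda_finite c' w y d0 c'0 w0 hlam.
have c'rho : c' * d%:R / n%:R = (rho / Num.sqrt n%:R) ^+ 2.
  by rewrite c'E exprMn exprVn rho2 sqr_sqrtr// ler0n.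
have sT : Num.sqrt (c' * d%:R / n%:R) = rho / Num.sqrt n%:R.
  by rewrite c'rho sqrtr_sqr ger0_norm// divr_ge0 ?sqrtr_ge0// ltW.
pose T := rho / Num.sqrt (n%:R : R).
have T0 : 0 <= T by rewrite divr_ge0 ?sqrtr_ge0// ltW.
pose lam := 6^-1 * (T * B1r + T ^+ 2 * B2r).
have hlamy' : lam * w < y by move: hlamy; rewrite sT c'rho.
have T2lam : T ^+ 2 / 6 <= lam.
  have h1 : 0 <= T * B1r by rewrite mulr_ge0.
  have h2 : T ^+ 2 <= T ^+ 2 * B2r by rewrite ler_peMr// sqr_ge0.
  by rewrite /lam; lra.
have lam0 : 0 <= lam by apply: le_trans T2lam; rewrite divr_ge0// sqr_ge0.
have lamy : lam <= y by apply: le_trans (ltW hlamy'); rewrite ler_peMr.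
(* As the fourth moment is at least 1, the smallness of lambda forces
   (c M) ^ (2 + a / 2) <= n, hence a = O(ln n) and the ball of radius rho lies
   in the local parameter space. *)
have cMd : c * M <= d%:R * ln n%:R ^+ 2.
  apply: (@Mda_scaled_le_log R d a k n%:R) => //; rewrite -/c -/M -/w.
  have h : T ^+ 2 / 6 * w <= y.
    by apply: le_trans (ltW hlamy'); rewrite ler_wpM2r// ltW.
  have : T ^+ 2 * w <= 1 by lra.
  by rewrite -c'rho c'E mulrAC ler_pdivrMr// mul1r.
have ballrho u : enorm u <= rho -> Theta E (th u).
  move=> urho; apply: ball; apply: (le_trans (enorm_of_local E n0 u)).
  have lnn0 : 0 <= ln (n%:R : R).
    by rewrite (le_trans _ lnn)// addr_ge0// mulr_ge0// ltW.
  have -> : Num.sqrt (d%:R * normFV E / n%:R) = Num.sqrt (normFV E) * Num.sqrt d%:R / Num.sqrt n%:R.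
    by rewrite sqrtrM ?sqrtrV ?ler0n// ?mulr_ge0 ?ler0n ?opnorm_ge0// (mulrC d%:R) sqrtrM ?opnorm_ge0.
  rewrite [leRHS]mulrAC ler_wpM2r ?invr_ge0 ?sqrtr_ge0// -mulrA ler_wpM2l ?sqrtr_ge0//.
  apply: (le_trans urho); rewrite -(ger0_norm lnn0) -sqrtr_sqr -sqrtrM ?ler0n//.
  by rewrite ler_wsqrtr.
have e0 : enorm (t0 - t0) = 0 by rewrite subrr /enorm dotv0r sqrtr0.
(* At distance 0 the Lipschitz bound compares the prior with itself; through the convention on
   logarithms it yields positivity at the true parameter. *)
have := hprior t0 (theta0_Theta E).
rewrite e0 sqrtr_ge0 => /(_ isT)/lne_dist_le[pt0 _ _].
pose kap := `|Kc| * (Num.sqrt (normFV E) * rho / Num.sqrt n%:R).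
have kap0 : 0 <= kap by rewrite !mulr_ge0 ?invr_ge0 ?sqrtr_ge0// ltW.
have kapW : kap * rho `^ a <= y.
  apply: le_trans hK; rewrite normrM (ger0_norm (sqrtr_ge0 _)) /kap -mulrA ler_wpM2l//.
  rewrite (_ : (c * M) `^ (1 + a) = rho ^+ 2 * (rho `^ a) ^+ 2); last first.
    rewrite powRD; last by rewrite (gt_eqF cM0) implybT.
    by rewrite powRr1 ?(ltW cM0)// [(_ `^ a) ^+ 2]expr2 -powRM ?(ltW rho0)// -expr2 rho2.
  rewrite -exprMn sqrtr_mul_sqr_div ?opnorm_ge0 ?ler0n ?mulr_ge0 ?powR_ge0 ?(ltW rho0)//.
  by rewrite [leLHS]mulrAC -(mulrA _ rho).
have kapP u : enorm u <= rho -> 0 < prior (th u) /\ `|ln (prior (th u)) - ln (prior t0)| <= kap.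
  move=> urho.
  have dist : enorm (th u - t0) <= Num.sqrt (normFV E) * rho / Num.sqrt n%:R.
    apply: (le_trans (enorm_of_local E n0 u)).
    by rewrite ler_wpM2r ?invr_ge0 ?sqrtr_ge0// ler_wpM2l ?sqrtr_ge0.
  have rad : Num.sqrt (c * M / d%:R * normFV E * d%:R / n%:R) =
      Num.sqrt (normFV E) * rho / Num.sqrt n%:R.
    have -> : c * M / d%:R * normFV E * d%:R / n%:R = normFV E * rho ^+ 2 / n%:R.
      rewrite rho2; move: (c * M) (normFV E) (n%:R^-1) => z1 z2 z3.
      by rewrite (mulrAC z1) divfK ?(gt_eqF dR)// (mulrC z1).
    by rewrite sqrtr_mul_sqr_div ?opnorm_ge0 ?ler0n ?(ltW rho0).
  have := hprior (th u) (ballrho u urho); rewrite rad => /(_ dist)/lne_dist_le[p1 _ h].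
  split=> //; apply: (le_trans h); rewrite /kap.
  apply: (@le_trans _ _ (`|Kc| * enorm (th u - t0))).
    by rewrite ler_wpM2r ?enorm_ge0 ?ler_norm.
  by rewrite ler_wpM2l.
have CP u : Theta E (th u) -> prior (th u) / prior t0 <= expR (C * d%:R).
  move=> Tu; have [p0|p0] := leP (prior (th u) / prior t0) 0.
    by rewrite (le_trans p0)// expR_ge0.
  have : (lne (prior (th u) / prior t0)%:E <= (C * d%:R)%:E)%E.
    by apply: le_trans hsup; apply: ereal_sup_ubound; exists (th u).
  by rewrite lne_EFin// lee_fin => hln; rewrite -[leLHS]lnK ?posrE// ler_expR.
(* The size of [c] gives [c M / 32 >= (C + ln 64 + 1) d], so the exponent [C d + d ln 64 - c M / 32]
   is at most [- d]. *)
have tby : tail_bound (d := d) rho C <= y.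
  apply: le_trans ed; rewrite /tail_bound rho2.
  have -> : 64 ^+ d = expR (d%:R * ln 64) :> R by rewrite expRM_natl lnK// posrE.
  rewrite -expRD ler_expR.
  have h1 : 32 * (C + ln 64 + 1) * d%:R <= c * M.
    apply: ler_pM; rewrite ?ler0n// mulr_ge0// !addr_ge0// ln_ge0//.
    by rewrite ler1n.
  by move: (c * M) (ln 64) h1 => z l h1; lra.
(* Together with the tail this gives the totals [2 (2 y) + 2 y = 6 y] and [8 (2 y) + 7 y = 23 y]
   required of [y]. *)
have akap : (lam * rho ^+ 2 + kap) * rho `^ a <= 2 * y.
  by rewrite mulrDl -mulrA -wE; lra.
apply: (@le_trans _ _ (64 * d%:R / rho ^+ 2)%:E).
  apply: (@posterior_l1_probability _ _ _ P d n E X prior n0 Xiid mprior prior0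
    rho lam kap C a eps) => //.
  - by rewrite ler_wsqrtr// (le_trans Md)// ler_peMl ?(ltW M0).
  - by rewrite rho2.
  - by rewrite rho2 lnrho.
  - by lra.
  - by have nuE := distributionE (Ordinal n0) Xiid;
      exact: (logrem_taylor n0 nuE (ltW rho0) c'rho B1P B2P ballrho).
  - by rewrite -mulrA; lra.
  - by lra.
by rewrite lee_fin rho2 ler_pdivrMr// [leRHS]mulrA divfK ?(gt_eqF c0)// ler_wpM2l.
Qed.

End fixed_n_asymptotics.

(** * Passage to the limit *)

Lemma ge0_cvge0 (R : realType) (f : nat -> \bar R) : (forall n, 0 <= f n)%E ->
  (forall e : R, 0 < e -> \forall n \near \oo, (f n <= e%:E)%E) -> f n @[n --> \oo] --> 0%E.
Proof.
move=> f0 fle; apply/fine_cvgP; split.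
  near=> n; rewrite ge0_fin_numE// (@le_lt_trans _ _ 1%:E) ?ltry//.
  by near: n; exact: fle.
apply/cvgr0Pnorm_le => e e0; near=> n => /=.
have fe : (f n <= e%:E)%E by near: n; exact: fle.
have fn : f n \is a fin_num by rewrite ge0_fin_numE// (le_lt_trans fe)// ltry.
by rewrite ger0_norm ?fine_ge0// -lee_fin fineK.
Unshelve. all: by end_near.
Qed.

Theorem theorem2 (R : realType) (d : nat -> nat)
  (E : forall n, expfam R (d n))
  (prior : forall n, 'cV[R]_(d n) -> R)
  (K : nat -> R -> R)
  (alpha : nat -> R)
  (disp : nat -> measure_display)
  (Omega : forall n, measurableType (disp n))
  (P : forall n, probability (Omega n) R)
  (X : forall n, 'I_n -> {RV (P n) >-> 'cV[R]_(d n)})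
  (d_infty : d @ \oo --> \oo)
  (ball_sub_Theta : forall n theta,
    enorm (theta - theta0 (E n)) <=
      Num.sqrt ((d n)%:R * normFV (E n) / n%:R) * ln n%:R ->
    Theta (E n) theta)
  (X_iid : forall n, iid_from (E n) (@X n))
  (prior_ge0 : forall n theta, Theta (E n) theta -> 0 <= prior n theta)
  (prior_measurable : forall n, measurable_fun (Theta (E n)) (prior n))
  (alpha_ge0 : forall n, 0 <= alpha n)
  (cond_i : forall c : R, 0 < c ->
    (B1 (E n) n c * (Num.sqrt ((d n)%:R / n%:R))%:E)%E @[n --> \oo] --> 0%E)
  (cond_ii' : forall cbar : R, 0 < cbar ->
    (lambda (E n) n (cbar * Mda (d n) (alpha n) / (d n)%:R) *
      ((cbar * Mda (d n) (alpha n)) `^ (1 + alpha n / 2))%:E)%E @[n --> \oo] --> 0%E)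
  (cond_iii : normFV (E n) * (d n)%:R / n%:R @[n --> \oo] --> (0 : R))
  (cond_iv' : forall cbar : R, 0 < cbar ->
    assumptionP E prior K (fun n => cbar * Mda (d n) (alpha n) / (d n)%:R) /\
    K n (cbar * Mda (d n) (alpha n) / (d n)%:R) *
      Num.sqrt (normFV (E n) * (cbar * Mda (d n) (alpha n)) `^ (1 + alpha n) / n%:R)
      @[n --> \oo] --> (0 : R)) :
  is_op1 P (fun n w => (\int[lebesgue_cV R (d n)]_(u in local_space (E n) n)
    (enorm u `^ alpha n *
     `|posterior (E n) (prior n) (fun i => X n i w) u
       - gaussian_pdf (Delta (E n) (fun i => X n i w)) 1%:M u|)%:E)%E).
Proof.
move=> eps eps0; apply: ge0_cvge0 => [n|e e0]; first exact: measure_ge0.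
(* The global bound on the prior ratio does not involve [cbar], so any value yields its constant; it
   must be known before [k] is chosen. Its maximum with 0 is taken because it may be negative. *)
have [[[C' C'P] _ _] _] := cond_iv' 1 ltr01.
pose C := Num.max C' 0.
have C0 : 0 <= C by rewrite le_max lexx orbT.
(* Each summand serves one demand: 66 for the growth estimates, the middle one for the tail against
   [exp (C d) 64 ^ d], and [64 / e] for the probability bound [64 / k^2 <= e]. The last two transfer
   to [c = k^2] through [k <= k^2]. *)
pose k := 66 + 32 * (C + ln 64 + 1) + 64 / e : R.
have l64 : 0 <= ln 64 :> R by rewrite ln_ge0// ler1n.
have e64 : 0 <= 64 / e by rewrite divr_ge0// ltW.
have k66 : 66 <= k by rewrite /k; lra.
have k1 : 32 * (C + ln 64 + 1) <= k by rewrite /k; lra.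
have k2 : 64 / e <= k by rewrite /k; lra.
have kk : k <= k ^+ 2 by rewrite expr2 ler_peMl; lra.
have c0 : 0 < k ^+ 2 by rewrite exprn_gt0//; lra.
(* The first value gives [23 y < eps], the second [6 y <= 1 / 2]. *)
pose y := Num.min (eps / 24) (12^-1).
have y0 : 0 < y by rewrite lt_min divr_gt0//= invr_gt0.
have yeps : 23 * y < eps.
  have : y <= eps / 24 by rewrite ge_min lexx.
  by lra.
have y6 : 6 * y <= 2^-1.
  have : y <= 12^-1 by rewrite ge_min lexx orbT.
  by lra.
have [[_ hP _] hK] := cond_iv' _ c0.
have hlam := cond_ii' _ c0.
have y0E : (0 < y%:E)%E by rewrite lte_fin.
near=> n.
have n0 : (0 < n)%N by near: n; exact: nbhs_infty_gt.
apply: (@le_trans _ _ (64 / k ^+ 2)%:E); last first.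
  rewrite lee_fin ler_pdivrMr// mulrC -ler_pdivrMr//; exact: le_trans k2 kk.
apply: (@posterior_l1_probability_Mda _ _ _ (P n) (d n) n (E n) (X n) (prior n) n0 (X_iid n)
  (prior_measurable n) (@prior_ge0 n) (alpha n) k C
  (K n (k ^+ 2 * Mda (d n) (alpha n) / (d n)%:R)) y eps) => //.
- have : (4 <= d n)%N by near: n; exact: (d_infty _ (nbhs_infty_ge 4)).
  by rewrite -(ler_nat R).
- exact: le_trans k1 kk.
- exact: ball_sub_Theta.
- have en : expR (5 * k ^+ 2 + 1) <= n%:R by near: n; exact: nbhs_infty_ger.
  by rewrite -[leLHS]expRK ler_ln ?posrE ?expR_gt0// ltr0n.
(* Since [exp d >= 1 + d], it is enough that [d] exceeds [1 / y]. *)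
- have yd : y^-1 <= (d n)%:R.
    by near: n; exact: (d_infty _ (nbhs_infty_ger y^-1)).
  have d1 : 0 < 1 + (d n)%:R :> R by rewrite ltr_wpDr.
  rewrite expRN -[leRHS]invrK lef_pV2 ?posrE ?expR_gt0 ?invr_gt0//.
  by apply: (le_trans yd); apply: le_trans (expR_ge1Dx _); rewrite lerDr.
- by near: n; exact: (hlam _ (open_ereal_lt' y0E)).
- by near: n; exact: (cvgr0_norm_le _ hK _ y0).
- have : (ereal_sup [set lne (prior n theta / prior n (theta0 (E n)))%:E
                   | theta in Theta (E n)] <= (C' * (d n)%:R)%:E)%E by near: n.
  by move=> /le_trans; apply; rewrite lee_fin ler_wpM2r// le_max lexx.
- by near: n.
Unshelve. all: by end_near.
Qed.
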